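(* Let $k\ge1$ and $n$ be integers with $n-2k\ge4$. Then the circle quotient Stiefel manifold $Y_{n,k}$ is not parallelizable.
   Context: $V_{n,2k}$ is the real Stiefel manifold of orthonormal $2k$-tuples of vectors in $\mathbb{R}^n$. Regard $S^1=SO(2)$ as a subgroup of $SO(2k)$ via the diagonal map into the block-diagonal maximal torus $SO(2)^k\subset SO(2k)$. $SO(2k)$ acts on $V_{n,2k}$ from the right by matrix multiplication, and $Y_{n,k}=V_{n,2k}/S^1$ is the orbit space of the restricted action of $S^1$. *)

(* Defs.v *)
From HB Require Import structures.
From mathcomp Require Import all_boot all_order all_algebra.
From mathcomp Require Import generic_quotient.
From mathcomp Require Import all_classical all_reals all_analysis.
From mathcomp.real_closed Require Import mxtens.

Set Implicit Arguments.
Unset Strict Implicit.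
Unset Printing Implicit Defensive.

Import GRing.Theory Num.Theory.
Import numFieldNormedType.Exports.

Local Open Scope classical_set_scope.
Local Open Scope ring_scope.
Local Open Scope quotient_scope.

Section euclidean_smoothness.
Variables (R : realType) (E : normedModType R).

Fixpoint Cr_on (r : nat) (U : set E) (f : E -> R) : Prop :=
  match r with
  | 0 => forall x, U x -> {for x, continuous f}
  | r'.+1 => (forall x, U x -> differentiable f x) /\
             (forall v : E, Cr_on r' U (fun x => 'd f x v))
  end.

Definition smooth_on (U : set E) (f : E -> R) := forall r, Cr_on r U f.

(* Smoothness on an arbitrary subset A of a finite-dimensional E: existence of
   local smooth extensions.  When A is an embedded submanifold, this is
   smoothness for the induced manifold structure. *)
Definition smooth_subset (A : set E) : set (A -> R) :=
  [set f | forall p : A, exists (U : set E) (g : E -> R),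
     [/\ open U, U (val p), smooth_on U g &
         forall q : A, U (val q) -> f q = g (val q)]].

End euclidean_smoothness.

(* A smooth manifold M is presented by its set C of smooth real functions,
   i.e. C = C^oo(M), which determines its smooth structure.  Tangent vectors
   are point derivations of C and vector fields are derivations C -> C.
   Operators are only meaningful on functions that belong to C. *)
Section parallelizability.
Variables (R : realType) (M : Type) (C : set (M -> R)).

Definition tangent_vector (y : M) (D : (M -> R) -> R) : Prop :=
  [/\ forall f g, C f -> C g -> D (f \+ g) = D f + D g,
      forall (a : R) f, C f -> D (a \*o f) = a * D f &
      forall f g, C f -> C g -> D (f \* g) = f y * D g + g y * D f].

Definition smooth_vector_field (X : (M -> R) -> M -> R) : Prop :=
  (forall y, tangent_vector y (fun f => X f y)) /\
  (forall f, C f -> C (X f)).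

(* At every y, the tangent vectors X_i(y) form a basis of T_y M: each tangent
   vector has unique coordinates. *)
Definition smooth_global_frame (m : nat) (X : 'I_m -> (M -> R) -> M -> R) :=
  (forall i, smooth_vector_field (X i)) /\
  (forall y D, tangent_vector y D ->
     exists! c : 'rV[R]_m,
       forall f, C f -> D f = \sum_(i < m) c ord0 i * X i f y).

(* Triviality of the tangent bundle: existence of a smooth global frame.  A
   continuous frame can be approximated by a smooth one, so smoothness of the
   trivialization is no restriction. *)
Definition parallelizable : Prop :=
  exists (m : nat) (X : 'I_m -> (M -> R) -> M -> R), smooth_global_frame X.

End parallelizability.

Section circle_quotient_stiefel.
Variable R : realType.

(* Orthonormal m-tuples of vectors of R^n, as the columns of p. *)
Definition stiefel (n m : nat) : set 'M[R]_(n, m) :=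
  [set p | p^T *m p = 1%:M].

Definition special_orthogonal (m : nat) : set 'M[R]_m :=
  [set g | g^T *m g = 1%:M /\ \det g = 1].

Arguments stiefel n m : clear implicits.
Arguments special_orthogonal m : clear implicits.

Variables n k : nat.

(* The Kronecker product 1%:M *t A is the block-diagonal matrix
   diag(A, ..., A) with k blocks. *)
Definition circle : set 'M[R]_(k * 2) :=
  [set (1%:M : 'M[R]_k) *t A | A in special_orthogonal 2].

Definition circle_orbit (p q : stiefel n (k * 2)) : bool :=
  `[< exists2 g, circle g & val q = val p *m g >].

Lemma tensmx11 : (1%:M : 'M[R]_k) *t (1%:M : 'M[R]_2) = 1%:M.
Proof.
apply/matrixP => i j; case: (mxtens_indexP i) => i1 i2.
case: (mxtens_indexP j) => j1 j2; rewrite tensmxE !mxE -natrM mulnb.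
by rewrite -xpair_eqE (can_eq (@mxtens_indexK k 2)).
Qed.

Lemma circle1 : circle 1%:M.
Proof.
exists 1%:M; first by split; rewrite ?trmx1 ?mulmx1 ?det1.
exact: tensmx11.
Qed.

Lemma circleM g h : circle g -> circle h -> circle (g *m h).
Proof.
move=> [A [A1 dA] <-] [B [B1 dB] <-]; exists (A *m B); last first.
  by rewrite tensmx_mul mulmx1.
split; last by rewrite det_mulmx dA dB mulr1.
by rewrite trmx_mul mulmxA -(mulmxA _ _ A) A1 mulmx1 B1.
Qed.

Lemma circleT g : circle g -> circle g^T.
Proof.
move=> [A [A1 dA] <-]; exists A^T; last by rewrite trmx_tens trmx1.
by split; rewrite ?det_tr // trmxK; exact: mulmx1C.
Qed.

Lemma circle_orthogonal g : circle g -> g *m g^T = 1%:M.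
Proof.
move=> [A [A1 dA] <-].
by rewrite trmx_tens trmx1 tensmx_mul mulmx1 (mulmx1C A1) tensmx11.
Qed.

Lemma stiefel_circle p g :
  stiefel n (k * 2) p -> circle g -> stiefel n (k * 2) (p *m g).
Proof.
move=> pV cg; rewrite /stiefel /= trmx_mul mulmxA -(mulmxA _ _ p) pV mulmx1.
exact: mulmx1C (circle_orthogonal cg).
Qed.

Lemma circle_orbit_refl : reflexive circle_orbit.
Proof. by move=> p; apply/asboolP; exists 1%:M; [exact: circle1|rewrite mulmx1]. Qed.

Lemma circle_orbit_sym : symmetric circle_orbit.
Proof.
suff sub p q : circle_orbit p q -> circle_orbit q p.
  by move=> p q; apply/idP/idP; exact: sub.
move=> /asboolP[g cg qE]; apply/asboolP; exists g^T; first exact: circleT.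
by rewrite qE -mulmxA circle_orthogonal// mulmx1.
Qed.

Lemma circle_orbit_trans : transitive circle_orbit.
Proof.
move=> q p r /asboolP[g cg qE] /asboolP[h ch rE]; apply/asboolP.
by exists (g *m h); [exact: circleM|rewrite rE qE mulmxA].
Qed.

Canonical circle_orbit_equiv :=
  EquivRel circle_orbit circle_orbit_refl circle_orbit_sym circle_orbit_trans.

Definition circle_quotient : topologicalType :=
  quotient_topology {eq_quot circle_orbit}.

Definition circle_proj (p : stiefel n (k * 2)) : circle_quotient :=
  \pi_({eq_quot circle_orbit}) p.

(* The smooth structure for which the projection of the principal circle
   bundle is a submersion: a function on the quotient is smooth exactly when
   its pullback to the Stiefel manifold is. *)
Definition smooth_circle_quotient : set (circle_quotient -> R) :=
  [set f : circle_quotient -> R |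
     @smooth_subset R 'M[R]_(n, k * 2) (stiefel n (k * 2)) (f \o circle_proj)].

End circle_quotient_stiefel.

(* Main.v *)
(* Suppose that Y has a global frame of length m.  Lift it horizontally to V and
   add the vertical vector [p J] and the normal vectors [p S], [S] symmetric: this
   identifies the bundle V x R^m (plus R and Sym_d) with V x M_(n,d), d = 2k,
   compatibly with the circle, which acts by right multiplication on M_(n,d), by
   conjugation on Sym_d and trivially on R^(m+1).  On the quotient this says that
   n d / 2 copies of the tautological line bundle L, as real bundles, agree stably
   with the bundle associated to Sym_d, so that the first Pontryagin numbers
   n d and d^2 + 2 d agree on every CP^2 in Y on which L is tautological, hence
   n = d + 2.  The bound n >= d + 4 provides such a CP^2: the columns of the matrix of
   multiplication by z_0 + z_1 t + z_2 t^2 on complex polynomials of degree < k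
   are independent in C^(k+2), and Gram-Schmidt turns them into a frame.

   The comparison of the Pontryagin numbers is done by hand.  Let A be the
   identification above in polar coordinates on CP^2 and B a left inverse.  The
   3-form tr((B dA)^3) is closed; it has no flux through the faces of the
   coordinate box that collapse or are identified, and on the remaining face,
   the sphere of unit vectors over the line at infinity, its flux is the
   difference of the two numbers. *)
From HB Require Import structures.
Require Import Defs.
From mathcomp Require Import all_boot all_order all_algebra.
From mathcomp Require Import generic_quotient.
From mathcomp Require Import all_classical all_reals all_analysis.
From mathcomp.real_closed Require Import mxtens.
From mathcomp Require Import ring lra.
Set Implicit Arguments.
Unset Strict Implicit.
Unset Printing Implicit Defensive.

Import Order.TTheory GRing.Theory Num.Theory.
Import numFieldNormedType.Exports.

Local Open Scope classical_set_scope.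
Local Open Scope ring_scope.
Local Open Scope quotient_scope.

(** The form tr((B dA)^3) extracts a characteristic number from a single matrix function. Over the
    line at infinity the circle of psi acts with generators D1 and D2, and the flux is tr(D2^2) -
    tr(D1^2 AB). Right multiplication by J on M_(n,d) has square -1, so the first trace is -n d;
    ad(J)^2 has trace -(d^2 + 2 d) on Sym_d. The unknown length m of the frame drops out, since the
    circle acts trivially on R^(m+1); the dimension of Y is never computed.

    Two obstacles shape the rest. Tangent vectors are abstract derivations on the smooth functions
    of the quotient and have to be matched with horizontal vectors of V: projections onto the plane
    of x and x J give invariant functions that define the lift, Hadamard's lemma makes the lift
    injective, and one-parameter groups of rotations make it surjective. Moreover Sym_d is kept
    inside M_d, which avoids a choice of basis; A is then not square, but AB is a constant
    projector, and together with BA = 1 this suffices for the calculus of the form. *)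

Section differential.
Variables (R : realType) (E : normedModType R).
Implicit Types (f g : E -> R) (x v : E).

(** The epsilon form suits candidates known only through estimates: parameter integrals, and a flat
    function at the origin. *)
Lemma is_diff_eps f x (L : {linear E -> R}) : continuous L ->
  (forall e, 0 < e ->
     \forall h \near 0, `|f (h + x) - f x - L h| <= e * `|h|) ->
  is_diff x f L.
Proof.
move=> Lc H.
have fE : f \o shift x = cst (f x) + L +o_ 0 id.
  apply/eqaddoP => e e0 /=.
  near=> h; rewrite /= opprD addrA; near: h; exact: H.
have dE := diff_unique Lc fE.
apply: DiffDef => //.
by apply/diff_locallyP; split; rewrite dE.
Unshelve. all: by end_near. Qed.

Lemma diff_eps f x : differentiable f x -> forall e, 0 < e ->
  \forall h \near 0, `|f (h + x) - f x - 'd f x h| <= e * `|h|.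
Proof.
move=> /diff_locallyP[dc /eqaddoP H] e e0.
have := H e e0; apply: filterS => h /=.
by rewrite !fctE /= opprD addrA.
Qed.

Lemma near0_shift (P : E -> Prop) x : (\near x, P x) -> \forall h \near (0 : E), P (h + x).
Proof.
have shx : (fun h => h + x) @ (0 : E) --> x.
  by rewrite -[X in _ --> X]add0r; apply: cvgD; [exact: cvg_id|exact: cvg_cst].
exact: shx.
Qed.

Lemma near_eq_is_diff f g x :
  (\near x, f x = g x) -> differentiable f x -> is_diff x g ('d f x).
Proof.
move=> fg df; apply: is_diff_eps; first exact: diff_continuous.
move=> e e0; have := diff_eps df e0.
have fgh : \forall h \near 0, f (h + x) = g (h + x) by exact: near0_shift fg.
by apply: filterS2 fgh => h <-; rewrite -(nbhs_singleton fg).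
Qed.

Lemma diff_near_eq f g x v :
  (\near x, f x = g x) -> differentiable f x -> 'd g x v = 'd f x v.
Proof. by move=> fg df; rewrite [in LHS](@diff_val _ _ _ _ _ _ _ (near_eq_is_diff fg df)). Qed.

Lemma is_diffE f x (L : E -> R) v : is_diff x f L -> 'd f x v = L v.
Proof. by move=> H; rewrite [in LHS](@diff_val _ _ _ _ _ _ _ H). Qed.

Lemma diff_const_line f x v : differentiable f x ->
  (forall h : R, f (h *: v + x) = f x) -> 'd f x v = 0.
Proof.
move=> df H; rewrite -deriveE// /derive; apply: cvg_lim => //.
rewrite (_ : (fun _ => _) = cst 0); first exact: cvg_cst.
by apply/funext => h /=; rewrite H subrr scaler0.
Qed.

Lemma diff_shift f c x v : differentiable f (x + c) ->
  'd (fun y => f (y + c)) x v = 'd f (x + c) v.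
Proof.
move=> df.
have H : is_diff x (fun y => y + c) (id + 0) by apply: is_diffD.
have dfc : is_diff (x + c) f ('d f (x + c)) by exact: differentiableP.
have /is_diffE -> := @is_diff_comp _ _ _ _ _ _ _ _ _ H dfc.
by rewrite /= fctE addr0.
Qed.

End differential.

(** * Calculus of smooth functions *)

Section smooth_calculus.
Variables (R : realType) (E : normedModType R).
Implicit Types (f g : E -> R) (x v : E) (U W : set E).

Lemma Cr_onW r U f : Cr_on r.+1 U f -> Cr_on r U f.
Proof.
elim: r f => [|r IH] f [df Df]; first by move=> x Ux; exact: differentiable_continuous (df x Ux).
by split=> // v; apply: IH; exact: Df.
Qed.

Lemma Cr_on_sub r U W f : U `<=` W -> Cr_on r W f -> Cr_on r U f.
Proof.
move=> UW; elim: r f => [|r IH] f /=; first by move=> cf x /UW; exact: cf.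
by move=> [df Df]; split=> [x /UW|v]; [exact: df|apply: IH].
Qed.

Lemma Cr_on_local r U f :
  (forall x, U x -> exists W, [/\ open W, W x & Cr_on r W f]) -> Cr_on r U f.
Proof.
elim: r f => [|r IH] f H /=.
  by move=> x /H[W [_ Wx]]; apply.
split=> [x /H[W [_ Wx]] /= [df _]|v]; first exact: df.
by apply: IH => x /H[W [oW Wx]] /= [_ Df]; exists W; split.
Qed.

Lemma Cr_on_eq r U f g : open U -> (forall x, U x -> f x = g x) ->
  Cr_on r U f -> Cr_on r U g.
Proof.
move=> oU; elim: r f g => [|r IH] f g fg /=.
  move=> cf x Ux; rewrite /prop_for /continuous_at -(fg _ Ux).
  apply: cvg_trans (cf x Ux); apply: near_eq_cvg.
  exact: filterS (open_nbhs_nbhs (conj oU Ux)).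
have nfg x : U x -> \near x, f x = g x.
  by move=> Ux; exact: filterS (open_nbhs_nbhs (conj oU Ux)).
move=> [df Df]; split=> [x Ux|v].
  by case: (near_eq_is_diff (nfg _ Ux) (df _ Ux)).
apply: IH (Df v) => x Ux; by rewrite (diff_near_eq _ (nfg _ Ux) (df _ Ux)).
Qed.

Lemma Cr_on_cst r U (c : R) : Cr_on r U (fun=> c).
Proof.
suff H : forall (c : R), Cr_on r U (cst c) by exact: H.
elim: r => [|r IH] {}c /=; first by move=> x _; exact: cst_continuous.
split=> [x _|v]; first exact: differentiable_cst.
by rewrite (_ : (fun x => _) = cst 0)//; apply/funext => x /=; rewrite diff_cst.
Qed.

Lemma Cr_on_lin r U (f : {linear E -> R}) : continuous f -> Cr_on r U f.
Proof.
case: r => [|r] cf /=; first by move=> x _; exact: cf.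
split=> [x _|v]; first exact: linear_differentiable.
rewrite (_ : (fun x => _) = fun=> f v); first exact: Cr_on_cst.
by apply/funext => x /=; rewrite diff_lin.
Qed.

Lemma Cr_onD r U f g : open U -> Cr_on r U f -> Cr_on r U g ->
  Cr_on r U (fun x => f x + g x).
Proof.
move=> oU; elim: r f g => [|r IH] f g /=.
  by move=> cf cg x Ux; apply: cvgD; [exact: cf|exact: cg].
move=> [df Df] [dg Dg]; split=> [x Ux|v].
  by apply: differentiableD; [exact: df|exact: dg].
apply: (Cr_on_eq _ _ (IH _ _ (Df v) (Dg v))) => // x Ux.
by rewrite [in RHS]diffD; [|exact: df|exact: dg].
Qed.

Lemma Cr_onM r U f g : open U -> Cr_on r U f -> Cr_on r U g ->
  Cr_on r U (fun x => f x * g x).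
Proof.
move=> oU; elim: r f g => [|r IH] f g.
  by move=> cf cg x Ux; apply: cvgM; [exact: cf|exact: cg].
move=> Hf Hg; have [df Df] := Hf; have [dg Dg] := Hg; split=> [x Ux|v].
  by apply: differentiableM; [exact: df|exact: dg].
have := Cr_onD oU (IH _ _ (Cr_onW Hf) (Dg v)) (IH _ _ (Cr_onW Hg) (Df v)).
apply: Cr_on_eq => // x Ux.
by rewrite (@diffM _ _ f g); [|exact: df|exact: dg].
Qed.

Lemma Cr_onN r U f : open U -> Cr_on r U f -> Cr_on r U (fun x => - f x).
Proof.
move=> oU Hf; apply: (Cr_on_eq _ _ (Cr_onM oU (Cr_on_cst r U (-1)) Hf)) => // x _.
by rewrite mulN1r.
Qed.

Lemma Cr_onB r U f g : open U -> Cr_on r U f -> Cr_on r U g ->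
  Cr_on r U (fun x => f x - g x).
Proof. by move=> oU Hf Hg; apply: Cr_onD => //; apply: Cr_onN. Qed.

Lemma Cr_on_sum r U (I : Type) (s : seq I) (P : pred I) (F : I -> E -> R) : open U ->
  (forall i, P i -> Cr_on r U (F i)) -> Cr_on r U (fun x => \sum_(i <- s | P i) F i x).
Proof.
move=> oU H; elim: s => [|i s IH].
  by apply: (Cr_on_eq _ _ (Cr_on_cst r U 0)) => // x _; rewrite big_nil.
apply: (@Cr_on_eq _ _ (fun x => if P i then F i x + \sum_(j <- s | P j) F j x else \sum_(j <- s | P j) F j x)) => //.
  by move=> x _; rewrite big_cons.
by case Pi: (P i) => //; apply: Cr_onD => //; exact: H.
Qed.

Lemma Cr_on_prod r U (I : Type) (s : seq I) (P : pred I) (F : I -> E -> R) : open U ->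
  (forall i, P i -> Cr_on r U (F i)) -> Cr_on r U (fun x => \prod_(i <- s | P i) F i x).
Proof.
move=> oU H; elim: s => [|i s IH].
  by apply: (Cr_on_eq _ _ (Cr_on_cst r U 1)) => // x _; rewrite big_nil.
apply: (@Cr_on_eq _ _ (fun x => if P i then F i x * \prod_(j <- s | P j) F j x else \prod_(j <- s | P j) F j x)) => //.
  by move=> x _; rewrite big_cons.
by case Pi: (P i) => //; apply: Cr_onM => //; exact: H.
Qed.

(** Induction on [r] closes because the derivative of 1/f is polynomial in 1/f and the derivative of
    f. *)
Lemma Cr_onV r U f : open U -> (forall x, U x -> f x != 0) -> Cr_on r U f ->
  Cr_on r U (fun x => (f x)^-1).
Proof.
move=> oU f0; elim: r => [|r IH].
  by move=> cf x Ux; apply: cvgV; [exact: f0|exact: cf].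
move=> Hf; have [df Df] := Hf; split=> [x Ux|v].
  by apply: differentiableV; [exact: df|exact: f0].
have HV := IH (Cr_onW Hf).
have := Cr_onN oU (Cr_onM oU (Cr_onM oU HV HV) (Df v)).
apply: Cr_on_eq => // x Ux.
rewrite (@diffV _ _ f); [|exact: df|exact: f0].
by rewrite /= expr2 invfM scaleNr.
Qed.

(* Chain rule for a scalar function applied to [f], stated for a pair
   [(phi, phi')] such that [phi' \o f] is itself of class [C^r]. *)
Lemma Cr_on_comp1 r U f (phi phi' : R -> R) : open U -> Cr_on r.+1 U f ->
  (forall x, U x -> is_derive (f x) 1 phi (phi' (f x))) ->
  Cr_on r U (fun x => phi' (f x)) -> Cr_on r.+1 U (fun x => phi (f x)).
Proof.
move=> oU Hf dphi Hphi'; have [df Df] := Hf.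
have key x : U x -> is_diff x (fun y => phi (f y)) (fun v => phi' (f x) * 'd f x v).
  move=> Ux; have dx := dphi _ Ux.
  have d1 : differentiable phi (f x) by apply/derivable1_diffP.
  have /is_diff_eq := @is_diff_comp _ _ _ _ _ _ _ _ _ (differentiableP (df _ Ux)) (differentiableP d1).
  apply; apply/funext => u /=.
  by rewrite diff1E//= derive1E (@derive_val _ _ _ _ _ _ _ dx) mulrC.
split=> [x Ux|v]; first by case: (key x Ux).
apply: (Cr_on_eq _ _ (Cr_onM oU Hphi' (Df v))) => // x Ux.
by rewrite (is_diffE _ (key x Ux)).
Qed.

Lemma Cr_on_sqrt r U f : open U -> (forall x, U x -> 0 < f x) -> Cr_on r U f ->
  Cr_on r U (fun x => Num.sqrt (f x)).
Proof.
move=> oU f0; elim: r => [|r IH] Hf.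
  move=> x Ux; apply: continuous_comp; [exact: Hf|exact: sqrt_continuous].
apply: (@Cr_on_comp1 _ _ _ _ (fun y => (2 * Num.sqrt y)^-1)) => //.
  by move=> x Ux; apply: is_derive1_sqrt; exact: f0.
apply: Cr_onV => //; first by move=> x Ux; rewrite mulf_neq0// gt_eqF// sqrtr_gt0 f0.
by apply: Cr_onM => //; [exact: Cr_on_cst|exact: IH (Cr_onW Hf)].
Qed.

Lemma Cr_on_cos_sin r U f : open U -> Cr_on r U f ->
  Cr_on r U (fun x => cos (f x)) /\ Cr_on r U (fun x => sin (f x)).
Proof.
move=> oU; elim: r => [|r IH] Hf.
  split; move=> x Ux; apply: continuous_comp; by [exact: Hf|exact: continuous_cos|exact: continuous_sin].
have [Hc Hs] := IH (Cr_onW Hf).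
split; last by apply: (@Cr_on_comp1 _ _ _ _ cos).
by apply: (@Cr_on_comp1 _ _ _ _ (fun y => - sin y)) => //; exact: Cr_onN.
Qed.

End smooth_calculus.

Section composition.
Variables (R : realType) (E F : normedModType R).

Lemma continuous_sumZ (I : Type) (s : seq I) (h : I -> E -> R) (b : I -> F) (x : E) :
  (forall i, {for x, continuous (h i)}) ->
  {for x, continuous (fun x => \sum_(i <- s) h i x *: b i)}.
Proof.
move=> H; elim: s => [|i s IH].
  rewrite (_ : (fun x => _) = cst 0); first exact: cst_continuous.
  by apply/funext => y; rewrite big_nil.
rewrite (_ : (fun x => _) = (fun x => h i x *: b i + \sum_(i <- s) h i x *: b i)); last first.
  by apply/funext => y; rewrite big_cons.
by apply: cvgD => //; apply: cvgZr_tmp; exact: H.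
Qed.

Lemma is_diff_sumZ (I : Type) (s : seq I) (h : I -> E -> R) (b : I -> F) (x : E) :
  (forall i, differentiable (h i) x) ->
  is_diff x (fun x => \sum_(i <- s) h i x *: b i)
    (fun v => \sum_(i <- s) 'd (h i) x v *: b i).
Proof.
move=> H; elim: s => [|i s IH].
  rewrite (_ : (fun x => _) = cst 0); last by apply/funext => y; rewrite big_nil.
  rewrite (_ : (fun v => _) = 0); last by apply/funext => y; rewrite big_nil.
  exact: is_diff_cst.
have -> : (fun x => \sum_(j <- i :: s) h j x *: b j) =
    (fun x => h i x *: b i) + (fun x => \sum_(j <- s) h j x *: b j).
  by apply/funext => y; rewrite big_cons.
have -> : (fun v => \sum_(j <- i :: s) 'd (h j) x v *: b j) =
    (fun v => 'd (h i) x v *: b i) + (fun v => \sum_(j <- s) 'd (h j) x v *: b j).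
  by apply/funext => y; rewrite big_cons.
apply: is_diffD; apply: DiffDef; first exact: differentiableZl.
by rewrite diffZl.
Qed.

(** [Cr_on] speaks of real-valued functions only, so the regularity of the inner map is carried by
    the coefficients of a finite expansion along fixed vectors. *)
Lemma Cr_on_comp (I : finType) r (U : set E) (W : set F) (g : F -> R)
    (h : E -> F) (hi : I -> E -> R) (b : I -> F) : open U ->
  (forall x, h x = \sum_i hi i x *: b i) ->
  (forall i, Cr_on r U (hi i)) -> (forall x, U x -> W (h x)) ->
  Cr_on r W g -> Cr_on r U (fun x => g (h x)).
Proof.
move=> oU hE Hi UW; have {hE}hE : h = fun x => \sum_i hi i x *: b i by exact/funext.
elim: r g Hi => [|r IH] g Hi.
  move=> cg x Ux; apply: continuous_comp; last exact/cg/UW.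
  by rewrite hE; apply: continuous_sumZ => i; exact: Hi.
move=> [dg Dg].
have key x : U x -> is_diff x (fun y => g (h y)) (fun v => \sum_i 'd (hi i) x v * 'd g (h x) (b i)).
  move=> Ux.
  have H1 : is_diff x h (fun v => \sum_i 'd (hi i) x v *: b i).
    by rewrite hE; apply: is_diff_sumZ => i; have [+ _] := Hi i; apply.
  have /is_diff_eq := @is_diff_comp _ _ _ _ _ _ _ _ _ H1 (differentiableP (dg _ (UW _ Ux))).
  apply; apply/funext => v /=; rewrite linear_sum; apply: eq_bigr => i _.
  by rewrite linearZ.
split=> [x Ux|v]; first by case: (key _ Ux).
have Hi' i : Cr_on r U (hi i) by exact: Cr_onW.
apply: (@Cr_on_eq _ _ _ _ (fun x => \sum_i 'd (hi i) x v * 'd g (h x) (b i))) => //.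
  by move=> x Ux; rewrite (is_diffE _ (key _ Ux)).
apply: Cr_on_sum => // i _; apply: Cr_onM => //; first by have [_ +] := Hi i; exact.
exact: (IH (fun y => 'd g y (b i)) Hi' (Dg (b i))).
Qed.

End composition.

Section matrix_space.
Variable R : realType.

Lemma Cr_on_comp_mx (E : normedModType R) a b r (U : set E) (W : set 'M[R]_(a, b))
    (g : 'M[R]_(a, b) -> R) (h : E -> 'M[R]_(a, b)) : open U ->
  (forall i j, Cr_on r U (fun x => h x i j)) -> (forall x, U x -> W (h x)) ->
  Cr_on r W g -> Cr_on r U (fun x => g (h x)).
Proof.
move=> oU Hh; apply: (@Cr_on_comp _ _ _ _ r U W g h (fun ij x => h x ij.1 ij.2)
  (fun ij => delta_mx ij.1 ij.2)) => // x.
by rewrite {1}[h x]matrix_sum_delta pair_bigA.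
Qed.

Lemma Cr_on_coord a b r (U : set 'M[R]_(a, b)) i j : Cr_on r U (fun M => M i j).
Proof.
have lf : linear (fun M : 'M[R]_(a, b) => M i j) by move=> c u v; rewrite !mxE.
pose fM := GRing.isLinear.Build _ _ _ _ _ lf.
pose f : {linear _ -> _} := HB.pack (fun M : 'M[R]_(a, b) => M i j) fM.
by apply: (@Cr_on_lin _ _ _ _ f); exact: coord_continuous.
Qed.

End matrix_space.

(** * Mean value theorem along lines and symmetry of second derivatives *)

Section mean_value.
Variables (R : realType) (E : normedModType R).
Implicit Types (f : E -> R) (x v w : E).

Lemma is_derive_line f x v (s : R) : differentiable f (s *: v + x) ->
  is_derive s 1 (fun s : R => f (s *: v + x)) ('d f (s *: v + x) v).
Proof.
move=> df.
have H : is_diff s (fun s : R => s *: v + x) (( *:%R^~ v) + (cst 0)).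
  by apply: is_diffD.
have D := @is_diff_comp _ _ _ _ _ _ _ _ _ H (differentiableP df).
have [D1 D2] := D.
have D3 : derivable (fun s : R => f (s *: v + x)) s 1 by apply/derivable1_diffP.
apply: DeriveDef => //; rewrite deriveE//.
by rewrite -[LHS]/('d (f \o (fun s : R => s *: v + x)) s 1) D2 /= fctE /= scale1r addr0.
Qed.

Lemma line_MVT f x v (h : R) : 0 <= h ->
  (forall s, 0 <= s <= h -> differentiable f (s *: v + x)) ->
  exists2 s, 0 <= s <= h & f (h *: v + x) - f x = h * 'd f (s *: v + x) v.
Proof.
move=> h0 df.
have [|c|s] := @MVT_segment R (fun s : R => f (s *: v + x)) (fun s : R => 'd f (s *: v + x) v) 0 h h0.
- move=> s; rewrite in_itv /= => /andP[/ltW s0 /ltW sh].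
  by apply: is_derive_line; apply: df; rewrite s0.
- apply: derivable_within_continuous => s; rewrite in_itv /= => sh.
  by have [] := is_derive_line (df _ sh).
- rewrite in_itv /= => sh; rewrite scale0r add0r subr0 mulrC => H.
  by exists s.
Qed.

(** Two uses of the mean value theorem write the second difference over the parallelogram with sides
    h v and h w as h^2 times a mixed derivative at a nearby point. The difference is symmetric in v
    and w, and both mixed derivatives are continuous at [x]. *)
Lemma schwarz f x v w : Cr_on 2 setT f ->
  'd (fun y => 'd f y v) x w = 'd (fun y => 'd f y w) x v.
Proof.
move=> Hf; have [df0 Df] := Hf; have df y : differentiable f y by exact: df0.
have dd u y : differentiable (fun y => 'd f y u) y by have [+ _] := Df u; exact.
have cc u u' : {for x, continuous (fun y => 'd (fun y => 'd f y u) y u')}.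
  by have [_ /(_ u')] := Df u; apply.
have step v' w' h : 0 <= h -> exists s t, [/\ 0 <= s <= h, 0 <= t <= h &
    f (h *: v' + (h *: w' + x)) - f (h *: v' + x) - (f (h *: w' + x) - f x) =
    h * (h * 'd (fun y => 'd f y v') (t *: w' + (s *: v' + x)) w')].
  move=> h0.
  have dshift y : differentiable (fun y => f (h *: w' + y)) y.
    rewrite (_ : (fun y => _) = f \o (fun y => y + h *: w')); last first.
      by apply/funext => z /=; rewrite addrC.
    by apply: differentiable_comp => //; apply: differentiableD.
  have [s sh] := @line_MVT (fun y => f (h *: w' + y) - f y) x v' h h0
    (fun s _ => differentiableB (dshift _) (df _)).
  have -> : 'd (fun y => f (h *: w' + y) - f y) (s *: v' + x) v' =
      'd f (h *: w' + (s *: v' + x)) v' - 'd f (s *: v' + x) v'.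
    have H1 := @is_diffB _ _ _ _ _ _ _ _ (differentiableP (dshift (s *: v' + x))) (differentiableP (df (s *: v' + x))).
    rewrite (is_diffE v' H1) fctE /=; congr (_ - _).
    rewrite (_ : (fun y => _) = (fun y => f (y + h *: w'))); last first.
      by apply/funext => z; rewrite addrC.
    by rewrite diff_shift addrC// addrC.
  have [t th ->] := @line_MVT _ (s *: v' + x) w' h h0 (fun t _ => dd v' (t *: w' + (s *: v' + x))).
  move=> E0; exists s, t; split => //; rewrite -E0.
  by rewrite (addrCA (h *: v')); ring.
apply/eqP; rewrite -subr_eq0 -normr_le0; apply/ler_addgt0Pr => e e0; rewrite add0r.
have e2 : 0 < e / 2 by rewrite divr_gt0.
have /cvgrPdist_lt /(_ _ e2) /nbhs_ballP[d1 /= d10 H1] := cc v w.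
have /cvgrPdist_lt /(_ _ e2) /nbhs_ballP[d2 /= d20 H2] := cc w v.
(* Small enough to keep all intermediate points within both radii of [x]; the summand 1 covers v = w
   = 0. *)
pose h := Num.min d1 d2 / (2 * (1 + `|v| + `|w|)).
have m0 : 0 < Num.min d1 d2 by rewrite lt_min d10.
have den : 0 < 1 + `|v| + `|w| by rewrite ltr_wpDr// ltr_wpDr.
have h0 : 0 < h by rewrite divr_gt0// mulr_gt0.
have hb s t v' w' : `|v'| + `|w'| = `|v| + `|w| -> 0 <= s <= h -> 0 <= t <= h ->
    `|x - (t *: w' + (s *: v' + x))| < Num.min d1 d2.
  move=> vw /andP[s0 sh] /andP[t0 th].
  rewrite addrA opprD addrCA subrr addr0.
  rewrite normrN; apply: (@le_lt_trans _ _ (h * (`|v| + `|w|))).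
    by rewrite -vw (addrC `|v'|) mulrDr (le_trans (ler_normD _ _))// !normrZ (ger0_norm t0) (ger0_norm s0) lerD// ler_wpM2r.
  apply: (@lt_le_trans _ _ (h * (2 * (1 + `|v| + `|w|)))); last first.
    by rewrite /h divfK// gt_eqF// mulr_gt0.
  rewrite ltr_pM2l//; have := normr_ge0 v; have := normr_ge0 w; lra.
have [s [t [sh th E1]]] := step v w h (ltW h0).
have [s' [t' [sh' th' E2]]] := step w v h (ltW h0).
have EE : 'd (fun y => 'd f y v) (t *: w + (s *: v + x)) w =
          'd (fun y => 'd f y w) (t' *: v + (s' *: w + x)) v.
  have hn : h != 0 by rewrite gt_eqF.
  apply: (mulfI hn); apply: (mulfI hn); rewrite -E1 -E2 (addrCA (h *: v)).
  ring.
have := H1 (t *: w + (s *: v + x)); have := H2 (t' *: v + (s' *: w + x)).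
rewrite -!ball_normE /= EE => {}H2 {}H1.
have b1 := hb s t v w erefl sh th.
have b2 := hb s' t' w v (addrC _ _) sh' th'.
move: b1 b2; rewrite !lt_min => /andP[/H1 b1 _] /andP[_ /H2 b2].
set a := 'd _ x w in b1 *; set b := 'd _ x v in b2 *; set c := 'd _ _ v in b1 b2.
have -> : a - b = (a - c) + (c - b) by ring.
rewrite (le_trans (ler_normD _ _))// (splitr e) lerD// ltW//.
by rewrite distrC.
Qed.

End mean_value.

(** * Integrals of continuous functions over the unit interval *)

Section unit_integral.
Variable R : realType.
Implicit Types g : R -> R.

Definition unit_int g : R := \int[@lebesgue_measure R]_(t in `[0, 1]) g t.

(** Continuity is two-sided in the line even at 0 and 1; the integrands below are defined beyond the
    segment. *)
Definition unit_cont g := forall t, 0 <= t <= 1 -> {for t, continuous g}.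

Lemma unit_cont_within g : unit_cont g -> {within `[0, 1], continuous g}.
Proof.
by move=> cg; apply: continuous_in_subspaceT => t; rewrite inE /= in_itv /=; exact: cg.
Qed.

Lemma unit_cont_integrable g : unit_cont g ->
  (@lebesgue_measure R).-integrable `[0, 1] (EFin \o g).
Proof.
move=> cg; apply: continuous_compact_integrable; first exact: segment_compact.
exact: unit_cont_within.
Qed.

Lemma unit_intB g h : unit_cont g -> unit_cont h ->
  unit_int (fun t => g t - h t) = unit_int g - unit_int h.
Proof. by move=> cg ch; apply: RintegralB => //; exact: unit_cont_integrable. Qed.

Lemma unit_intD g h : unit_cont g -> unit_cont h ->
  unit_int (fun t => g t + h t) = unit_int g + unit_int h.
Proof. by move=> cg ch; apply: RintegralD => //; exact: unit_cont_integrable. Qed.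

Lemma unit_intZ c g : unit_cont g -> unit_int (fun t => c * g t) = c * unit_int g.
Proof. by move=> cg; apply: RintegralZl => //; exact: unit_cont_integrable. Qed.

Lemma unit_contZ c g : unit_cont g -> unit_cont (fun t => c * g t).
Proof. by move=> cg t ht; apply: cvgM; [exact: cvg_cst|exact: cg]. Qed.

Lemma unit_cont_sum (I : Type) (s : seq I) (g : I -> R -> R) :
  (forall i, unit_cont (g i)) -> unit_cont (fun t => \sum_(i <- s) g i t).
Proof.
move=> cg; elim: s => [|i s IH].
  by rewrite (_ : (fun _ => _) = cst 0); [move=> ? _; exact: cst_continuous|
    apply/funext => t; rewrite big_nil].
rewrite (_ : (fun _ => _) = (fun t => g i t + \sum_(i <- s) g i t)); last first.
  by apply/funext => t; rewrite big_cons.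
by move=> t ht; apply: cvgD; [exact: cg|exact: IH].
Qed.

Lemma unit_int_sum (I : Type) (s : seq I) (g : I -> R -> R) :
  (forall i, unit_cont (g i)) ->
  unit_int (fun t => \sum_(i <- s) g i t) = \sum_(i <- s) unit_int (g i).
Proof.
move=> cg; elim: s => [|i s IH].
  rewrite big_nil (_ : (fun _ => _) = fun=> 0); last by apply/funext => t; rewrite big_nil.
  by rewrite /unit_int Rintegral_cst// mul0r.
rewrite big_cons -IH -unit_intD//; last exact: unit_cont_sum.
by congr unit_int; apply/funext => t; rewrite big_cons.
Qed.

Lemma unit_int_le g (e : R) : unit_cont g -> (forall t, 0 <= t <= 1 -> `|g t| <= e) ->
  `|unit_int g| <= e.
Proof.
move=> cg ge; apply: (le_trans (le_normr_Rintegral _ (unit_cont_integrable cg))) => //.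
rewrite [leRHS](_ : e = unit_int (fun=> e)); last first.
  rewrite /unit_int Rintegral_cst// [X in fine X](_ : _ = 1%E) ?mulr1//.
  by have := @lebesgue_measure_itv R `[0, 1]%R; rewrite /= lte_fin ltr01 oppr0 adde0 => <-.
apply: le_Rintegral => //.
- apply: (@unit_cont_integrable (fun t => `|g t|)) => t ht.
  by apply: cvg_norm; exact: cg.
- by apply: (@unit_cont_integrable (fun=> e)) => t _; exact: cst_continuous.
Qed.

Lemma unit_int_FTC G g : (forall t : R, 0 <= t <= 1 -> is_derive t 1 G (g t)) ->
  unit_cont g -> unit_int g = G 1 - G 0.
Proof.
move=> dG cg.
have cG t : 0 <= t <= 1 -> {for t, continuous G}.
  by move=> ht; apply/differentiable_continuous/derivable1_diffP; case: (dG _ ht).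
rewrite /unit_int /Rintegral (@continuous_FTC2 _ g G 0 1)//.
- exact: unit_cont_within.
- split; first by move=> t; rewrite in_itv /= => /andP[t0 t1]; case: (dG t) => //; rewrite !ltW.
  + by apply: cvg_at_right_filter; apply: cG; rewrite lexx ler01.
  + by apply: cvg_at_left_filter; apply: cG; rewrite lexx ler01.
- move=> t; rewrite in_itv /= => /andP[t0 t1]; rewrite derive1E.
  by have [_] := dG t (introT andP (conj (ltW t0) (ltW t1))).
Qed.

End unit_integral.

(** * Hadamard's lemma and bump functions *)

Section hadamard.
Variables (R : realType) (a b : nat) (w0 : 'M[R]_(a, b)) (rho : R).
Notation E := 'M[R]_(a, b).
Let B : set E := ball w0 rho.

Let seg (w : E) (t : R) : E := t *: (w - w0) + w0.

Lemma ball_open_set : open B. Proof. exact: ball_open. Qed.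

Let seg_ball (w : E) (t : R) : 0 <= t <= 1 -> B w -> B (seg w t).
Proof.
move=> /andP[t0 t1]; rewrite /B -!ball_normE /= => wB.
rewrite /seg opprD addrCA subrr addr0 normrN normrZ ger0_norm//.
by apply: le_lt_trans wB; rewrite distrC ler_piMl.
Qed.

Let seg_cont w t : {for t, continuous (seg w)}.
Proof.
apply: cvgD; last exact: cvg_cst.
by apply: cvgZr_tmp; exact: cvg_id.
Qed.

(* The remainder factors of Hadamard's lemma are of this form with [j = 0]; the
   class [{ray_int j K}] is closed under differentiation. *)
Definition ray_int j (K : E -> R) (w : E) : R := unit_int (fun t => t ^+ j * K (seg w t)).

Let ray_cont j K w : Cr_on 0 B K -> B w -> unit_cont (fun t => t ^+ j * K (seg w t)).
Proof.
move=> cK Bw t ht; apply: cvgM; first exact: exprn_continuous.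
by apply: continuous_comp; [exact: seg_cont|exact/cK/seg_ball].
Qed.

Lemma diff_coords (K : E -> R) x (v : E) :
  'd K x v = \sum_i \sum_j v i j * 'd K x (delta_mx i j).
Proof.
rewrite {1}[v]matrix_sum_delta linear_sum; apply: eq_bigr => i _.
by rewrite linear_sum; apply: eq_bigr => j _; rewrite linearZ.
Qed.

Let entry_le (v : E) i j : `|v i j| <= `|v|.
Proof.
rewrite [leRHS]/Num.norm/= mx_normrE.
by apply: (le_bigmax _ (fun ij : 'I_a * 'I_b => `|v ij.1 ij.2|) (i, j)).
Qed.

Let coord_incr_bound (f1 f2 : E -> R) (h : E) (eta : R) :
  f1 h = \sum_i \sum_j h i j * f1 (delta_mx i j) ->
  f2 h = \sum_i \sum_j h i j * f2 (delta_mx i j) ->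
  (forall i j, `|f1 (delta_mx i j) - f2 (delta_mx i j)| <= eta) ->
  `|f1 h - f2 h| <= (a * b)%:R * eta * `|h|.
Proof.
move=> -> -> H; rewrite -sumrB; apply: (le_trans (ler_norm_sum _ _ _)).
apply: (@le_trans _ _ (\sum_(i < a) \sum_(j < b) eta * `|h|)); last first.
  by rewrite !sumr_const !card_ord -mulrnA -mulrA mulr_natl mulnC.
apply: ler_sum => i _; rewrite -sumrB; apply: (le_trans (ler_norm_sum _ _ _)).
apply: ler_sum => j _; by rewrite -mulrBr normrM mulrC ler_pM//.
Qed.

Let scaled_incr_bound (f1 f2 : E -> R) (h u : E) (eta t : R) :
  f1 u = t * f1 h -> 0 <= t <= 1 ->
  f1 h = \sum_i \sum_j h i j * f1 (delta_mx i j) ->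
  f2 h = \sum_i \sum_j h i j * f2 (delta_mx i j) ->
  (forall i j, `|f1 (delta_mx i j) - f2 (delta_mx i j)| <= eta) ->
  `|f1 u - t * f2 h| <= (a * b)%:R * eta * `|h|.
Proof.
move=> -> /andP[t0 t1] c1 c2 /(coord_incr_bound c1 c2) H.
by rewrite -mulrBr normrM ger0_norm//; apply: le_trans H; rewrite ler_piMl.
Qed.

Let dist_via (x y z eta : R) : `|x - y| < eta -> `|x - z| < eta -> `|z - y| <= eta + eta.
Proof.
move=> H1 H2; have -> : z - y = (x - y) - (x - z) by ring.
by rewrite (le_trans (ler_normB _ _))// lerD// ltW.
Qed.

Let diff_scale (K : E -> R) (c h u : E) (t : R) : u = t *: h -> 'd K c u = t * 'd K c h.
Proof. by move=> ->; exact: (linearZ_LR ('d K c) t h). Qed.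

(** The mean value theorem reduces the error to the oscillation of the partial derivatives, which
    compactness of [0, 1] controls uniformly along the segment from [w0] to [w]. *)
Let uniform_diff (K : E -> R) w (e : R) : 0 < e -> Cr_on 1 B K -> B w ->
  \forall h \near (0 : E), forall t, 0 <= t <= 1 ->
   `|K (t *: h + seg w t) - K (seg w t) - t * 'd K (seg w t) h| <= e * `|h|.
Proof.
move=> e0 [dK DK] Bw.
(* The successor keeps [N] nonzero when the matrices have no entries. *)
pose N : R := (a * b).+1%:R.
have N0 : 0 < N by rewrite ltr0n.
have /compact_near_coveringP cov := @segment_compact R 0 1.
pose P (h : E) (t : R) := 0 <= t <= 1 ->
   `|K (t *: h + seg w t) - K (seg w t) - t * 'd K (seg w t) h| <= e * `|h|.
have /cov : forall t0 : R, `[0, 1]%classic t0 -> \forall t \near t0 & h \near (0 : E), P h t.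
  move=> t0; rewrite /= in_itv /= => t01.
  set c0 := seg w t0.
  have Bc0 : B c0 by exact: seg_ball.
  have eta0 : 0 < e / (2 * N) by rewrite divr_gt0// mulr_gt0.
  have : \forall c \near c0, forall ij : 'I_a * 'I_b,
      `|'d K c0 (delta_mx ij.1 ij.2) - 'd K c (delta_mx ij.1 ij.2)| < e / (2 * N).
    apply: (@filter_forall E _ (fun ij c => `|'d K c0 (delta_mx ij.1 ij.2) -
      'd K c (delta_mx ij.1 ij.2)| < e / (2 * N)) (nbhs c0)) => -[i j] /=.
    have /cvgrPdist_lt := DK (delta_mx i j) c0 Bc0.
    exact.
  move=> nc; have : \forall c \near c0, B c.
    exact: open_nbhs_nbhs (conj ball_open_set Bc0).
  move=> /(filterI nc) /nbhs_ballP[d /= d0 Hd].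
  have d20 : 0 < d / 2 by rewrite divr_gt0.
  have /cvgrPdist_lt /(_ _ d20) near_t := @seg_cont w t0.
  near=> t h => /=.
  have tt : `|c0 - seg w t| < d / 2 by near: t.
  have hh : `|h| < d / 2.
    near: h; apply/nbhs_ballP; exists (d / 2) => //= z.
    by rewrite -ball_normE /= sub0r normrN.
  move=> t1; have /andP[t_ge0 t_le1] := t1.
  have [u uE] : {u | u = t *: h} by exists (t *: h).
  rewrite -uE.
  have inb s : 0 <= s <= 1 -> ball c0 d (s *: u + seg w t).
    move=> /andP[s0 s1]; rewrite -ball_normE /= opprD addrCA.
    rewrite (splitr d) addrC (le_lt_trans (ler_normB _ _))// ltr_leD//.
    rewrite uE !normrZ !ger0_norm//.
    apply: (le_trans _ (ltW hh)); rewrite mulrA ler_piMl//.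
    by rewrite -[leRHS]mulr1 ler_pM.
  have [||s s01] := @line_MVT _ _ K (seg w t) u 1.
  - by [].
  - by move=> s /inb /Hd[_ Bc]; exact: dK.
  rewrite scale1r mul1r => ->.
  apply: (@le_trans _ _ ((a * b)%:R * (e / N) * `|h|)).
    apply: (scaled_incr_bound (diff_scale K (s *: u + seg w t) uE) t1
      (diff_coords K (s *: u + seg w t) h) (diff_coords K (seg w t) h)) => i j.
    have [H1 _] := Hd _ (inb s s01).
    have in0 : ball c0 d (seg w t).
      by have := inb 0; rewrite scale0r add0r; apply; rewrite lexx ler01.
    have [H2 _] := Hd _ in0.
    have -> : e / N = e / (2 * N) + e / (2 * N) by field; rewrite gt_eqF.
    exact: dist_via (H2 (i, j)) (H1 (i, j)).
  rewrite ler_wpM2r// mulrCA ler_piMr// ?(ltW e0)// ler_pdivrMr// mul1r /N ler_nat.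
  exact: leqnSn.
by apply: filterS => h H t t01; apply: H => //=; rewrite in_itv.
Unshelve. all: by end_near. Qed.

(** Differentiation under the integral sign. Moving [w] by h moves the point at parameter t by t h,
    so the exponent grows by one. *)
Lemma diff_ray_int j K w : Cr_on 1 B K -> B w ->
  is_diff w (ray_int j K) (fun v => ray_int j.+1 (fun x => 'd K x v) w).
Proof.
move=> cK Bw; have [dK DK] := cK.
have cD v : unit_cont (fun t => t ^+ j.+1 * 'd K (seg w t) v).
  exact: (@ray_cont j.+1 (fun x => 'd K x v) w (DK v) Bw).
have LE v : ray_int j.+1 (fun x => 'd K x v) w =
    \sum_(ij : 'I_a * 'I_b) v ij.1 ij.2 * ray_int j.+1 (fun x => 'd K x (delta_mx ij.1 ij.2)) w.
  rewrite /ray_int.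
  transitivity (unit_int (fun t => \sum_(ij : 'I_a * 'I_b) v ij.1 ij.2 * (t ^+ j.+1 * 'd K (seg w t) (delta_mx ij.1 ij.2)))).
    congr unit_int; apply/funext => t; rewrite diff_coords pair_bigA mulr_sumr.
    by apply: eq_bigr => ij _; rewrite mulrCA.
  rewrite unit_int_sum; last by move=> ij; exact: unit_contZ.
  by apply: eq_bigr => ij _; rewrite unit_intZ.
have lin : linear (fun v => ray_int j.+1 (fun x => 'd K x v) w).
  move=> c u v; rewrite !LE scaler_sumr -big_split; apply: eq_bigr => ij _.
  by rewrite !mxE mulrDl scalerAl.
pose LM := GRing.isLinear.Build _ _ _ _ _ lin.
pose L : {linear E -> R} := HB.pack (fun v => ray_int j.+1 (fun x => 'd K x v) w) LM.
have Lc : continuous L.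
  have -> : (L : E -> R) = fun v => \sum_(ij : 'I_a * 'I_b) v ij.1 ij.2 *:
      (ray_int j.+1 (fun x => 'd K x (delta_mx ij.1 ij.2)) w : R^o).
    exact/funext/LE.
  move=> v; apply: (@continuous_sumZ _ _ R^o _ _ (fun ij (M : E) => M ij.1 ij.2)) => ij.
  exact: coord_continuous.
apply: (is_diff_eps Lc) => e e0.
have nB : \forall h \near (0 : E), B (h + w).
  have nw : \near w, B w by exact: open_nbhs_nbhs (conj ball_open_set Bw).
  exact: near0_shift nw.
apply: filterS2 nB (uniform_diff e0 cK Bw) => h Bh Hh.
have segE t : seg (h + w) t = t *: h + seg w t.
  by rewrite /seg -!addrA scalerDr addrA.
rewrite /= /ray_int -unit_intB; [|exact: ray_cont (Cr_onW cK) Bh|exact: ray_cont (Cr_onW cK) Bw].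
rewrite -unit_intB//; last first.
  move=> t t01; apply: cvgB.
    exact: (ray_cont (Cr_onW cK) Bh t01).
  exact: (ray_cont (Cr_onW cK) Bw t01).
apply: unit_int_le.
  move=> t t01; apply: cvgB; last exact: cD.
  apply: cvgB.
    exact: (ray_cont (Cr_onW cK) Bh t01).
  exact: (ray_cont (Cr_onW cK) Bw t01).
move=> t t01; rewrite segE exprSr -mulrBr -mulrA -mulrBr normrM.
have /andP[t0 t1] := t01.
rewrite -[leRHS]mul1r ler_pM//; last exact: Hh.
by rewrite ger0_norm ?exprn_ge0// exprn_ile1.
Qed.

Lemma Cr_on_ray_int r j K : smooth_on B K -> Cr_on r B (ray_int j K).
Proof.
elim: r j K => [|r IH] j K sK.
  move=> x Bx; apply: differentiable_continuous.
  by case: (diff_ray_int j (sK 1%N) Bx).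
split=> [x Bx|v]; first by case: (diff_ray_int j (sK 1%N) Bx).
apply: (Cr_on_eq _ _ (IH j.+1 (fun x => 'd K x v) _)).
- exact: ball_open_set.
- move=> x Bx; exact: esym (is_diffE v (diff_ray_int j (sK 1%N) Bx)).
- by move=> s; have [_] := sK s.+1; exact.
Qed.

Lemma hadamard (F : E -> R) : smooth_on B F ->
  exists2 H : 'I_a -> 'I_b -> E -> R, forall i j, smooth_on B (H i j) &
    forall w, B w -> F w = F w0 + \sum_i \sum_j (w i j - w0 i j) * H i j w.
Proof.
move=> sF; exists (fun i j => ray_int 0 (fun x => 'd F x (delta_mx i j))).
  by move=> i j r; apply: Cr_on_ray_int => s; have [_] := sF s.+1; exact.
move=> w Bw; have [dF DF] := sF 1%N.
have cF v : unit_cont (fun t => 'd F (seg w t) v).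
  move=> t t01; apply: (@continuous_comp _ _ _ (seg w) (fun x => 'd F x v)).
    exact: seg_cont.
  exact: (DF v _ (seg_ball t01 Bw)).
have := @unit_int_FTC _ (fun t : R => F (seg w t)) (fun t => 'd F (seg w t) (w - w0)).
rewrite /seg scale1r subrK scale0r add0r => H.
have {}H := H (fun t t01 => @is_derive_line _ _ F w0 (w - w0) t (dF _ (seg_ball t01 Bw))) (cF (w - w0)).
rewrite -[LHS](subrK (F w0)) addrC; congr (_ + _); rewrite -{}H.
transitivity (unit_int (fun t => \sum_(ij : 'I_a * 'I_b) (w ij.1 ij.2 - w0 ij.1 ij.2) * (t ^+ 0 * 'd F (seg w t) (delta_mx ij.1 ij.2)))).
  congr unit_int; apply/funext => t; rewrite diff_coords pair_bigA.
  by apply: eq_bigr => ij _; rewrite !mxE expr0 mul1r.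
have cF' v : unit_cont (fun t => t ^+ 0 * 'd F (seg w t) v).
  exact: (@ray_cont 0 (fun x => 'd F x v) w (DF v) Bw).
rewrite unit_int_sum; last by move=> ij; exact: unit_contZ.
by rewrite pair_bigA; apply: eq_bigr => ij _; rewrite unit_intZ.
Qed.

End hadamard.

Section flat.
Variable R : realType.

(** The powers of 1/t make the family stable under differentiation up to linear combinations, so
    that one induction proves the smoothness of e^(-1/t) extended by 0. *)
Definition flat n (t : R) : R := if 0 < t then t^-1 ^+ n * expR (- t^-1) else 0.

(** Raise s <= e^s, at s = 1/((n+1) t), to the power n + 1. *)
Lemma flat_bound n (t : R) : 0 < t -> t^-1 ^+ n * expR (- t^-1) <= n.+1%:R ^+ n.+1 * t.
Proof.
move=> t0; rewrite expRN ler_pdivrMr ?expR_gt0//.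
have N0 : 0 < n.+1%:R :> R by rewrite ltr0n.
have H : (n.+1%:R^-1 * t^-1) ^+ n.+1 <= expR t^-1.
  have -> : expR t^-1 = expR (n.+1%:R^-1 * t^-1) ^+ n.+1.
    by rewrite -expRM_natl mulrA divff ?mul1r// gt_eqF.
  rewrite ler_pXn2r// ?nnegrE ?mulr_ge0 ?invr_ge0 ?expR_ge0 ?(ltW t0)//.
  by apply: le_trans (expR_ge1Dx _); rewrite lerDr.
apply: (@le_trans _ _ (n.+1%:R ^+ n.+1 * t * (n.+1%:R^-1 * t^-1) ^+ n.+1)).
  rewrite exprMn mulrACA -exprMn divff ?gt_eqF// expr1n mul1r exprS mulrA divff ?mul1r//.
  by rewrite gt_eqF.
by rewrite ler_wpM2l// mulr_ge0 ?exprn_ge0// ltW.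
Qed.

Lemma is_derive_flat n (t : R) : is_derive t 1 (flat n) (- n%:R * flat n.+1 t + flat n.+2 t).
Proof.
have [t0|t0|<-] := ltgtP 0 t.
- have tn0 : t != 0 by rewrite gt_eqF.
  have D1 : is_derive t (1 : R) (fun s : R => s^-1) (- t ^- 2).
    by have := @is_deriveV _ id t 1 1 tn0 (is_derive_id t 1); rewrite scaler1.
  have D2 := @is_derive1_comp _ expR (fun s : R => - s^-1) t _ _
    (is_derive_expR _) (is_deriveN D1).
  have D3 := is_deriveM (is_deriveX n D1) D2.
  have nfg : \forall s \near t, ((fun s : R => s^-1) ^+ n * (expR \o (fun s : R => - s^-1))) s = flat n s.
    near=> s; rewrite /flat ifT//; last by near: s; exact: lt_nbhsr.
    by rewrite !fctE.
  apply: (is_derive_eq (near_eq_is_derive nfg D3)).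
  rewrite /flat t0 !fctE /=.
  case: n {nfg D3} => [|n] /=.
    by rewrite expr0 mul0r scale0r scaler0 oppr0 mul0r addr0 add0r /GRing.scale /= mul1r; field.
  by rewrite /GRing.scale /= -!exprVn !exprS; ring.
- rewrite /flat ltNge (ltW t0) /= mulr0 addr0.
  apply: (@near_eq_is_derive _ _ _ (cst 0)).
  near=> s; rewrite /= ifF//; apply/negbTE; rewrite -leNgt ltW//.
  by near: s; exact: lt_nbhsl.
- rewrite /flat ltxx mulr0 addr0 -/(flat n).
  have lin0 : is_diff (0 : R) (flat n) (\0 : {linear R -> R}).
    apply: is_diff_eps => [|e e0]; first exact: cst_continuous.
    pose C : R := n.+2%:R ^+ n.+2.
    have C0 : 0 < C by rewrite exprn_gt0// ltr0n.
    near=> h; rewrite /= addr0 {2}/flat ltxx subr0 subr0 /flat.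
    case: ifP => [h0|_]; last by rewrite normr0 mulr_ge0// ltW.
    (* One factor h is split off; what remains is O(h) by [flat_bound], so the derivative at 0
       vanishes. *)
    have -> : h^-1 ^+ n * expR (- h^-1) = h * (h^-1 ^+ n.+1 * expR (- h^-1)).
      by rewrite exprS !mulrA divff ?mul1r// gt_eqF.
    rewrite normrM mulrC ler_wpM2r// ger0_norm; last first.
      by rewrite mulr_ge0 ?expR_ge0// exprn_ge0// invr_ge0 ltW.
    apply: (le_trans (flat_bound _ h0)); rewrite -/C -ler_pdivlMl// mulrC.
    rewrite -[leLHS]gtr0_norm//; near: h.
    apply/nbhs_ballP; exists (e / C) => /=; first by rewrite divr_gt0.
    by move=> z; rewrite -ball_normE /= sub0r normrN => /ltW.
  have [d1 d2] := lin0.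
  have D3 : derivable (flat n) 0 1 by apply/derivable1_diffP.
  by apply: DeriveDef => //; rewrite deriveE// d2.
Unshelve. all: by end_near. Qed.

Lemma Cr_on_flat (E : normedModType R) r n (U : set E) f : open U -> Cr_on r U f ->
  Cr_on r U (fun x => flat n (f x)).
Proof.
move=> oU; elim: r n => [|r IH] n Hf.
  move=> x Ux; apply: continuous_comp; first exact: Hf.
  apply/differentiable_continuous/derivable1_diffP.
  by case: (is_derive_flat n (f x)).
apply: (@Cr_on_comp1 _ _ _ _ _ _ (fun t => - n%:R * flat n.+1 t + flat n.+2 t)) => //.
  by move=> x _; exact: is_derive_flat.
have Hf' := Cr_onW Hf.
apply: Cr_onD => //; last exact: IH.
by apply: Cr_onM => //; [exact: Cr_on_cst|exact: IH].
Qed.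

Lemma bump_function a b (w0 : 'M[R]_(a, b)) (rho : R) : 0 < rho ->
  exists chi : 'M[R]_(a, b) -> R, [/\ smooth_on setT chi, chi w0 != 0 &
    forall w, chi w != 0 -> ball w0 rho w].
Proof.
move=> rho0.
(* The matrix norm is the maximum norm, which is not smooth; the squared Euclidean distance is
   smooth and dominates its square. *)
pose q (w : 'M[R]_(a, b)) := rho ^+ 2 - \sum_i \sum_j (w i j - w0 i j) * (w i j - w0 i j).
exists (fun w => flat 0 (q w)); split.
- move=> r; apply: Cr_on_flat; first exact: openT.
  apply: Cr_onB; [exact: openT|exact: Cr_on_cst|].
  apply: Cr_on_sum; first exact: openT.
  move=> i _; apply: Cr_on_sum; first exact: openT.
  move=> j _; apply: Cr_onM; first exact: openT.
    by apply: Cr_onB; [exact: openT|exact: Cr_on_coord|exact: Cr_on_cst].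
  by apply: Cr_onB; [exact: openT|exact: Cr_on_coord|exact: Cr_on_cst].
- rewrite /flat /q big1 ?subr0; last first.
    by move=> i _; rewrite big1// => j _; rewrite subrr mul0r.
  by rewrite exprn_gt0// expr0 mul1r gt_eqF// expR_gt0.
- move=> w; rewrite /flat; case: ifP; last by rewrite eqxx.
  rewrite /q subr_gt0 => qlt _; rewrite -ball_normE /=.
  rewrite [ltLHS]/Num.norm/= mx_normrE; apply/bigmax_ltP; split=> // -[i j] _ /=.
  rewrite !mxE -(ltr_pXn2r (n := 2))// ?nnegrE ?(ltW rho0)// -normrX ger0_norm ?sqr_ge0//.
  apply: le_lt_trans qlt; rewrite (bigD1 i)//= (bigD1 j)//= -expr2 -sqrrN opprB.
  rewrite -addrA lerDl addr_ge0// sumr_ge0// => *; rewrite ?sqr_ge0//.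
  by rewrite sumr_ge0// => *; rewrite -expr2 sqr_ge0.
Qed.

End flat.

(** * The complex structure and the circle *)

Section frobenius.
Variables (R : realType) (n d : nat).
Implicit Types u v w : 'M[R]_(n, d).

Definition dotm u v : R := \tr (u^T *m v).

Lemma dotmE u v : dotm u v = \sum_i \sum_j u i j * v i j.
Proof.
rewrite /dotm /mxtrace exchange_big; apply: eq_bigr => i _.
by rewrite mxE; apply: eq_bigr => j _; rewrite mxE.
Qed.

Lemma dotmC u v : dotm u v = dotm v u.
Proof. by rewrite /dotm -mxtrace_tr trmx_mul trmxK. Qed.

Lemma dotmDl u v w : dotm (u + v) w = dotm u w + dotm v w.
Proof. by rewrite /dotm linearD mulmxDl linearD. Qed.

Lemma dotmDr u v w : dotm w (u + v) = dotm w u + dotm w v.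
Proof. by rewrite dotmC dotmDl !(dotmC w). Qed.

Lemma dotmZl c u v : dotm (c *: u) v = c * dotm u v.
Proof. by rewrite /dotm linearZ -scalemxAl linearZ. Qed.

Lemma dotmZr c u v : dotm u (c *: v) = c * dotm u v.
Proof. by rewrite dotmC dotmZl dotmC. Qed.

Lemma dotmNl u v : dotm (- u) v = - dotm u v.
Proof. by rewrite -scaleN1r dotmZl mulN1r. Qed.

Lemma dotmNr u v : dotm u (- v) = - dotm u v.
Proof. by rewrite dotmC dotmNl dotmC. Qed.

Lemma dotm_eq0 u : dotm u u = 0 -> u = 0.
Proof.
rewrite dotmE => /eqP; rewrite psumr_eq0; last first.
  by move=> i _; apply: sumr_ge0 => j _; rewrite -expr2 sqr_ge0.
move=> /allP H; apply/matrixP => i j; rewrite mxE; apply/eqP.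
have := H i (mem_index_enum _) => /=; rewrite psumr_eq0; last by move=> *; rewrite -expr2 sqr_ge0.
by move=> /allP/(_ j (mem_index_enum _)) /=; rewrite mulf_eq0 orbb.
Qed.

End frobenius.

Section complex_structure.
Variables (R : realType) (d : nat) (J : 'M[R]_d).
Hypotheses (JT : J^T = - J) (JJ : J *m J = - 1%:M).

Definition rotJ (a b : R) : 'M[R]_d := a%:M + b *: J.

Lemma JT_J : J^T *m J = 1%:M.
Proof. by rewrite JT mulNmx JJ opprK. Qed.

Lemma trJ0 : \tr J = 0.
Proof.
have : \tr J = - \tr J by rewrite -{1}mxtrace_tr JT linearN.
lra.
Qed.

Section frames.
Variable n : nat.
Implicit Types u v p x e : 'M[R]_(n, d).

Lemma mulJJ u : u *m J *m J = - u.
Proof. by rewrite -mulmxA JJ mulmxN mulmx1. Qed.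

Lemma mul_rotJ u a b : u *m rotJ a b = a *: u + b *: (u *m J).
Proof. by rewrite /rotJ mulmxDr mul_mx_scalar -scalemxAr. Qed.

Lemma dotmJ u v : dotm (u *m J) v = - dotm u (v *m J).
Proof.
rewrite /dotm trmx_mul JT mulNmx mulNmx linearN /=; congr (- _).
by rewrite -mulmxA mxtrace_mulC mulmxA.
Qed.

Lemma dotmJJ u v : dotm (u *m J) (v *m J) = dotm u v.
Proof. by rewrite dotmJ mulJJ dotmNr opprK. Qed.

Lemma dotm_uuJ u : dotm u (u *m J) = 0.
Proof.
by have : dotm u (u *m J) = - dotm u (u *m J); [rewrite -dotmJ dotmC|lra].
Qed.

(** For [x] in the Stiefel manifold this is d times the orthogonal projection of [v] onto the plane
    of x and x J. It depends only on the circle orbit of [x], so its entries are smooth functions on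
    the quotient. *)
Definition proj2 x v : 'M[R]_(n, d) := dotm x v *: x + dotm (x *m J) v *: (x *m J).

Lemma proj2_rot x v a b : a ^+ 2 + b ^+ 2 = 1 -> proj2 (x *m rotJ a b) v = proj2 x v.
Proof.
move=> ab; have {}ab : a ^+ 2 = 1 - b ^+ 2 by rewrite -ab addrK.
rewrite /proj2 mul_rotJ mulmxDl -!scalemxAl mulJJ.
rewrite !dotmDl !dotmZl dotmNl; apply/matrixP => i j; rewrite !mxE.
ring: ab.
Qed.

Lemma proj2D x u v : proj2 x (u + v) = proj2 x u + proj2 x v.
Proof. by rewrite /proj2 !dotmDr !scalerDl addrACA. Qed.

Lemma proj2Z x c v : proj2 x (c *: v) = c *: proj2 x v.
Proof. by rewrite /proj2 !dotmZr scalerDr !scalerA. Qed.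

Lemma proj2_mulJ x v : proj2 x (v *m J) = proj2 x v *m J.
Proof.
rewrite /proj2 mulmxDl -!scalemxAl mulJJ scalerN dotmJJ.
have -> : dotm x (v *m J) = - dotm (x *m J) v by rewrite dotmJ opprK.
by rewrite scaleNr addrC.
Qed.

Lemma dotm_stiefel x : x^T *m x = 1%:M -> dotm x x = d%:R.
Proof. by move=> xx; rewrite /dotm xx mxtrace1. Qed.

Lemma proj2_self p : p^T *m p = 1%:M -> proj2 p p = d%:R *: p.
Proof.
move=> pV; rewrite /proj2 dotm_stiefel// dotmC dotm_uuJ scale0r addr0//.
Qed.

Lemma dotm_proj2_pJ x p : dotm (p *m J) (proj2 x p) = 0.
Proof.
by rewrite /proj2 dotmDr !dotmZr dotmJJ (dotmJ x p) (dotmC p x) (dotmC (p *m J) x); ring.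
Qed.

Lemma dotm_proj2_proj2 x p : x^T *m x = 1%:M ->
  dotm (proj2 x p) (proj2 x p) = d%:R * dotm p (proj2 x p).
Proof.
move=> xV; rewrite /proj2 !dotmDl !dotmDr !dotmZl !dotmZr dotmJJ.
rewrite (dotmC (x *m J) x) dotm_uuJ (dotm_stiefel xV) (dotmC p x) (dotmC p (x *m J)).
ring.
Qed.

Lemma proj2E x p : proj2 x p = x *m rotJ (dotm x p) (dotm (x *m J) p).
Proof. by rewrite mul_rotJ. Qed.

Lemma rotJ_TM a b : (rotJ a b)^T *m rotJ a b = (a ^+ 2 + b ^+ 2)%:M.
Proof.
rewrite /rotJ [(_ + _)^T]linearD /= tr_scalar_mx [(_ *: J)^T]linearZ /= JT scalerN.
rewrite -!(scalemx1 _ a) -scalemx1 mulmxBl !mulmxDr -!scalemxAl -!scalemxAr !mul1mx !mulmx1 JJ.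
by apply/matrixP => i j; rewrite !mxE; ring.
Qed.

(** By [proj2E] the matrix is [x] times a complex scalar, so its columns are orthogonal and of equal
    length. Differentiating this identity will show that lifted vectors are tangent. *)
Lemma proj2_TM x p : x^T *m x = 1%:M ->
  (proj2 x p)^T *m proj2 x p = (dotm p (proj2 x p))%:M.
Proof.
move=> xV; rewrite {1 2}proj2E trmx_mul mulmxA -(mulmxA _ _ x) xV mulmx1 rotJ_TM.
congr (_%:M); rewrite /proj2 dotmDr !dotmZr (dotmC p x) (dotmC p (x *m J)); ring.
Qed.

Definition symm (S : 'M[R]_d) : 'M[R]_d := 2^-1 *: (S + S^T).

Lemma tr_symm S : (symm S)^T = symm S.
Proof. by rewrite /symm linearZ linearD /= trmxK addrC. Qed.

Lemma symm_id S : S^T = S -> symm S = S.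
Proof. by move=> ST; rewrite /symm ST -[S + S]mulr2n -[S *+ 2]scaler_nat scalerA mulVf ?scale1r// pnatr_eq0. Qed.

Definition tangent p u := p^T *m u + u^T *m p = 0.

Lemma tangent_J p : p^T *m p = 1%:M -> tangent p (p *m J).
Proof.
by move=> pV; rewrite /tangent trmx_mul -mulmxA pV mulmx1 JT mulmxA pV mul1mx subrr.
Qed.

Lemma tangent_decomp p u : p^T *m p = 1%:M -> tangent p (u - p *m symm (p^T *m u)).
Proof.
move=> pV; rewrite /tangent mulmxBr mulmxA pV mul1mx linearB /= mulmxBl trmx_mul tr_symm.
rewrite -mulmxA pV mulmx1 /symm trmx_mul trmxK.
move: (p^T *m u) (u^T *m p) => A B.
by apply/matrixP => i j; rewrite !mxE; field.
Qed.

Lemma tangent_normal p u S : p^T *m p = 1%:M -> tangent p u -> u + p *m symm S = 0 ->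
  u = 0 /\ symm S = 0.
Proof.
move=> pV tu /eqP; rewrite addr_eq0 => /eqP uE.
have S0 : symm S = 0.
  move: tu; rewrite /tangent uE [(- _)^T]linearN /= trmx_mul tr_symm mulNmx mulmxN mulmxA pV.
  rewrite mul1mx -mulmxA pV mulmx1 => /matrixP SS; apply/matrixP => i j; have := SS i j; rewrite !mxE.
  move: (S i j + S j i) => s; lra.
by split=> //; rewrite uE S0 mulmx0 oppr0.
Qed.

(** The orthogonal group acts transitively on the Stiefel manifold, hence infinitesimally too. The
    first two terms of the witness send p to t - p t^T p; the third restores the missing part. *)
Lemma skew_transitive p t : p^T *m p = 1%:M -> tangent p t ->
  exists2 W : 'M[R]_n, W^T = - W & W *m p = t.
Proof.
move=> pV tp; exists (t *m p^T - p *m t^T + p *m (t^T *m p) *m p^T); last first.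
  rewrite !mulmxDl mulNmx -!mulmxA pV !mulmx1.
  by rewrite subrK.
have sk : p^T *m t = - (t^T *m p) by apply/eqP; rewrite -addr_eq0; apply/eqP.
rewrite [(_ + _)^T]linearD /= [(_ - _)^T]linearB /= !trmx_mul !trmxK sk mulNmx mulmxN.
by rewrite !opprD opprK !mulmxA; congr (_ - _); rewrite addrC.
Qed.

End frames.
End complex_structure.

Section rotation_structure.
Variable R : realType.

Definition rot90 : 'M[R]_2 := \matrix_(i, j) ((j < i)%:R - (i < j)%:R).

Lemma rot90T : rot90^T = - rot90.
Proof. by apply/matrixP => i j; rewrite !mxE opprB. Qed.

Lemma rot90_sqr : rot90 *m rot90 = - 1%:M.
Proof.
apply/matrixP => i j; rewrite !mxE !big_ord_recl big_ord0 !mxE.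
by case: i => [[|[|]]]//= ?; case: j => [[|[|]]]//= ?; rewrite /=; ring.
Qed.

Lemma ord2 (i : 'I_2) : i = 0 \/ i = 1.
Proof. by case: i => [[|[|//]] hi]; [left|right]; exact/val_inj. Qed.

Lemma det2 (A : 'M[R]_2) : \det A = A 0 0 * A 1 1 - A 0 1 * A 1 0.
Proof.
have l1 : lift ord0 ord0 = 1 :> 'I_2 by apply/val_inj.
have l0 : lift (1 : 'I_2) ord0 = 0 :> 'I_2 by apply/val_inj.
rewrite (expand_det_row _ 0) !big_ord_recl big_ord0 /cofactor !det_mx11 !mxE !l1 !l0 /=.
by rewrite expr0 expr1; ring.
Qed.

Lemma special_orthogonal2P (A : 'M[R]_2) : @special_orthogonal R 2 A ->
  exists a b, a ^+ 2 + b ^+ 2 = 1 /\ A = rotJ rot90 a b.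
Proof.
move=> [AA dA]; exists (A 0 0), (A 1 0).
have E00 := congr1 (fun M : 'M[R]_2 => M 0 0) AA.
have E11 := congr1 (fun M : 'M[R]_2 => M 1 1) AA.
move: E00 E11; rewrite !mxE !big_ord_recl !big_ord0 !mxE /= => E00 E11.
have := dA; rewrite det2 => E.
have l1 : lift ord0 ord0 = 1 :> 'I_2 by apply/val_inj.
move: E00 E11; rewrite !l1 !addr0 => E00 E11.
(* This is the squared norm of [A] minus 2 det A, that is 2 - 2. *)
have : (A 0 0 - A 1 1) ^+ 2 + (A 0 1 + A 1 0) ^+ 2 = 0.
  have -> : (A 0 0 - A 1 1) ^+ 2 + (A 0 1 + A 1 0) ^+ 2 =
    (A 0 0 * A 0 0 + A 1 0 * A 1 0) + (A 0 1 * A 0 1 + A 1 1 * A 1 1) - 2 * (A 0 0 * A 1 1 - A 0 1 * A 1 0) by ring.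
  by rewrite E00 E11 E /=; ring.
move=> /eqP; rewrite paddr_eq0 ?sqr_ge0// !sqrf_eq0 subr_eq0 addr_eq0.
move=> /andP[/eqP e1 /eqP e2]; split; first by rewrite !expr2.
apply/matrixP => i j; rewrite !mxE.
by have [->|->] := ord2 i; have [->|->] := ord2 j; rewrite /= ?mulr1n ?mulr0n ?e1 ?e2; ring.
Qed.

Lemma rot90_special a b : a ^+ 2 + b ^+ 2 = 1 -> @special_orthogonal R 2 (rotJ rot90 a b).
Proof.
move=> ab; split; first by rewrite rotJ_TM ?rot90T ?rot90_sqr// ab.
by rewrite -[RHS]ab det2 !mxE ?eqE /= ?mulr1n ?mulr0n; ring.
Qed.

Variable k : nat.

Definition stdJ : 'M[R]_(k * 2) := (1%:M : 'M[R]_k) *t rot90.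

Lemma stdJT : stdJ^T = - stdJ.
Proof. by rewrite /stdJ trmx_tens trmx1 rot90T; apply/matrixP => i j; rewrite !mxE mulrN. Qed.

Lemma stdJJ : stdJ *m stdJ = - 1%:M.
Proof.
rewrite /stdJ tensmx_mul mulmx1 rot90_sqr -(tensmx11 R k).
by apply/matrixP => i j; rewrite !mxE mulrN.
Qed.

Lemma tens_rotJ a b : (1%:M : 'M[R]_k) *t rotJ rot90 a b = rotJ stdJ a b.
Proof.
rewrite /rotJ /stdJ -!(scalemx1 _ a) -(tensmx11 R k).
by apply/matrixP => i j; rewrite !mxE; ring.
Qed.

Lemma circleP (g : 'M[R]_(k * 2)) :
  @circle R k g <-> exists a b, a ^+ 2 + b ^+ 2 = 1 /\ g = rotJ stdJ a b.
Proof.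
split=> [[A /special_orthogonal2P[a [b [ab ->]]] <-]|[a [b [ab ->]]]].
  by exists a, b; rewrite tens_rotJ.
by exists (rotJ rot90 a b); [exact: rot90_special|rewrite tens_rotJ].
Qed.

End rotation_structure.

Section smooth_subset_algebra.
Variables (R : realType) (E : normedModType R) (A : set E).
Implicit Types f g : A -> R.

Lemma smooth_subsetD f g : smooth_subset f -> smooth_subset g -> smooth_subset (f \+ g).
Proof.
move=> Hf Hg p; have [U [F [oU Up sF fF]]] := Hf p; have [W [G [oW Wp sG gG]]] := Hg p.
exists (U `&` W), (F \+ G); split => //; first exact: openI.
  move=> r; apply: Cr_onD; first exact: openI.
    by apply: Cr_on_sub (sF r); exact: subIsetl.
  by apply: Cr_on_sub (sG r); exact: subIsetr.
by move=> q [/fF fq /gG gq] /=; rewrite fq gq.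
Qed.

Lemma smooth_subsetM f g : smooth_subset f -> smooth_subset g -> smooth_subset (f \* g).
Proof.
move=> Hf Hg p; have [U [F [oU Up sF fF]]] := Hf p; have [W [G [oW Wp sG gG]]] := Hg p.
exists (U `&` W), (F \* G); split => //; first exact: openI.
  move=> r; apply: Cr_onM; first exact: openI.
    by apply: Cr_on_sub (sF r); exact: subIsetl.
  by apply: Cr_on_sub (sG r); exact: subIsetr.
by move=> q [/fF fq /gG gq] /=; rewrite fq gq.
Qed.

Lemma smooth_subset_restr (F : E -> R) : smooth_on setT F -> @smooth_subset R E A (fun p => F (val p)).
Proof. by move=> sF p; exists setT, F; split => //; exact: openT. Qed.

End smooth_subset_algebra.

(** * Tangent vectors of the quotient *)

Section quotient_functions.
Variables (R : realType) (n k : nat).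
Notation d := (k * 2)%N.
Notation J := (stdJ R k).
Notation M := 'M[R]_(n, k * 2).
Notation V := (@stiefel R n (k * 2)).
Notation Y := (circle_quotient R n k).
Notation C := (@smooth_circle_quotient R n k).

(** The choice is arbitrary, so smoothness in [y] is claimed only for circle-invariant expressions
    in [rep y]. *)
Definition rep (y : Y) : M := val (repr (y : {eq_quot @circle_orbit R n k})).

Lemma rep_stiefel y : (rep y)^T *m rep y = 1%:M.
Proof. by have /set_mem := valP (repr (y : {eq_quot @circle_orbit R n k})). Qed.

Lemma rep_proj (p : V) : exists a b, a ^+ 2 + b ^+ 2 = 1 /\
  rep (circle_proj p) = val p *m rotJ J a b.
Proof.
have : circle_orbit p (repr (circle_proj p : {eq_quot @circle_orbit R n k})).
  by rewrite -[circle_orbit _ _]eqmodE reprK.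
by move=> /asboolP[g /circleP[a [b [ab ->]]] E]; exists a, b.
Qed.

Lemma circle_proj_eq (p q : V) a b : a ^+ 2 + b ^+ 2 = 1 ->
  val q = val p *m rotJ J a b -> circle_proj p = circle_proj q.
Proof.
move=> ab E; apply/eqmodP/asboolP; exists (rotJ J a b) => //.
by apply/circleP; exists a, b.
Qed.

Definition inv_fun (F : M -> R) := forall x a b, a ^+ 2 + b ^+ 2 = 1 -> F (x *m rotJ J a b) = F x.

Lemma inv_fun_proj F (p : V) : inv_fun F -> F (rep (circle_proj p)) = F (val p).
Proof. by move=> H; have [a [b [ab ->]]] := rep_proj p; exact: H. Qed.

Lemma smooth_inv_fun F : inv_fun F -> smooth_on setT F -> C (fun y => F (rep y)).
Proof.
move=> iF sF; rewrite /smooth_circle_quotient /=.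
rewrite (_ : _ \o _ = fun p : V => F (val p)); first exact: smooth_subset_restr.
by apply/funext => p /=; exact: inv_fun_proj.
Qed.

Lemma C_add f g : C f -> C g -> C (f \+ g).
Proof. exact: smooth_subsetD. Qed.

Lemma C_mul f g : C f -> C g -> C (f \* g).
Proof. exact: smooth_subsetM. Qed.

Lemma C_cst c : C (fun=> c).
Proof. by apply: (@smooth_inv_fun (fun=> c)) => // r; exact: Cr_on_cst. Qed.

Lemma C_sum (I : Type) (s : seq I) (F : I -> Y -> R) :
  (forall i, C (F i)) -> C (fun y => \sum_(i <- s) F i y).
Proof.
move=> HF; elim: s => [|i s IH].
  by rewrite (_ : (fun _ => _) = fun=> 0); [exact: C_cst|apply/funext => y; rewrite big_nil].
rewrite (_ : (fun _ => _) = F i \+ (fun y => \sum_(i <- s) F i y)); first exact: C_add.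
by apply/funext => y; rewrite big_cons.
Qed.

Section tangent_vectors.
Variables (y : Y) (D : (Y -> R) -> R).
Hypothesis tD : tangent_vector C y D.

Lemma tv_add f g : C f -> C g -> D (fun y => f y + g y) = D f + D g.
Proof. by have [H _ _] := tD; exact: H. Qed.

Lemma tv_mul f g : C f -> C g -> D (fun y => f y * g y) = f y * D g + g y * D f.
Proof. by have [_ _ H] := tD; exact: H. Qed.

Lemma tv_scale a f : C f -> D (fun y => a * f y) = a * D f.
Proof. by have [_ H _] := tD; exact: H. Qed.

Lemma tv_cst a : D (fun=> a) = 0.
Proof.
have H1 : D (fun=> 1) = 0.
  have := tv_mul (C_cst 1) (C_cst 1).
  have -> : (fun y => (fun=> 1) y * (fun=> 1) y) = (fun=> 1) :> (Y -> R).
    by apply/funext => ?; rewrite mul1r.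
  rewrite !mul1r; lra.
have := tv_scale a (C_cst 1); rewrite H1 mulr0 => <-.
by congr D; apply/funext => ?; rewrite mulr1.
Qed.

Lemma tv_sum (I : Type) (s : seq I) (F : I -> Y -> R) : (forall i, C (F i)) ->
  D (fun y => \sum_(i <- s) F i y) = \sum_(i <- s) D (F i).
Proof.
move=> HF; elim: s => [|i s IH].
  rewrite big_nil -[RHS](tv_cst 0); congr D.
  by apply/funext => z; rewrite big_nil.
rewrite big_cons -IH -tv_add//; last exact: C_sum.
by congr D; apply/funext => z; rewrite big_cons.
Qed.

End tangent_vectors.

Lemma proj2_inv v i j : inv_fun (fun x => proj2 J x v i j).
Proof. by move=> x a b ab; rewrite proj2_rot// ?stdJT// stdJJ. Qed.

Lemma Cr_on_entry r (U : set M) (T : 'M[R]_(k * 2)) i j : open U ->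
  Cr_on r U (fun x : M => (x *m T) i j).
Proof.
move=> oU; apply: (@Cr_on_eq _ _ _ _ (fun x : M => \sum_l x i l * T l j)) => //.
  by move=> x _; rewrite mxE.
by apply: Cr_on_sum => // l _; apply: Cr_onM => //; [exact: Cr_on_coord|exact: Cr_on_cst].
Qed.

Lemma Cr_on_dotm r (E : normedModType R) (U : set E) a b (F G : E -> 'M[R]_(a, b)) : open U ->
  (forall i j, Cr_on r U (fun x => F x i j)) -> (forall i j, Cr_on r U (fun x => G x i j)) ->
  Cr_on r U (fun x => dotm (F x) (G x)).
Proof.
move=> oU HF HG; apply: (@Cr_on_eq _ _ _ _ (fun x => \sum_i \sum_j F x i j * G x i j)) => //.
  by move=> x _; rewrite dotmE.
by apply: Cr_on_sum => // i _; apply: Cr_on_sum => // j _; apply: Cr_onM.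
Qed.

Lemma proj2_smooth (v : M) i j : smooth_on setT (fun x : M => proj2 J x v i j).
Proof.
move=> r; apply: (@Cr_on_eq _ _ _ _ (fun x : M => dotm x v * x i j + dotm (x *m J) v * (x *m J) i j)).
- exact: openT.
- by move=> x _; rewrite /proj2 !mxE.
apply: Cr_onD; [exact: openT| |]; apply: Cr_onM; try exact: openT.
- by apply: Cr_on_dotm => [|? ?|? ?]; [exact: openT|exact: Cr_on_coord|exact: Cr_on_cst].
- exact: Cr_on_coord.
- by apply: Cr_on_dotm => [|? ?|? ?]; [exact: openT|apply: Cr_on_entry; exact: openT|exact: Cr_on_cst].
- by apply: Cr_on_entry; exact: openT.
Qed.

Definition pfun v i j : Y -> R := fun y => proj2 J (rep y) v i j.

Lemma C_pfun v i j : C (pfun v i j).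
Proof. exact: smooth_inv_fun (proj2_inv v i j) (proj2_smooth v i j). Qed.

(* The horizontal lift at [p] of a tangent vector [D] of the quotient: the
   invariant map [x |-> proj2 J x p] has derivative [d *: u] at [p] along a
   horizontal tangent vector [u]. *)
Definition hlift (D : (Y -> R) -> R) (p : M) : M :=
  d%:R^-1 *: \matrix_(i, j) D (pfun p i j).

Section lifts.
Hypothesis k0 : (0 < k)%N.
Variables (p : V) (D : (Y -> R) -> R).
Hypothesis tD : tangent_vector C (circle_proj p) D.
Let p0 := val p.

Let pV : p0^T *m p0 = 1%:M.
Proof. by have /set_mem := valP p. Qed.

Let d0 : d%:R != 0 :> R.
Proof. by rewrite pnatr_eq0 -lt0n muln_gt0 k0. Qed.

Let D_pfun i j : D (pfun p0 i j) = d%:R * hlift D p0 i j.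
Proof. by rewrite !mxE mulrA mulfV// mul1r. Qed.

Let pfun_at v i j : pfun v i j (circle_proj p) = proj2 J p0 v i j.
Proof. exact: (inv_fun_proj _ (proj2_inv v i j)). Qed.

Let pfun_at_p i j : pfun p0 i j (circle_proj p) = d%:R * p0 i j.
Proof. by rewrite pfun_at proj2_self ?mxE// ?stdJT// stdJJ. Qed.

Let D_dot v : D (fun y => dotm v (proj2 J (rep y) p0)) = d%:R * dotm v (hlift D p0).
Proof.
transitivity (D (fun y => \sum_(ij : 'I_n * 'I_(k * 2)) v ij.1 ij.2 * pfun p0 ij.1 ij.2 y)).
  by congr D; apply/funext => y; rewrite dotmE pair_bigA.
have Cv ij : C (fun y => v ij.1 ij.2 * pfun p0 ij.1 ij.2 y).
  by apply: C_mul; [exact: C_cst|exact: C_pfun].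
rewrite (tv_sum tD)// dotmE pair_bigA mulr_sumr; apply: eq_bigr => ij _ /=.
by rewrite (tv_scale tD) ?D_pfun; [rewrite mulrCA|exact: C_pfun].
Qed.

Lemma lift_dotJ : dotm (p0 *m J) (hlift D p0) = 0.
Proof.
apply: (mulfI d0); rewrite -D_dot mulr0 -[RHS](tv_cst tD 0); congr D; apply/funext => y.
by rewrite dotm_proj2_pJ// ?stdJT// stdJJ.
Qed.

(** With P = [proj2 J x], apply [D] to |P p|^2 = d <p, P p>. Since P p = d p at the base point, the
    Leibniz rule on the left gives twice what the right side gives. *)
Lemma lift_dot : dotm p0 (hlift D p0) = 0.
Proof.
have := D_dot p0 => E.
have C1 : C (fun y => dotm p0 (proj2 J (rep y) p0)).
  rewrite (_ : (fun _ => _) = fun y => \sum_(ij : 'I_n * 'I_(k * 2)) p0 ij.1 ij.2 * pfun p0 ij.1 ij.2 y).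
    by apply: C_sum => ij; apply: C_mul; [exact: C_cst|exact: C_pfun].
  by apply/funext => y; rewrite dotmE pair_bigA.
have E1 : D (fun y => dotm (proj2 J (rep y) p0) (proj2 J (rep y) p0)) =
    d%:R * (d%:R * dotm p0 (hlift D p0)).
  rewrite -E -(tv_scale tD _ C1); congr D; apply/funext => y.
  by rewrite dotm_proj2_proj2 ?stdJT ?stdJJ// rep_stiefel.
have E2 : D (fun y => dotm (proj2 J (rep y) p0) (proj2 J (rep y) p0)) =
    2 * (d%:R * (d%:R * dotm p0 (hlift D p0))).
  transitivity (D (fun y => \sum_(ij : 'I_n * 'I_(k * 2)) pfun p0 ij.1 ij.2 y * pfun p0 ij.1 ij.2 y)).
    by congr D; apply/funext => y; rewrite dotmE pair_bigA.
  rewrite (tv_sum tD); last by move=> ij; apply: C_mul; exact: C_pfun.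
  rewrite [in RHS]dotmE pair_bigA /= !mulr_sumr; apply: eq_bigr => ij _.
  by rewrite (tv_mul tD) ?D_pfun ?pfun_at_p; try exact: C_pfun; ring.
apply: (mulfI d0); apply: (mulfI d0); rewrite !mulr0.
by move: E2; rewrite E1; move: (_ * _) => z; lra.
Qed.

(** [D] is applied to the entries of [proj2_TM]: the right side is killed by [lift_dot], and the
    Leibniz rule turns the left side into d^2 (p^T u + u^T p), u being the lift. *)
Lemma lift_tangent : tangent p0 (hlift D p0).
Proof.
have E i j : D (fun y => \sum_l pfun p0 l i y * pfun p0 l j y) = 0.
  transitivity (D (fun y => (i == j)%:R * dotm p0 (proj2 J (rep y) p0))).
    congr D; apply/funext => y.
    have := proj2_TM (stdJT R k) (stdJJ R k) p0 (rep_stiefel y) => /matrixP/(_ i j).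
    rewrite mxE [RHS]mxE mulr_natl => <-; apply: eq_bigr => l _.
    by congr (_ * _); rewrite mxE.
  rewrite (tv_scale tD) ?D_dot ?lift_dot ?mulr0//.
  rewrite (_ : (fun _ => _) = fun y => \sum_(ij : 'I_n * 'I_(k * 2)) p0 ij.1 ij.2 * pfun p0 ij.1 ij.2 y).
    by apply: C_sum => ij; apply: C_mul; [exact: C_cst|exact: C_pfun].
  by apply/funext => y; rewrite dotmE pair_bigA.
apply/matrixP => i j; have := E i j.
rewrite (tv_sum tD); last by move=> l; apply: C_mul; exact: C_pfun.
move=> E0; apply: (mulfI d0); apply: (mulfI d0).
rewrite [X in _ = _ * (_ * X)]mxE !mulr0 -[RHS]E0 mxE [X in X + _]mxE [X in _ + X]mxE.
rewrite -big_split !mulr_sumr; apply: eq_bigr => l _.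
rewrite (tv_mul tD) ?D_pfun ?pfun_at_p; try exact: C_pfun.
by rewrite /= [p0^T _ _]mxE [(hlift D p0)^T _ _]mxE; ring.
Qed.

End lifts.
End quotient_functions.

(** * Injectivity of the horizontal lift *)

Section derivation_determined.
Variables (R : realType) (n k : nat).
Hypothesis k0 : (0 < k)%N.
Notation d := (k * 2)%N.
Notation J := (stdJ R k).
Notation M := 'M[R]_(n, k * 2).
Notation V := (@stiefel R n (k * 2)).
Notation Y := (circle_quotient R n k).
Notation C := (@smooth_circle_quotient R n k).

(** Away from the closed half ball the product is locally zero, whatever [H] does outside the
    ball. *)
Lemma bump_mul_smooth (a b : nat) (w0 : 'M[R]_(a, b)) (rho : R) (chi H : 'M[R]_(a, b) -> R) :
  0 < rho -> smooth_on setT chi -> (forall w, chi w != 0 -> ball w0 (rho / 2) w) ->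
  smooth_on (ball w0 rho) H -> smooth_on setT (fun w => chi w * H w).
Proof.
move=> rho0 schi supp sH r; apply: Cr_on_local => w _.
have [Bw|nBw] := pselect (ball w0 rho w).
  exists (ball w0 rho); split => //; first exact: ball_open.
  by apply: Cr_onM; [exact: ball_open|exact: Cr_on_sub (schi r)|exact: sH].
exists (~` closed_ball w0 (rho / 2)); split.
- by apply: closed_openC; exact: closed_ball_closed.
- by move=> Bw; apply: nBw; exact: subset_closure_half Bw.
- have oc : open (~` closed_ball w0 (rho / 2)) by apply: closed_openC; exact: closed_ball_closed.
  apply: (Cr_on_eq oc _ (Cr_on_cst _ _ 0)) => x Bx.
  have [->|/supp Bx'] := eqVneq (chi x) 0; first by rewrite mul0r.
  by case: Bx; exact: subset_closed_ball.
Qed.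

Section at_point.
Variables (p : V) (D : (Y -> R) -> R).
Hypothesis tD : tangent_vector C (circle_proj p) D.
Let p0 := val p.
Hypothesis lift0 : hlift D p0 = 0.

Let pV : p0^T *m p0 = 1%:M.
Proof. by have /set_mem := valP p. Qed.

Let d_gt0 : 0 < d%:R :> R.
Proof. by rewrite ltr0n muln_gt0 k0. Qed.

Let w0 := d%:R *: p0.

Let rho (w : M) := dotm p0 w.

Let normalize (w : M) : M := (Num.sqrt (rho w))^-1 *: w.

Let rho0 : rho w0 = d%:R ^+ 2.
Proof. by rewrite /rho dotmZr dotm_stiefel. Qed.

Let normalize0 : normalize w0 = p0.
Proof.
by rewrite /normalize rho0 sqrtr_sqr ger0_norm ?ltW// /w0 scalerA mulVf ?scale1r// gt_eqF.
Qed.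

Let Cr_rho r (U : set M) : open U -> Cr_on r U rho.
Proof. by move=> oU; apply: Cr_on_dotm => // *; [exact: Cr_on_cst|exact: Cr_on_coord]. Qed.

Let rho_cont : continuous rho.
Proof. by move=> w; exact: (@Cr_rho 0 setT openT). Qed.

Let pos_open : open [set w | 0 < rho w].
Proof.
have -> : [set w | 0 < rho w] = rho @^-1` [set x | 0 < x] by [].
by apply: open_comp; [move=> w _; exact: rho_cont|exact: open_gt].
Qed.

Let Cr_norm_inv r : Cr_on r [set w | 0 < rho w] (fun w => (Num.sqrt (rho w))^-1).
Proof.
apply: Cr_onV => //; first by move=> w rw; rewrite gt_eqF// sqrtr_gt0.
by apply: Cr_on_sqrt => //; exact: Cr_rho.
Qed.

Let normalize_cont w : 0 < rho w -> {for w, continuous normalize}.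
Proof.
move=> rw; have cs : {for w, continuous (fun w => (Num.sqrt (rho w))^-1)}.
  exact: (Cr_norm_inv 0).
exact: (cvgZ cs (@cvg_id _ (nbhs w))).
Qed.

Let rho_proj2 x : rho (proj2 J x p0) = dotm x p0 ^+ 2 + dotm (x *m J) p0 ^+ 2.
Proof. by rewrite /rho /proj2 dotmDr !dotmZr (dotmC p0) (dotmC p0). Qed.

(** [proj2 J x p0] is x times a complex scalar of squared modulus [rho], so dividing by the root of
    [rho] lands on the circle orbit of x. Thus [proj2] at [p0] is a local coordinate on the
    quotient. *)
Let normalize_proj2 (q : V) : 0 < rho (proj2 J (val q) p0) ->
  exists2 q' : V, val q' = normalize (proj2 J (val q) p0) & circle_proj q' = circle_proj q.
Proof.
move=> rw; set a := dotm (val q) p0; set b := dotm (val q *m J) p0.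
set s := Num.sqrt (rho (proj2 J (val q) p0)).
have s0 : s != 0 by rewrite gt_eqF// sqrtr_gt0.
have ab : (a / s) ^+ 2 + (b / s) ^+ 2 = 1.
  by rewrite !expr_div_n -mulrDl -rho_proj2 sqr_sqrtr ?ltW// divff// gt_eqF.
have E : normalize (proj2 J (val q) p0) = val q *m rotJ J (a / s) (b / s).
  by rewrite /normalize -/s /proj2 -/a -/b mul_rotJ scalerDr !scalerA !(mulrC s^-1).
have mem : normalize (proj2 J (val q) p0) \in V.
  apply/mem_set; rewrite E; apply: stiefel_circle; first by have /set_mem := valP q.
  by apply/circleP; exists (a / s), (b / s).
pose q' : V := exist (fun x => x \in V) _ mem.
exists q' => //; apply/esym; exact: (@circle_proj_eq _ _ _ q q' _ _ ab E).
Qed.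

(** Near [p], [f] is a smooth function [F] of w = [proj2] at [p0]. Hadamard's lemma writes F - F w0
    as a combination of the entries of w - w0, which vanish at the point and are killed by [D]
    because the lift is zero. As [D] only acts on globally smooth functions, the identity is first
    multiplied by a bump function chi of w; the Leibniz rule leaves chi(w0) D f = 0. *)
Lemma tangent_vector_determined f : C f -> D f = 0.
Proof.
move=> Cf; have [U [G [oU Up sG fG]]] := Cf p.
have rho0_gt0 : 0 < rho w0 by rewrite rho0 exprn_gt0.
have : \near w0, 0 < rho w0 /\ U (normalize w0).
  have n1 : \near w0, 0 < rho w0 := open_nbhs_nbhs (conj pos_open rho0_gt0).
  have n2 : \near w0, U (normalize w0).
    apply: (normalize_cont rho0_gt0); rewrite normalize0.
    exact: open_nbhs_nbhs (conj oU Up).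
  exact: filterI n1 n2.
move=> /nbhs_ballP[e /= e0 eB].
pose F w := G (normalize w).
have sF : smooth_on (ball w0 e) F.
  move=> r; apply: (@Cr_on_comp_mx _ _ _ _ _ _ U); first exact: ball_open.
  - move=> i j; apply: (@Cr_on_eq _ _ _ _ (fun w => (Num.sqrt (rho w))^-1 * w i j)).
    + exact: ball_open.
    + by move=> w _; rewrite !mxE.
    + apply: Cr_onM; [exact: ball_open| |exact: Cr_on_coord].
      by apply: Cr_on_sub (Cr_norm_inv r) => w /eB[].
  - by move=> w /eB[].
  - exact: sG.
have [H sH FE] := hadamard sF.
have e2 : 0 < e / 2 by rewrite divr_gt0.
have [chi [schi chi0 supp]] := @bump_function R n d w0 (e / 2) e2.
have sHchi i j := bump_mul_smooth e0 schi supp (sH i j).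
pose w y := proj2 J (rep y) p0.
have Cw (phi : M -> R) : smooth_on setT phi -> C (fun y => phi (w y)).
  move=> sphi; apply: (@smooth_inv_fun _ _ _ (fun x => phi (proj2 J x p0))).
    by move=> x a b ab; rewrite proj2_rot// stdJJ.
  move=> r; apply: (@Cr_on_comp_mx _ _ _ _ _ _ setT); first exact: openT.
  - by move=> i j; exact: proj2_smooth.
  - by [].
  - exact: sphi.
have wp : w (circle_proj p) = w0.
  rewrite /w; have [a [b [ab ->]]] := rep_proj p.
  by rewrite proj2_rot ?stdJJ// proj2_self ?stdJT.
have prod_eq : (fun y => f y * chi (w y)) = (fun y => F w0 * chi (w y) +
    \sum_(ij : 'I_n * 'I_(k * 2)) (w y ij.1 ij.2 - w0 ij.1 ij.2) * (chi (w y) * H ij.1 ij.2 (w y))).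
  apply/funext => y; have [c0|cw] := eqVneq (chi (w y)) 0.
    by rewrite c0 !mulr0 big1 ?addr0// => ij _; rewrite mul0r mulr0.
  have Bw : ball w0 e (w y).
    by apply: le_ball (supp _ cw); rewrite ler_pdivrMr// ler_peMr ?ler1n ?ltW.
  have fE : f y = F (w y).
    have [rw Uw] := eB _ Bw.
    pose q : V := repr (y : {eq_quot @circle_orbit R n k}).
    have yE : circle_proj q = y by rewrite /circle_proj reprK.
    have [q' q'E q'y] := @normalize_proj2 q rw.
    have Uq' : U (val q') by rewrite q'E.
    have /= := fG q' Uq'; rewrite q'y yE => ->; rewrite /F; congr G; exact: q'E.
  rewrite fE (FE _ Bw) mulrDl pair_bigA mulr_suml; congr (_ + _).
  by apply: eq_bigr => ij _; rewrite /= -!mulrA (mulrC (H _ _ _)).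
have Cchi : C (fun y => chi (w y)) by exact: Cw.
have Dw i j : D (fun y => w y i j - w0 i j) = 0.
  rewrite (tv_add tD); [|exact: C_pfun|exact: C_cst].
  rewrite (tv_cst tD) addr0; have := congr1 (fun A : M => A i j) lift0.
  by rewrite !mxE => /eqP; rewrite mulf_eq0 invr_eq0 gt_eqF//= => /eqP.
have CwB i j : C (fun y => w y i j - w0 i j).
  by apply: C_add; [exact: C_pfun|exact: C_cst].
have CH i j : C (fun y => chi (w y) * H i j (w y)) by exact: (Cw (fun w => chi w * H i j w)).
have := congr1 D prod_eq.
have CwH ij : C (fun y => (w y ij.1 ij.2 - w0 ij.1 ij.2) * (chi (w y) * H ij.1 ij.2 (w y))).
  exact: C_mul.
rewrite (tv_mul tD Cf Cchi) (tv_add tD _ (C_sum _ CwH)); last by apply: C_mul => //; exact: C_cst.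
rewrite (tv_scale tD _ Cchi) (tv_sum tD _ CwH) big1 ?addr0; last first.
  by move=> ij _; rewrite (tv_mul tD)// Dw mulr0 addr0 wp subrr mul0r.
have -> : f (circle_proj p) = F w0.
  have := congr1 (fun g : Y -> R => g (circle_proj p)) prod_eq.
  rewrite /= wp big1 ?addr0; last by move=> ij _; rewrite subrr mul0r.
  by move=> /(mulIf chi0).
move=> /eqP; rewrite -subr_eq0 addrC addKr wp mulf_eq0 (negPf chi0) /= => /eqP.
exact.
Qed.

End at_point.
End derivation_determined.

(** * Velocities of one-parameter groups *)

Section velocities.
Variables (R : realType) (n k : nat).
Hypothesis k0 : (0 < k)%N.
Notation d := (k * 2)%N.
Notation J := (stdJ R k).
Notation M := 'M[R]_(n, k * 2).
Notation V := (@stiefel R n (k * 2)).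
Notation Y := (circle_quotient R n k).
Notation C := (@smooth_circle_quotient R n k).

Section one_parameter.
Variable W : 'M[R]_n.
Hypotheses (WT : W^T = - W) (W3 : W *m W *m W = - W).

(* [expm s] is the one-parameter group exp(sW), written with Rodrigues' formula. *)
Definition expm (s : R) : 'M[R]_n := 1%:M + sin s *: W + (1 - cos s) *: (W *m W).

Lemma expm_orthogonal s : (expm s)^T *m expm s = 1%:M.
Proof.
have WWT : (W *m W)^T = W *m W by rewrite trmx_mul WT mulNmx mulmxN opprK.
have E : (expm s)^T = 1%:M - sin s *: W + (1 - cos s) *: (W *m W).
  move: WT WWT; rewrite /expm; move: (W *m W) => W2 /matrixP WTe /matrixP WWT.
  apply/matrixP => i j; move: (WTe i j) (WWT i j); rewrite !mxE => -> ->.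
  by rewrite (eq_sym j); ring.
rewrite E /expm !mulmxDl !mulmxDr !mul1mx !mulmx1 mulNmx -!scalemxAl -!scalemxAr.
have W12 : W *m (W *m W) = - W by rewrite mulmxA.
have W22 : W *m W *m (W *m W) = - (W *m W) by rewrite mulmxA W3 mulNmx.
rewrite W3 W22 [- _ *m _]mulNmx -[_ *: W *m _]scalemxAl W12.
have := cos2Dsin2 s; move: (cos s) (sin s) (W *m W) => c t W2 ct.
have {}ct : t ^+ 2 = 1 - c ^+ 2 by rewrite -ct; ring.
apply/matrixP => i j; rewrite !mxE; ring: ct.
Qed.

Variable p : V.
Let p0 := val p.

Let pV : p0^T *m p0 = 1%:M.
Proof. by have /set_mem := valP p. Qed.

Lemma expm_stiefel s : expm s *m p0 \in V.
Proof.
apply/mem_set; rewrite /stiefel /= trmx_mul mulmxA -(mulmxA _ (expm s)^T) expm_orthogonal.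
by rewrite mulmx1.
Qed.

Definition expm_act s : V := exist (fun x => x \in V) _ (expm_stiefel s).

Lemma expm_act0 : expm_act 0 = p.
Proof. by apply/val_inj; rewrite /= /expm sin0 cos0 subrr !scale0r !addr0 mul1mx. Qed.

Definition velocity (f : Y -> R) : R := 'D_1 (fun s : R => f (circle_proj (expm_act s))) 0.

Lemma expm_actE s : val (expm_act s) =
  p0 + sin s *: (W *m p0) + (1 - cos s) *: (W *m W *m p0).
Proof. by rewrite /= /expm !mulmxDl mul1mx -!scalemxAl. Qed.

Let curve_differentiable : differentiable (fun s : R => val (expm_act s) : M) 0.
Proof.
rewrite (_ : (fun s => _) = (fun s : R => p0 + sin s *: (W *m p0)) +
    (fun s : R => (1 - cos s) *: (W *m W *m p0))); last first.
  by apply/funext => s; rewrite expm_actE.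
have ds : differentiable (@sin R) 0 by apply/derivable1_diffP.
have dc : differentiable (fun s : R => 1 - cos s) 0.
  by apply: differentiableB => //; apply/derivable1_diffP.
apply: differentiableD; last exact: differentiableZl.
by apply: differentiableD => //; exact: differentiableZl.
Qed.

Lemma velocity_derivable f : C f ->
  derivable (fun s : R => f (circle_proj (expm_act s))) 0 1.
Proof.
move=> Cf; have [U [G [oU Up sG fG]]] := Cf p.
have near_eq : \forall s \near (0 : R), G (val (expm_act s)) = f (circle_proj (expm_act s)).
  have nU : \forall s \near (0 : R), U (val (expm_act s)).
    apply: (differentiable_continuous curve_differentiable).
    by rewrite expm_act0; exact: open_nbhs_nbhs (conj oU Up).
  by apply: filterS nU => s Us; rewrite -(fG _ Us).
apply: near_eq_derivable near_eq _.
apply/derivable1_diffP; apply: (@differentiable_comp _ _ _ _ (fun s : R => val (expm_act s) : M) G) => //.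
by rewrite expm_act0; have [+ _] := sG 1%N; exact.
Qed.

Lemma velocity_tangent : tangent_vector C (circle_proj p) velocity.
Proof.
split=> [f g Cf Cg|a f Cf|f g Cf Cg]; rewrite /velocity.
- by rewrite (@deriveD _ _ _ _ _ _ _ (velocity_derivable Cf) (velocity_derivable Cg)).
- by rewrite (@deriveZ _ _ _ _ a _ _ (velocity_derivable Cf)).
- by rewrite (@deriveM _ _ _ _ _ _ (velocity_derivable Cf) (velocity_derivable Cg)) expm_act0.
Qed.

Let trig_derive (a0 a1 a2 : R) :
  is_derive (0 : R) (1 : R) (fun s : R => a0 + sin s * a1 + (1 - cos s) * a2) a1.
Proof.
apply: is_derive_eq; rewrite cos0 sin0 /GRing.scale /=; ring.
Qed.

(** Put u = W p. The derivative of x |-> [proj2 J x p] at p along u is d u + <u J, p> p J: the terms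
    with <u, p> and <p J, p> vanish by skewness of [W] and of J. The multiple of p J is the vertical
    correction. *)
Lemma lift_velocity : exists c, hlift velocity p0 = W *m p0 + c *: (p0 *m J).
Proof.
have d0 : d%:R != 0 :> R by rewrite pnatr_eq0 -lt0n muln_gt0 k0.
exists (d%:R^-1 * dotm (W *m p0 *m J) p0).
apply/matrixP => i j; rewrite [LHS]mxE [X in _ * X]mxE [RHS]mxE [X in _ + X]mxE.
have E : is_derive (0 : R) (1 : R)
   (fun s : R => pfun p0 i j (circle_proj (expm_act s)))
   (d%:R * (W *m p0) i j + dotm (W *m p0 *m J) p0 * (p0 *m J) i j).
  rewrite (_ : (fun s => _) = (fun s : R => (dotm p0 p0 + sin s * dotm (W *m p0) p0 + (1 - cos s) * dotm (W *m W *m p0) p0)) *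
    (fun s : R => (p0 i j + sin s * (W *m p0) i j + (1 - cos s) * (W *m W *m p0) i j)) +
    (fun s : R => (dotm (p0 *m J) p0 + sin s * dotm (W *m p0 *m J) p0 + (1 - cos s) * dotm (W *m W *m p0 *m J) p0)) *
    (fun s : R => ((p0 *m J) i j + sin s * (W *m p0 *m J) i j + (1 - cos s) * (W *m W *m p0 *m J) i j))); last first.
    apply/funext => s; rewrite /pfun (inv_fun_proj (F := fun x => proj2 J x p0 i j)); last exact: proj2_inv.
    rewrite expm_actE /proj2 !mulmxDl -!scalemxAl !dotmDl !dotmZl !fctE.
    rewrite mxE [X in X + _]mxE [X in _ + X]mxE.
    by congr (_ * _ + _ * _); rewrite !mxE.
  have D1 := is_deriveM (trig_derive (dotm p0 p0) (dotm (W *m p0) p0) (dotm (W *m W *m p0) p0))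
    (trig_derive (p0 i j) ((W *m p0) i j) ((W *m W *m p0) i j)).
  have D2 := is_deriveM (trig_derive (dotm (p0 *m J) p0) (dotm (W *m p0 *m J) p0) (dotm (W *m W *m p0 *m J) p0))
    (trig_derive ((p0 *m J) i j) ((W *m p0 *m J) i j) ((W *m W *m p0 *m J) i j)).
  apply: (is_derive_eq (is_deriveD D1 D2)).
  rewrite sin0 cos0 subrr !mul0r !addr0 /GRing.scale /= (dotm_stiefel pV).
  rewrite (dotmC (p0 *m J) p0) dotm_uuJ ?stdJT// (_ : dotm (W *m p0) p0 = 0); last first.
    have : dotm (W *m p0) p0 = - dotm (W *m p0) p0.
      rewrite {1}/dotm trmx_mul WT mulmxN mulNmx linearN /=; congr (- _).
      by rewrite dotmC /dotm mulmxA.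
    lra.
  ring.
have [_ E2] := E; rewrite /velocity E2.
by rewrite mulrDr !mulrA mulVf// mul1r.
Qed.

End one_parameter.
End velocities.

(** * The lift of a global frame to the Stiefel manifold *)

Section frame_lifts.
Variables (R : realType) (n k : nat).
Hypothesis k0 : (0 < k)%N.
Notation d := (k * 2)%N.
Notation J := (stdJ R k).
Notation M := 'M[R]_(n, k * 2).
Notation V := (@stiefel R n (k * 2)).
Notation Y := (circle_quotient R n k).
Notation C := (@smooth_circle_quotient R n k).

Section linearity.
Variables (y : Y) (D : (Y -> R) -> R).
Hypothesis tD : tangent_vector C y D.
Implicit Types u v : M.

Lemma tv_pfun v i j :
  D (pfun v i j) = \sum_a \sum_b v a b * D (pfun (delta_mx a b) i j).
Proof.
rewrite pair_bigA; transitivity (D (fun y => \sum_(ab : 'I_n * 'I_d) v ab.1 ab.2 * pfun (delta_mx ab.1 ab.2) i j y)).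
  congr D; apply/funext => z; rewrite /pfun {1}[v]matrix_sum_delta pair_bigA.
  rewrite (big_morph (fun v => proj2 J (rep z) v i j) (id1 := 0) (op1 := +%R)).
  - by apply: eq_bigr => ab _; rewrite proj2Z mxE.
  - by move=> u w; rewrite proj2D mxE.
  - by rewrite -(scale0r 0) proj2Z mxE mul0r.
rewrite (tv_sum tD); last by move=> ab; apply: C_mul; [exact: C_cst|exact: C_pfun].
by apply: eq_bigr => ab _; rewrite (tv_scale tD)//; exact: C_pfun.
Qed.

Lemma lift_entry v i j :
  hlift D v i j = d%:R^-1 * \sum_a \sum_b v a b * D (pfun (delta_mx a b) i j).
Proof. by rewrite !mxE tv_pfun. Qed.

Lemma lift_comb u v a b : hlift D (a *: u + b *: v) = a *: hlift D u + b *: hlift D v.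
Proof.
apply/matrixP => i j; rewrite [RHS]mxE [X in _ = X + _]mxE [X in _ = _ + X]mxE !lift_entry.
rewrite !(mulrCA _ d%:R^-1) -mulrDr; congr (_ * _); rewrite !mulr_sumr -big_split.
apply: eq_bigr => l _; rewrite !mulr_sumr -big_split; apply: eq_bigr => r _.
by rewrite !mxE /=; ring.
Qed.

Lemma lift_mulJ v : hlift D (v *m J) = hlift D v *m J.
Proof.
apply/matrixP => i j; rewrite mxE [X in _ * X]mxE [RHS]mxE.
transitivity (d%:R^-1 * D (fun y => \sum_l J l j * pfun v i l y)).
  congr (_ * D _); apply/funext => z.
  rewrite /pfun proj2_mulJ ?stdJT ?stdJJ// mxE; apply: eq_bigr => l _; exact: mulrC.
rewrite (tv_sum tD); last by move=> l; apply: C_mul; [exact: C_cst|exact: C_pfun].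
rewrite mulr_sumr; apply: eq_bigr => l _; rewrite (tv_scale tD) ?[hlift D v i l]mxE; last exact: C_pfun.
by rewrite [X in _ = _ * X * _]mxE; ring.
Qed.

(** [hlift D] is defined on all matrices and is complex linear, so lifts at different points of one
    orbit differ by the circle action. *)
Lemma lift_rotJ v a b : hlift D (v *m rotJ J a b) = hlift D v *m rotJ J a b.
Proof. by rewrite !mul_rotJ lift_comb lift_mulJ. Qed.

End linearity.

Lemma lift_lin m (c : 'I_m -> R) (D : 'I_m -> (Y -> R) -> R) (v : M) :
  hlift (fun f => \sum_i c i * D i f) v = \sum_i c i *: hlift (D i) v.
Proof.
apply/matrixP => i j; rewrite summxE [LHS]mxE [X in _ * X]mxE mulr_sumr.
by apply: eq_bigr => l _; rewrite [RHS]mxE [X in _ = _ * X]mxE [X in _ = _ * (_ * X)]mxE mulrCA.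
Qed.

Lemma lift_ext (D D' : (Y -> R) -> R) (v : M) : (forall f, C f -> D f = D' f) -> hlift D v = hlift D' v.
Proof.
move=> E; apply/matrixP => i j; rewrite [LHS]mxE [RHS]mxE; congr (_ * _).
by rewrite [LHS]mxE [RHS]mxE E//; exact: C_pfun.
Qed.

Variables (m : nat) (X : 'I_m -> (Y -> R) -> Y -> R).
Hypothesis HX : smooth_global_frame C X.

Definition frame_vec (i : 'I_m) (p : V) : M := hlift (fun f => X i f (circle_proj p)) (val p).

Lemma frame_tangent i y : tangent_vector C y (fun f => X i f y).
Proof. by have [H _] := HX; have [H1 _] := H i; exact: H1. Qed.

Section at_point.
Variable p : V.
Let p0 := val p.
Let pV : p0^T *m p0 = 1%:M.
Proof. by have /set_mem := valP p. Qed.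

Let in_span (t : M) := exists (c : 'rV[R]_m) c0,
  t = \sum_i c ord0 i *: frame_vec i p + c0 *: (p0 *m J).

Let in_spanD t u : in_span t -> in_span u -> in_span (t + u).
Proof.
move=> [c [c0 ->]] [b [b0 ->]]; exists (c + b), (c0 + b0).
rewrite addrACA -scalerDl -big_split; congr (_ + _); apply: eq_bigr => i _.
by rewrite mxE scalerDl.
Qed.

Let in_spanZ a t : in_span t -> in_span (a *: t).
Proof.
move=> [c [c0 ->]]; exists (a *: c), (a * c0).
rewrite scalerDr scaler_sumr scalerA; congr (_ + _); apply: eq_bigr => i _.
by rewrite mxE scalerA.
Qed.

Let in_span0 : in_span 0.
Proof.
exists 0, 0; rewrite scale0r addr0 big1// => i _; by rewrite mxE scale0r.
Qed.

Let in_span_velocity (W : 'M[R]_n) : W^T = - W -> W *m W *m W = - W -> in_span (W *m p0).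
Proof.
move=> WT W3; have tv := velocity_tangent WT W3 p.
have [_ /(_ _ _ tv)[c [cE _]]] := HX.
have [c0 lE] := lift_velocity k0 WT W3 p.
have E : hlift (velocity WT W3 p) p0 = \sum_i c ord0 i *: frame_vec i p.
  by rewrite -lift_lin; apply: lift_ext => f Cf; rewrite cE.
exists c, (- c0); rewrite -E lE scaleNr addrK//.
Qed.

Let skew_delta (a b : 'I_n) := delta_mx a b - delta_mx b a : 'M[R]_n.

Let in_span_skew a b : in_span (skew_delta a b *m p0).
Proof.
have [->|ab] := eqVneq a b; first by rewrite /skew_delta subrr mul0mx.
apply: in_span_velocity; first by rewrite /skew_delta linearB /= !trmx_delta opprB.
have ba : b != a by rewrite eq_sym.
have E2 : skew_delta a b *m skew_delta a b = - (delta_mx a a + delta_mx b b).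
  rewrite /skew_delta mulmxBl !mulmxBr !mul_delta_mx !mul_delta_mx_0// sub0r subr0 opprD.
  by rewrite addrC.
rewrite E2 /skew_delta mulNmx mulmxDl !mulmxBr !mul_delta_mx !mul_delta_mx_0//.
by rewrite subr0 sub0r.
Qed.

(** A tangent vector is W p with [W] skew, and [W] is a combination of elementary skew matrices.
    Those satisfy W^3 = -W, so Rodrigues' formula provides curves whose velocities the frame must
    span. *)
Lemma frame_span t : tangent p0 t -> exists (c : 'rV[R]_m) c0,
  t = \sum_i c ord0 i *: frame_vec i p + c0 *: (p0 *m J).
Proof.
move=> /(skew_transitive pV)[W WT <-]; rewrite -/(in_span _).
(* All ordered pairs are summed, so each elementary skew matrix occurs twice; hence the half. *)
have -> : W *m p0 = \sum_(ab : 'I_n * 'I_n) (W ab.1 ab.2 / 2) *: (skew_delta ab.1 ab.2 *m p0).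
  have Wsum : W = \sum_(ab : 'I_n * 'I_n) (W ab.1 ab.2 / 2) *: skew_delta ab.1 ab.2.
    have WE : W = 2^-1 *: (W - W^T).
      by rewrite WT opprK; apply/matrixP => i j; rewrite !mxE; field.
    rewrite {1}WE {1 2}[W]matrix_sum_delta !pair_bigA /= linear_sum -sumrB scaler_sumr.
    apply: eq_bigr => ab _ /=.
    by rewrite linearZ /= trmx_delta -scalerBr scalerA mulrC.
  by rewrite {1}Wsum mulmx_suml; apply: eq_bigr => ab _; rewrite -scalemxAl.
elim/big_ind: _ => // ab _.
by apply: in_spanZ.
Qed.

(** The same combination of the fields is a derivation with zero lift, hence zero on smooth
    functions, and the zero derivation has unique coordinates. *)
Lemma frame_free (c : 'rV[R]_m) : \sum_i c ord0 i *: frame_vec i p = 0 -> c = 0.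
Proof.
move=> c0; pose D f := \sum_i c ord0 i * X i f (circle_proj p).
have tX i := frame_tangent i (circle_proj p).
have tD : tangent_vector C (circle_proj p) D.
  split=> [f g Cf Cg|a f Cf|f g Cf Cg]; rewrite /D.
  - rewrite -big_split; apply: eq_bigr => i _ /=.
    by rewrite -mulrDr; congr (_ * _); have [+ _ _] := tX i; exact.
  - rewrite mulr_sumr; apply: eq_bigr => i _.
    by rewrite mulrCA; congr (_ * _); have [_ + _] := tX i; exact.
  - rewrite !mulr_sumr -big_split; apply: eq_bigr => i _ /=.
    have [_ _ H] := tX i; rewrite (H _ _ Cf Cg); ring.
have D0 f : C f -> D f = 0.
  by apply: (tangent_vector_determined k0 tD); rewrite lift_lin.
have t0 : tangent_vector C (circle_proj p) (fun=> 0).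
  by split=> *; rewrite ?mulr0 ?addr0.
have [_ /(_ _ _ t0)[c' [_ uniq]]] := HX.
have E1 : c' = c by apply: uniq => f Cf; rewrite -[RHS]/(D f) D0.
rewrite -E1; apply: uniq => f _.
by rewrite big1// => i _; rewrite mxE mul0r.
Qed.

Lemma frame_vec_tangent i : tangent p0 (frame_vec i p).
Proof. exact: (lift_tangent k0 (frame_tangent i (circle_proj p))). Qed.

Lemma frame_vec_dotJ i : dotm (p0 *m J) (frame_vec i p) = 0.
Proof. exact: (lift_dotJ k0 (frame_tangent i (circle_proj p))). Qed.

End at_point.
End frame_lifts.

HB.lock Definition partial (R : realType) (m : nat) (i : 'I_m) (f : 'rV[R]_m -> R) (x : 'rV[R]_m) : R :=
  'd f x (delta_mx 0 i).

(** * The closed 3-form of a trivialization *)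

Section partials.
Variables (R : realType) (m : nat).
Notation E := 'rV[R]_m.
Implicit Types (f g : E -> R) (i j : 'I_m) (x : E).

Notation smooth := (smooth_on (@setT E)).

Lemma smooth_diff f x : smooth f -> differentiable f x.
Proof. by move=> /(_ 1%N)[+ _]; exact. Qed.

Lemma smooth_partial i f : smooth f -> smooth (partial i f).
Proof.
move=> sf r; have [_ /(_ (delta_mx 0 i))] := sf r.+1.
by apply: Cr_on_eq; [exact: openT|move=> x _; rewrite partial.unlock].
Qed.

Lemma smoothD f g : smooth f -> smooth g -> smooth (fun x => f x + g x).
Proof. by move=> sf sg r; apply: Cr_onD; [exact: openT|exact: sf|exact: sg]. Qed.

Lemma smoothM f g : smooth f -> smooth g -> smooth (fun x => f x * g x).
Proof. by move=> sf sg r; apply: Cr_onM; [exact: openT|exact: sf|exact: sg]. Qed.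

Lemma smoothB f g : smooth f -> smooth g -> smooth (fun x => f x - g x).
Proof. by move=> sf sg r; apply: Cr_onB; [exact: openT|exact: sf|exact: sg]. Qed.

Lemma smooth_cst c : smooth (fun=> c).
Proof. by move=> r; exact: Cr_on_cst. Qed.

Lemma smooth_sum (I : Type) (s : seq I) (F : I -> E -> R) :
  (forall l, smooth (F l)) -> smooth (fun x => \sum_(l <- s) F l x).
Proof. by move=> sF r; apply: Cr_on_sum; [exact: openT|move=> l _; exact: sF]. Qed.

Lemma partialD i f g x : smooth f -> smooth g ->
  partial i (fun x => f x + g x) x = partial i f x + partial i g x.
Proof.
move=> /(smooth_diff x) df /(smooth_diff x) dg; rewrite partial.unlock.
exact: (is_diffE _ (is_diffD (differentiableP df) (differentiableP dg))).
Qed.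

Lemma partialB i f g x : smooth f -> smooth g ->
  partial i (fun x => f x - g x) x = partial i f x - partial i g x.
Proof.
move=> /(smooth_diff x) df /(smooth_diff x) dg; rewrite partial.unlock.
exact: (is_diffE _ (is_diffB (differentiableP df) (differentiableP dg))).
Qed.

Lemma partialM i f g x : smooth f -> smooth g ->
  partial i (fun x => f x * g x) x = partial i f x * g x + f x * partial i g x.
Proof.
move=> /(smooth_diff x) df /(smooth_diff x) dg; rewrite partial.unlock addrC [_ * g x]mulrC.
exact: (is_diffE _ (is_diffM (differentiableP df) (differentiableP dg))).
Qed.

Lemma partial_cst i c x : partial i (fun=> c) x = 0.
Proof. by rewrite partial.unlock; exact: (is_diffE _ (is_diff_cst c x)). Qed.

Lemma partial_sum (I : Type) (s : seq I) (F : I -> E -> R) i x : (forall l, smooth (F l)) ->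
  partial i (fun x => \sum_(l <- s) F l x) x = \sum_(l <- s) partial i (F l) x.
Proof.
move=> sF; elim: s => [|l s IH].
  rewrite big_nil -[RHS](partial_cst i 0 x); congr (partial i _ x).
  by apply/funext => y; rewrite big_nil.
rewrite big_cons -IH -partialD//; last exact: smooth_sum.
by congr (partial i _ x); apply/funext => y; rewrite big_cons.
Qed.

Lemma partial_comm i j f x : smooth f ->
  partial i (partial j f) x = partial j (partial i f) x.
Proof.
move=> sf; have := schwarz x (delta_mx 0 j) (delta_mx 0 i) (sf 2%N).
by rewrite partial.unlock.
Qed.

Lemma partial_shift i f c x : smooth f -> (forall y, f (y + c) = f y) ->
  partial i f (x + c) = partial i f x.
Proof.
move=> sf fc; rewrite partial.unlock.
have E : (fun y => f (y + c)) = f by apply/funext => y; exact: fc.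
apply: (etrans (esym (diff_shift (delta_mx 0 i) (smooth_diff (x + c) sf)))).
exact: (congr1 (fun g : 'rV[R]_m -> R => 'd g x (delta_mx 0 i)) E).
Qed.

Lemma partial_const_line i f x : smooth f ->
  (forall h : R, f (h *: delta_mx 0 i + x) = f x) -> partial i f x = 0.
Proof. by move=> sf H; rewrite partial.unlock; apply: diff_const_line => //; exact: smooth_diff. Qed.

Lemma partial_diag i j f x : smooth f ->
  (forall h : R, f (h *: (delta_mx 0 i - delta_mx 0 j) + x) = f x) ->
  partial i f x = partial j f x.
Proof.
move=> sf H; have df := smooth_diff x sf; rewrite partial.unlock.
have /eqP := diff_const_line df H.
have /= -> := linearB ('d f x) (delta_mx 0 i) (delta_mx 0 j).
by rewrite subr_eq0 => /eqP.
Qed.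

Section matrices.
Implicit Types (a b c : nat).

Definition msmooth a b (F : E -> 'M[R]_(a, b)) := forall (l : 'I_a) (r : 'I_b), smooth (fun x => F x l r).

Definition mpartial a b i (F : E -> 'M[R]_(a, b)) x : 'M[R]_(a, b) :=
  \matrix_(l, r) partial i (fun x => F x l r) x.

Lemma msmooth_mpartial a b i (F : E -> 'M[R]_(a, b)) : msmooth F -> msmooth (mpartial i F).
Proof.
move=> sF l r; rewrite (_ : (fun x => _) = partial i (fun x => F x l r)).
  exact: smooth_partial.
by apply/funext => x; rewrite mxE.
Qed.

Lemma msmoothM a b c (F : E -> 'M[R]_(a, b)) (G : E -> 'M[R]_(b, c)) :
  msmooth F -> msmooth G -> msmooth (fun x => F x *m G x).
Proof.
move=> sF sG l r; rewrite (_ : (fun x => _) = fun x => \sum_t F x l t * G x t r).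
  by apply: smooth_sum => t; exact: smoothM.
by apply/funext => x; rewrite mxE.
Qed.

Lemma msmooth_cst a b (F : 'M[R]_(a, b)) : msmooth (fun=> F).
Proof. by move=> l r; exact: smooth_cst. Qed.

Lemma msmooth_tr a (F : E -> 'M[R]_a) : msmooth F -> smooth (fun x => \tr (F x)).
Proof. by move=> sF; apply: smooth_sum => l; exact: sF. Qed.

Lemma mpartialM a b c i (F : E -> 'M[R]_(a, b)) (G : E -> 'M[R]_(b, c)) x :
  msmooth F -> msmooth G ->
  mpartial i (fun x => F x *m G x) x = mpartial i F x *m G x + F x *m mpartial i G x.
Proof.
move=> sF sG; apply/matrixP => l r; rewrite mxE [RHS]mxE [X in _ = X + _]mxE [X in _ = _ + X]mxE.
rewrite (_ : (fun x => _) = fun x => \sum_t F x l t * G x t r); last first.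
  by apply/funext => y; rewrite mxE.
rewrite partial_sum; last by move=> t; exact: smoothM.
rewrite -big_split; apply: eq_bigr => t _ /=.
by rewrite partialM// [mpartial i F x _ _]mxE [mpartial i G x _ _]mxE.
Qed.

Lemma mpartial_cst a b i (F : 'M[R]_(a, b)) x : mpartial i (fun=> F) x = 0.
Proof. by apply/matrixP => l r; rewrite !mxE partial_cst. Qed.

Lemma partial_tr a i (F : E -> 'M[R]_a) x : msmooth F ->
  partial i (fun x => \tr (F x)) x = \tr (mpartial i F x).
Proof. by move=> sF; rewrite partial_sum//; apply: eq_bigr => l _; rewrite mxE. Qed.

Lemma mpartial_comm a b i j (F : E -> 'M[R]_(a, b)) x : msmooth F ->
  mpartial i (mpartial j F) x = mpartial j (mpartial i F) x.
Proof.
move=> sF; apply/matrixP => l r; rewrite !mxE.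
rewrite (_ : (fun x => mpartial j F x l r) = partial j (fun x => F x l r)); last first.
  by apply/funext => y; rewrite mxE.
rewrite (_ : (fun x => mpartial i F x l r) = partial i (fun x => F x l r)); last first.
  by apply/funext => y; rewrite mxE.
by rewrite partial_comm.
Qed.

End matrices.
End partials.

Section closed_form.
Variables (R : realType) (m a b : nat).
Notation E := 'rV[R]_m.
Variables (A : E -> 'M[R]_(a, b)) (B : E -> 'M[R]_(b, a)) (Pi : 'M[R]_a).
Hypotheses (sA : msmooth A) (sB : msmooth B).
Hypotheses (BA : forall x, B x *m A x = 1%:M) (AB : forall x, A x *m B x = Pi).

Definition omega i x : 'M[R]_b := B x *m mpartial i A x.
Definition omega' i x : 'M[R]_a := mpartial i A x *m B x.

Let sdA i := msmooth_mpartial i sA.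

Lemma msmooth_omega i : msmooth (omega i).
Proof. exact: msmoothM. Qed.

Lemma msmooth_omega' i : msmooth (omega' i).
Proof. exact: msmoothM. Qed.

Let PiA x : Pi *m A x = A x.
Proof. by rewrite -(AB x) -mulmxA BA mulmx1. Qed.

Lemma Pi_mpartial i x : Pi *m mpartial i A x = mpartial i A x.
Proof.
have := mpartialM i x (@msmooth_cst R m _ _ Pi) sA; rewrite mpartial_cst mul0mx add0r => <-.
by congr (mpartial i _ x); apply/funext => y.
Qed.

(** Differentiating B A = 1 determines dB on the image of [A] only; the constancy of [Pi] and B Pi =
    B give the rest. *)
Let dB i x : mpartial i B x = - (B x *m mpartial i A x *m B x).
Proof.
have BPi y : B y *m Pi = B y by rewrite -(AB y) mulmxA BA mul1mx.
have dBA : mpartial i B x *m A x = - (B x *m mpartial i A x).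
  apply/eqP; rewrite -addr_eq0 -mpartialM//; apply/eqP.
  by rewrite (_ : (fun x => _) = fun=> 1%:M) ?mpartial_cst//; apply/funext.
have dBPi : mpartial i B x *m Pi = mpartial i B x.
  have := mpartialM i x sB (@msmooth_cst R m _ _ Pi); rewrite mpartial_cst mulmx0 addr0 => <-.
  by congr (mpartial i _ x); apply/funext => y.
by rewrite -[LHS]dBPi -(AB x) mulmxA dBA mulNmx.
Qed.

Definition hess i j x : 'M[R]_b := B x *m mpartial i (mpartial j A) x.

Lemma hessC i j x : hess i j x = hess j i x.
Proof. by rewrite /hess mpartial_comm. Qed.

(** The Maurer-Cartan equation: antisymmetrizing in [i] and [j] removes the symmetric [hess]. *)
Lemma mpartial_omega i j x : mpartial i (omega j) x = hess i j x - omega i x *m omega j x.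
Proof. by rewrite mpartialM// dB addrC mulNmx /omega !mulmxA. Qed.

Lemma mpartial_omega' i j x : mpartial i (omega' j) x =
  mpartial i (mpartial j A) x *m B x - omega' j x *m omega' i x.
Proof. by rewrite mpartialM// dB mulmxN /omega' !mulmxA. Qed.

Definition t3 (x y z : 'M[R]_b) := \tr (x *m y *m z).
Definition t4 (w x y z : 'M[R]_b) := \tr (w *m x *m y *m z).

Let t3C x y z : t3 x y z = t3 y z x.
Proof. by rewrite /t3 -mulmxA mxtrace_mulC. Qed.
Let t4C w x y z : t4 w x y z = t4 x y z w.
Proof. by rewrite /t4 -!mulmxA mxtrace_mulC !mulmxA. Qed.

Lemma partial_t3 i (F G H : E -> 'M[R]_b) x : msmooth F -> msmooth G -> msmooth H ->
  partial i (fun x => t3 (F x) (G x) (H x)) x =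
  t3 (mpartial i F x) (G x) (H x) + t3 (F x) (mpartial i G x) (H x) + t3 (F x) (G x) (mpartial i H x).
Proof.
move=> sF sG sH; have sFG := msmoothM sF sG.
rewrite partial_tr; last exact: msmoothM.
by rewrite mpartialM// mpartialM// mulmxDl !linearD.
Qed.

(** By cyclicity of the trace, the six signed terms of tr(omega^3) on three basis vectors amount to
    three times this difference. *)
Definition T3 i j l x := t3 (omega i x) (omega j x) (omega l x) - t3 (omega i x) (omega l x) (omega j x).

Lemma smooth_t3 (F G H : E -> 'M[R]_b) : msmooth F -> msmooth G -> msmooth H ->
  smooth_on setT (fun x => t3 (F x) (G x) (H x)).
Proof. by move=> sF sG sH; apply: msmooth_tr; apply: msmoothM => //; exact: msmoothM. Qed.

Lemma smooth_T3 i j l : smooth_on setT (T3 i j l).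
Proof. by apply: smoothB; apply: smooth_t3; exact: msmooth_omega. Qed.

Let t3_1 h x y z w : t3 (h - x *m y) z w = t3 h z w - t4 x y z w.
Proof. by rewrite /t3 /t4 !mulmxBl linearB. Qed.
Let t3_2 h x y z w : t3 z (h - x *m y) w = t3 h w z - t4 x y w z.
Proof. by rewrite t3C t3_1. Qed.
Let t3_3 h x y z w : t3 z w (h - x *m y) = t3 h z w - t4 x y z w.
Proof. by rewrite -t3C t3_1. Qed.

(* tr (omega ^ 3) is a closed form. *)
Lemma T3_closed p q r s x :
  partial p (T3 q r s) x - partial q (T3 p r s) x + partial r (T3 p q s) x - partial s (T3 p q r) x = 0.
Proof.
have so i := msmooth_omega i.
have pT i j l h : partial h (T3 i j l) x =
    (t3 (mpartial h (omega i) x) (omega j x) (omega l x) +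
     t3 (omega i x) (mpartial h (omega j) x) (omega l x) +
     t3 (omega i x) (omega j x) (mpartial h (omega l) x)) -
    (t3 (mpartial h (omega i) x) (omega l x) (omega j x) +
     t3 (omega i x) (mpartial h (omega l) x) (omega j x) +
     t3 (omega i x) (omega l x) (mpartial h (omega j) x)).
  rewrite partialB; try exact: smooth_t3.
  by rewrite !partial_t3.
rewrite !pT !mpartial_omega !(t3_1, t3_2, t3_3).
rewrite (hessC q p) (hessC r p) (hessC s p) (hessC r q) (hessC s q) (hessC s r).
set w0 := omega p x; set w1 := omega q x; set w2 := omega r x; set w3 := omega s x.
(* With [w0] rotated to the front the quartic traces can be compared; they cancel since a cyclic
   rotation of four 1-forms is odd. *)
have c2 u v w : t4 u w0 v w = t4 w0 v w u by exact: t4C.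
have c3 u v w : t4 u v w0 w = t4 w0 w u v by rewrite t4C t4C.
have c4 u v w : t4 u v w w0 = t4 w0 u v w by rewrite t4C t4C t4C.
rewrite !(c2, c3, c4); ring.
Qed.

Section boundary.
Variables (D1 : 'M[R]_a) (D2 : 'M[R]_b).

Definition P1 i x := \tr (D2 *m omega i x) + \tr (D1 *m omega' i x).

Lemma smooth_P1 i : smooth_on setT (P1 i).
Proof.
by apply: smoothD; apply: msmooth_tr; apply: msmoothM;
  [exact: msmooth_cst|exact: msmooth_omega|exact: msmooth_cst|exact: msmooth_omega'].
Qed.

(** Equivariance in direction [h] gives omega_h = D2 - B D1 A. The contraction of the 3-form with
    that direction becomes tr(D2 [omega_i, omega_j]) - tr(D1 [omega'_i, omega'_j]), and the
    Maurer-Cartan equations of [omega] and [omega'], of opposite signs, make it exact with primitive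
    [P1]. *)
Lemma T3_boundary h i j x : mpartial h A x = A x *m D2 - D1 *m A x ->
  T3 h i j x = partial j (P1 i) x - partial i (P1 j) x.
Proof.
move=> dh.
have dP u v : partial u (P1 v) x = \tr (D2 *m mpartial u (omega v) x) + \tr (D1 *m mpartial u (omega' v) x).
  have s1 : msmooth (fun x => D2 *m omega v x) by apply: msmoothM; [exact: msmooth_cst|exact: msmooth_omega].
  have s2 : msmooth (fun x => D1 *m omega' v x) by apply: msmoothM; [exact: msmooth_cst|exact: msmooth_omega'].
  rewrite partialD; [|exact: msmooth_tr..].
  rewrite !partial_tr// mpartialM; [|exact: msmooth_cst|exact: msmooth_omega].
  rewrite mpartialM; [|exact: msmooth_cst|exact: msmooth_omega'].
  by rewrite !mpartial_cst !mul0mx !add0r.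
rewrite !dP !mpartial_omega !mpartial_omega' (hessC j i) (mpartial_comm j i _ sA).
rewrite !mulmxBr ![\tr (_ - _)]linearB /=.
have wh : omega h x = D2 - B x *m D1 *m A x.
  by rewrite /omega dh mulmxBr mulmxA BA mul1mx mulmxA.
have key u v : t3 (omega h x) (omega u x) (omega v x) =
    \tr (D2 *m (omega u x *m omega v x)) - \tr (D1 *m (omega' u x *m omega' v x)).
  rewrite /t3 wh !mulmxBl linearB /= mulmxA; congr (_ - _).
  rewrite -!mulmxA mxtrace_mulC; congr (\tr _).
  rewrite /omega /omega' -!mulmxA; congr (_ *m _).
  by rewrite !mulmxA (AB x) Pi_mpartial.
rewrite /T3 !key; ring.
Qed.

(** The cross terms tr(D2 B D1 A) and tr(D1 A D2 B) agree by cyclicity and cancel. *)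
Lemma P1_boundary h j x : mpartial h A x = A x *m D2 - D1 *m A x ->
  mpartial j A x = mpartial h A x -> P1 j x = \tr (D2 *m D2) - \tr (D1 *m D1 *m Pi).
Proof.
move=> dh dj; rewrite /P1 /omega /omega' dj dh !(mulmxBr, mulmxBl) !linearB /= !mulmxA.
rewrite -(mulmxA D2) BA mulmx1 -(mulmxA _ (A x) (B x)) AB.
rewrite [X in _ - X + _](_ : _ = \tr (D1 *m A x *m D2 *m B x)); last first.
  by rewrite -!mulmxA mxtrace_mulC -!mulmxA mxtrace_mulC !mulmxA.
by rewrite addrA subrK.
Qed.

End boundary.
End closed_form.

(** * Grid averages *)

Section averages.
Variables (R : realType) (m : nat) (L : 'I_m -> R).
Hypothesis L0 : forall i, 0 < L i.
Notation E := 'rV[R]_m.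
Implicit Types (f g : E -> R) (i j : 'I_m) (x : E) (s t : R).

Lemma line_MVT_partial f x i (h : R) : smooth_on setT f -> 0 <= h ->
  exists2 s, 0 <= s <= h &
    f (h *: delta_mx 0 i + x) - f x = h * partial i f (s *: delta_mx 0 i + x).
Proof.
move=> sf h0; rewrite partial.unlock.
by apply: line_MVT => // s _; exact: smooth_diff.
Qed.

Definition upd x i t : E := \row_j (if j == i then t else x ord0 j).

Lemma upd_upd x i s t : upd (upd x i s) i t = upd x i t.
Proof. by apply/rowP => j; rewrite !mxE; case: eqP. Qed.

Lemma upd_comm x i j s t : i != j -> upd (upd x i s) j t = upd (upd x j t) i s.
Proof.
move=> ij; apply/rowP => l; rewrite !mxE.
by case: eqVneq => [->|//]; rewrite eq_sym (negPf ij).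
Qed.

Lemma upd_line x i s t : upd x i (s + t) = t *: delta_mx 0 i + upd x i s.
Proof.
apply/rowP => j; rewrite !mxE eqxx /=; case: eqP => _; rewrite ?mulr1 ?mulr0 ?add0r//.
exact: addrC.
Qed.

Definition box : set E := [set x | forall j, 0 <= x ord0 j <= L j].

Lemma box_upd x i t : box x -> 0 <= t <= L i -> box (upd x i t).
Proof. by move=> bx ht j; rewrite mxE; case: eqP => [->|_]; [|exact: bx]. Qed.

Lemma box_compact : compact box.
Proof.
have := @rV_compact R m (fun j => `[0, L j]%classic) (fun j => @segment_compact R 0 (L j)).
by rewrite (_ : [set v | _] = box).
Qed.

Lemma box0 : box 0.
Proof. by move=> j; rewrite mxE lexx (ltW (L0 j)). Qed.

Lemma box_bounded f : continuous f -> exists2 K, 0 <= K & forall x, box x -> `|f x| <= K.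
Proof.
move=> cf; have := @EVT_max_rV R m (fun x => `|f x|) box.
case.
- by exists 0; exact: box0.
- exact: box_compact.
- by apply: continuous_subspaceT => x; apply: continuous_comp; [exact: cf|exact: norm_continuous].
- move=> c bc H; exists `|f c| => // x bx; apply: H; exact: mem_set.
Qed.

Variable N : nat.
Hypothesis N0 : (0 < N)%N.

Definition node i (l : 'I_N) : R := l%:R / N%:R * L i.

(** A Riemann sum over left end points, normalized to a mean value. Such finite averages commute
    without any integrability condition. *)
Definition avg i f x : R := N%:R^-1 * \sum_(l < N) f (upd x i (node i l)).

Let NR : 0 < N%:R :> R. Proof. by rewrite ltr0n. Qed.

Lemma node_box i l : 0 <= node i l <= L i.
Proof.
have Li := ltW (L0 i); rewrite /node mulr_ge0 ?divr_ge0//= ler_piMl//.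
by rewrite ler_pdivrMr// mul1r ler_nat ltnW.
Qed.

Lemma avgB i f g : avg i (fun x => f x - g x) = fun x => avg i f x - avg i g x.
Proof. by apply/funext => x; rewrite /avg sumrB mulrBr. Qed.

Lemma avgZ i c f : avg i (fun x => c * f x) = fun x => c * avg i f x.
Proof. by apply/funext => x; rewrite /avg -mulr_sumr mulrCA. Qed.

Lemma avg_const i f x : (forall t, f (upd x i t) = f x) -> avg i f x = f x.
Proof.
move=> H; rewrite /avg (eq_bigr (fun=> f x)) => [|l _]; last exact: H.
by rewrite sumr_const card_ord -[f x *+ N]mulr_natl mulrA mulVf ?mul1r// gt_eqF.
Qed.

Lemma avg_bound i f K x : (forall x, box x -> `|f x| <= K) -> box x -> `|avg i f x| <= K.
Proof.
move=> H bx; rewrite /avg normrM ger0_norm ?invr_ge0// mulrC ler_pdivrMr//.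
apply: (le_trans (ler_norm_sum _ _ _)).
rewrite (_ : K * _ = \sum_(l < N) K); last by rewrite sumr_const card_ord mulr_natr.
by apply: ler_sum => l _; apply: H; apply: box_upd => //; exact: node_box.
Qed.

Lemma avg_comm i j f : avg i (avg j f) = avg j (avg i f).
Proof.
have [->//|ij] := eqVneq i j.
apply/funext => x; rewrite /avg; congr (_ * _).
under eq_bigr do rewrite mulr_sumr; under [RHS]eq_bigr do rewrite mulr_sumr.
rewrite exchange_big; apply: eq_bigr => l _; apply: eq_bigr => r _.
by rewrite upd_comm.
Qed.

Lemma avg_avg i f : avg i (avg i f) = avg i f.
Proof.
apply/funext => x; apply: avg_const => t; rewrite /avg; congr (_ * _).
by apply: eq_bigr => l _; rewrite upd_upd.
Qed.

(** The increments of [f] over the N subintervals of length h = L i / N telescope; on each one, two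
    uses of the mean value theorem bound the error of the left end point by K h^2. *)
Lemma avg_partial f i (K : R) : smooth_on setT f -> 0 <= K ->
  (forall x, box x -> `|partial i (partial i f) x| <= K) ->
  forall x, box x ->
  `|L i * avg i (partial i f) x - (f (upd x i (L i)) - f (upd x i 0))| <= K * L i ^+ 2 / N%:R.
Proof.
move=> sf K0 HK x bx.
pose u (l : nat) : R := l%:R / N%:R * L i.
pose h : R := L i / N%:R.
have h0 : 0 <= h by rewrite divr_ge0// (ltW (L0 i)).
have uS l : u l.+1 = u l + h by rewrite /u /h -natr1; ring.
have tele : f (upd x i (L i)) - f (upd x i 0) = \sum_(l < N) (f (upd x i (u l.+1)) - f (upd x i (u l))).
  rewrite -(big_mkord xpredT (fun l => f (upd x i (u l.+1)) - f (upd x i (u l)))).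
  rewrite (telescope_sumr (fun l => f (upd x i (u l))))//.
  by rewrite /u mul0r mul0r divff ?mul1r// gt_eqF.
have LA : L i * avg i (partial i f) x = \sum_(l < N) h * partial i f (upd x i (u l)).
  by rewrite /avg mulrA -/h mulr_sumr.
rewrite tele LA -sumrB; apply: (le_trans (ler_norm_sum _ _ _)).
apply: (@le_trans _ _ (\sum_(l < N) K * h ^+ 2)); last first.
  rewrite sumr_const card_ord (_ : K * h ^+ 2 *+ N = K * L i ^+ 2 / N%:R)//.
  by rewrite -[LHS]mulr_natr /h; field; rewrite gt_eqF.
apply: ler_sum => l _.
have box_s (s : R) : 0 <= s <= h -> box (s *: delta_mx 0 i + upd x i (u l)).
  move=> /andP[s0 sh]; rewrite -upd_line; apply: box_upd => //.
  have := node_box i l; rewrite -/(u l) => /andP[ul0 _]; rewrite addr_ge0//=.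
  apply: (@le_trans _ _ (u l.+1)); first by rewrite uS lerD2l.
  rewrite /u ler_piMl ?(ltW (L0 i))// ler_pdivrMr// mul1r ler_nat.
  exact: ltn_ord.
have [s sh] := line_MVT_partial (upd x i (u l)) i sf h0.
rewrite -upd_line -uS => ->.
have s0 : 0 <= s by case/andP: sh.
have [t ts Et] := line_MVT_partial (upd x i (u l)) i (smooth_partial i sf) s0.
move: (partial i f (upd x i (u l))) (partial i f (s *: _ + _)) Et => p1 p2 Et.
have -> : h * p1 - h * p2 = - (h * (p2 - p1)) by ring.
rewrite Et normrN [`|h * _|]normrM [`|s * _|]normrM (ger0_norm h0) (ger0_norm s0).
rewrite expr2 (mulrCA K) ler_wpM2l// (mulrC K).
have /andP[t0 tls] := ts; have /andP[_ slh] := sh.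
by apply: ler_pM => //; apply: HK; apply: box_s; rewrite t0 (le_trans tls).
Qed.

End averages.

Section torus.
Variables (R : realType) (L : 'I_4 -> R).
Hypothesis L0 : forall i, 0 < L i.
Notation E := 'rV[R]_4.
Notation smooth := (smooth_on (@setT E)).

Definition avg4 N (f : E -> R) : R := avg L N 0 (avg L N 1 (avg L N 2 (avg L N 3 f))) 0.

Lemma avg4B N f g : avg4 N (fun x => f x - g x) = avg4 N f - avg4 N g.
Proof. by rewrite /avg4 !avgB. Qed.

Lemma avg4Z N c f : avg4 N (fun x => c * f x) = c * avg4 N f.
Proof. by rewrite /avg4 !avgZ. Qed.

Section nodes.
Variable N : nat.
Hypothesis N0 : (0 < N)%N.

Lemma avg4_bound f K : (forall x, box L x -> `|f x| <= K) -> `|avg4 N f| <= K.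
Proof.
move=> H; have b0 := box0 L0.
apply: (avg_bound L0 N0) b0 => x; apply: (avg_bound L0 N0) => {}x.
by apply: (avg_bound L0 N0) => {}x; apply: (avg_bound L0 N0).
Qed.

Lemma avg4_avg i f : avg4 N (avg L N i f) = avg4 N f.
Proof.
rewrite /avg4; case: i => [[|[|[|[|//]]]] hi].
- rewrite (_ : Ordinal hi = 0); last exact/val_inj.
  by rewrite (avg_comm L N 3 0) (avg_comm L N 2 0) (avg_comm L N 1 0) (avg_avg L N0).
- rewrite (_ : Ordinal hi = 1); last exact/val_inj.
  by rewrite (avg_comm L N 3 1) (avg_comm L N 2 1) (avg_avg L N0).
- rewrite (_ : Ordinal hi = 2); last exact/val_inj.
  by rewrite (avg_comm L N 3 2) (avg_avg L N0).
- rewrite (_ : Ordinal hi = 3); last exact/val_inj.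
  by rewrite (avg_avg L N0).
Qed.

Lemma avg4_const c : avg4 N (fun=> c) = c.
Proof.
rewrite /avg4; do 4 (rewrite (_ : avg _ _ _ (fun=> c) = fun=> c); last by
  apply/funext => x; rewrite (avg_const _ N0)).
by [].
Qed.

End nodes.

(* Averaging over finer and finer grids replaces integration: up to [O(1/N)],
   the average of a partial derivative is a boundary difference. *)
Lemma avg4_partial i f (s : E -> E) : smooth f ->
  (forall x t, s (upd x i t) = upd (s x) i t) -> (forall x, box L x -> box L (s x)) ->
  exists K, forall N, (0 < N)%N ->
  `|L i * avg4 N (fun x => partial i f (s x)) -
    avg4 N (fun x => f (upd (s x) i (L i)) - f (upd (s x) i 0))| <= K / N%:R.
Proof.
move=> sf su sb.
have sff := smooth_partial i (smooth_partial i sf).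
have cff : continuous (partial i (partial i f)).
  by move=> x; apply: (sff 0%N).
have [K K0 HK] := box_bounded L0 cff.
exists (K * L i ^+ 2) => N N0.
rewrite -(avg4_avg N0 i (fun x => partial i f (s x))) -avg4Z -avg4B.
apply: (avg4_bound N0) => x bx.
have -> : avg L N i (fun x => partial i f (s x)) x = avg L N i (partial i f) (s x).
  by rewrite /avg; congr (_ * _); apply: eq_bigr => l _; rewrite su.
exact: (avg_partial L0 N0 sf K0 HK (sb _ bx)).
Qed.

End torus.

(* The hypotheses are those of a map on CP^2 in polar coordinates
   [x = (r, psi, u, phi)]: the circle of [psi] collapses at [r = 0], that of [phi]
   at [u = 0], that of [phi - psi] at [u = L 2], and at [r = L 0], over the line at
   infinity, [psi] turns the fibre and A is equivariant with weights D1 and D2. *)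
Section obstruction.
Variables (R : realType) (L : 'I_4 -> R).
Hypothesis L0 : forall i, 0 < L i.
Notation E := 'rV[R]_4.
Variables (a b : nat) (A : E -> 'M[R]_(a, b)) (B : E -> 'M[R]_(b, a)) (Pi : 'M[R]_a).
Hypotheses (sA : msmooth A) (sB : msmooth B).
Hypotheses (BA : forall x, B x *m A x = 1%:M) (AB : forall x, A x *m B x = Pi).
Variables (D1 : 'M[R]_a) (D2 : 'M[R]_b).
Hypotheses
  (perA1 : forall x, A (x + L 1 *: delta_mx 0 1) = A x)
  (perA3 : forall x, A (x + L 3 *: delta_mx 0 3) = A x)
  (perB1 : forall x, B (x + L 1 *: delta_mx 0 1) = B x)
  (perB3 : forall x, B (x + L 3 *: delta_mx 0 3) = B x)
  (A_r0 : forall x : E, x 0 0 = 0 -> mpartial 1 A x = 0)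
  (A_u0 : forall x : E, x 0 2 = 0 -> mpartial 3 A x = 0)
  (A_u1 : forall x : E, x 0 2 = L 2 -> mpartial 3 A x = mpartial 1 A x)
  (A_r1 : forall x : E, x 0 0 = L 0 -> mpartial 1 A x = A x *m D2 - D1 *m A x).

Let upd_per (x : E) i : upd x i (L i) = upd x i 0 + L i *: delta_mx 0 i.
Proof. by rewrite -[L i]add0r upd_line addrC !add0r. Qed.

Let per_T3 h : (forall x, A (x + L h *: delta_mx 0 h) = A x) ->
  (forall x, B (x + L h *: delta_mx 0 h) = B x) ->
  forall i j l x, T3 A B i j l (upd x h (L h)) = T3 A B i j l (upd x h 0).
Proof.
move=> pA pB i j l x.
have pw q y : omega A B q (y + L h *: delta_mx 0 h) = omega A B q y.
  rewrite /omega pB; congr (_ *m _); apply/matrixP => s t; rewrite !mxE.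
  apply: (@partial_shift _ _ _ (fun x => A x s t)) => [|z]; first exact: sA.
  by rewrite pA.
by rewrite upd_per /T3 !pw.
Qed.

(** Stokes' theorem on the box, then on its face r = L 0. At r = 0 and at u = 0 a component of
    [omega] vanishes, at u = L 2 two components agree, and in psi and phi the form is periodic, so
    only that face is left. There the form has primitive [P1], whose u-component is periodic in phi
    and whose phi-component rises from 0 at u = 0 to the constant [c] at u = L 2. All of this holds
    up to O(1/N), which forces c = 0. *)
Theorem charge_balance : \tr (D2 *m D2) = \tr (D1 *m D1 *m Pi).
Proof.
have sT i j l := smooth_T3 sA sB i j l.
pose idE := fun x : E => x.
pose face := fun x : E => upd x 0 (L 0).
have face_box x : box L x -> box L (face x).
  by move=> bx; apply: box_upd => //; rewrite lexx (ltW (L0 0)).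
have face_upd i x t : i != 0 -> face (upd x i t) = upd (face x) i t.
  by move=> i0; rewrite /face upd_comm.
have [K0 H0] := avg4_partial L0 (sT 1 2 3) (s := idE) (i := 0) (fun _ _ => erefl) (fun _ H => H).
have [K1 H1] := avg4_partial L0 (sT 0 2 3) (s := idE) (i := 1) (fun _ _ => erefl) (fun _ H => H).
have [K2 H2] := avg4_partial L0 (sT 0 1 3) (s := idE) (i := 2) (fun _ _ => erefl) (fun _ H => H).
have [K3 H3] := avg4_partial L0 (sT 0 1 2) (s := idE) (i := 3) (fun _ _ => erefl) (fun _ H => H).
have sP i := smooth_P1 sA sB D1 D2 i.
have [K4 H4] := avg4_partial L0 (sP 3) (s := face) (i := 2) (fun x t => face_upd 2 x t isT) face_box.
have [K5 H5] := avg4_partial L0 (sP 2) (s := face) (i := 3) (fun x t => face_upd 3 x t isT) face_box.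
have perP x : P1 A B D1 D2 2 (upd (face x) 3 (L 3)) = P1 A B D1 D2 2 (upd (face x) 3 0).
  rewrite upd_per /P1 /omega /omega' perB3.
  have -> // : mpartial 2 A (upd (face x) 3 0 + L 3 *: delta_mx 0 3) = mpartial 2 A (upd (face x) 3 0).
  apply/matrixP => s t; rewrite !mxE.
  apply: (@partial_shift _ _ _ (fun x => A x s t)) => [|z]; first exact: sA.
  by rewrite perA3.
have w_0 i (x : E) : mpartial i A x = 0 -> omega A B i x = 0 by rewrite /omega => ->; rewrite mulmx0.
have w_u1 (x : E) : x 0 2 = L 2 -> omega A B 3 x = omega A B 1 x by move=> /A_u1; rewrite /omega => ->.
have T_r0 x : T3 A B 1 2 3 (upd x 0 0) = 0.
  rewrite /T3 (w_0 1) ?A_r0//; last by rewrite mxE eqxx.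
  by rewrite /t3 !mul0mx subrr.
have T_u0 x : T3 A B 0 1 3 (upd x 2 0) = 0.
  rewrite /T3 (w_0 3) ?A_u0//; last by rewrite mxE eqxx.
  by rewrite /t3 !(mulmx0, mul0mx) subrr.
have T_u1 x : T3 A B 0 1 3 (upd x 2 (L 2)) = 0.
  by rewrite /T3 w_u1 ?subrr// mxE eqxx.
set c := \tr (D2 *m D2) - \tr (D1 *m D1 *m Pi).
have P_u0 x : P1 A B D1 D2 3 (upd (face x) 2 0) = 0.
  have d3 : mpartial 3 A (upd (face x) 2 0) = 0 by rewrite A_u0// mxE eqxx.
  by rewrite /P1 (w_0 3)// /omega' d3 mul0mx !mulmx0 !mxtrace0 addr0.
have P_u1 x : P1 A B D1 D2 3 (upd (face x) 2 (L 2)) = c.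
  apply: (P1_boundary BA AB (h := 1)); last by rewrite A_u1// mxE eqxx.
  by rewrite A_r1// mxE /= mxE eqxx.
have T_face x : T3 A B 1 2 3 (face x) =
    partial 3 (P1 A B D1 D2 2) (face x) - partial 2 (P1 A B D1 D2 3) (face x).
  by apply: (T3_boundary sA sB BA AB); rewrite A_r1// mxE eqxx.
pose Q := K4 + L 2 * (K0 + L 0 * (K1 / L 1 + K2 / L 2 + K3 / L 3) + K5 / L 3).
have bound N : (0 < N)%N -> `|c| <= Q / N%:R.
  move=> N0; move: (H0 N N0) (H1 N N0) (H2 N N0) (H3 N N0) (H4 N N0) (H5 N N0).
  have -> : (fun x => T3 A B 1 2 3 (upd (idE x) 0 (L 0)) - T3 A B 1 2 3 (upd (idE x) 0 0)) =
      (fun x => T3 A B 1 2 3 (face x)) by apply/funext => x; rewrite T_r0 subr0.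
  have -> : (fun x => T3 A B 0 2 3 (upd (idE x) 1 (L 1)) - T3 A B 0 2 3 (upd (idE x) 1 0)) =
      (fun=> 0) by apply/funext => x; rewrite per_T3// subrr.
  have -> : (fun x => T3 A B 0 1 3 (upd (idE x) 2 (L 2)) - T3 A B 0 1 3 (upd (idE x) 2 0)) =
      (fun=> 0) by apply/funext => x; rewrite T_u0 T_u1 subrr.
  have -> : (fun x => T3 A B 0 1 2 (upd (idE x) 3 (L 3)) - T3 A B 0 1 2 (upd (idE x) 3 0)) =
      (fun=> 0) by apply/funext => x; rewrite per_T3// subrr.
  have -> : (fun x => P1 A B D1 D2 3 (upd (face x) 2 (L 2)) - P1 A B D1 D2 3 (upd (face x) 2 0)) =
      (fun=> c) by apply/funext => x; rewrite P_u0 P_u1 subr0.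
  have -> : (fun x => P1 A B D1 D2 2 (upd (face x) 3 (L 3)) - P1 A B D1 D2 2 (upd (face x) 3 0)) =
      (fun=> 0) by apply/funext => x; rewrite perP subrr.
  have -> : (fun x => T3 A B 1 2 3 (face x)) = (fun x =>
      partial 3 (P1 A B D1 D2 2) (face x) - partial 2 (P1 A B D1 D2 3) (face x)).
    exact/funext.
  rewrite avg4B !(avg4_const L N0).
  have := avg4_const L N0 0.
  rewrite (_ : (fun=> 0) = (fun x => (partial 0 (T3 A B 1 2 3) x - partial 1 (T3 A B 0 2 3) x) -
      (partial 3 (T3 A B 0 1 2) x - partial 2 (T3 A B 0 1 3) x))); last first.
    apply/funext => x; have := T3_closed sA sB BA AB 0 1 2 3 x; lra.
  rewrite !avg4B.
  move: (avg4 L N (fun x => partial 0 _ x)) (avg4 L N (fun x => partial 1 _ x))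
    (avg4 L N (fun x => partial 2 _ x)) (avg4 L N (fun x => partial 3 _ x))
    (avg4 L N (fun x => partial 2 _ (face x))) (avg4 L N (fun x => partial 3 _ (face x))).
  have NV : 0 < N%:R^-1 :> R by rewrite invr_gt0 ltr0n.
  move: (N%:R^-1) NV => e e0 a0 a1 a2 a3 p4 p5 closed.
  rewrite !subr0 => B0 B1 B2 B3 B4 B5.
  have div i x K : `|L i * x| <= K * e -> `|x| <= K / L i * e.
    by rewrite normrM gtr0_norm ?L0// mulrAC ler_pdivlMr ?L0// mulrC.
  have {}B1 := div _ _ _ B1; have {}B2 := div _ _ _ B2; have {}B3 := div _ _ _ B3.
  have {}B5 := div _ _ _ B5.
  have a0E : a0 = a1 - a2 + a3 by lra.
  have Ba0 : `|a0| <= (K1 / L 1 + K2 / L 2 + K3 / L 3) * e.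
    rewrite a0E (le_trans (ler_normD _ _))// mulrDl lerD// (le_trans (ler_normB _ _))//.
    by rewrite mulrDl lerD.
  have Bt : `|p5 - p4| <= K0 * e + L 0 * ((K1 / L 1 + K2 / L 2 + K3 / L 3) * e).
    have -> : p5 - p4 = - (L 0 * a0 - (p5 - p4)) + L 0 * a0 by ring.
    rewrite (le_trans (ler_normD _ _))// normrN lerD// normrM gtr0_norm ?L0//.
    by rewrite ler_wpM2l// ltW ?L0.
  have Bp4 : `|p4| <= K0 * e + L 0 * ((K1 / L 1 + K2 / L 2 + K3 / L 3) * e) + K5 / L 3 * e.
    have -> : p4 = - (p5 - p4) + p5 by ring.
    by rewrite (le_trans (ler_normD _ _))// normrN lerD.
  have -> : c = - (L 2 * p4 - c) + L 2 * p4 by ring.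
  rewrite (le_trans (ler_normD _ _))// normrN normrM (gtr0_norm (L0 2)).
  apply: (le_trans (lerD B4 (ler_wpM2l (ltW (L0 2)) Bp4))).
  by rewrite le_eqVlt; apply/orP; left; apply/eqP; rewrite /Q; ring.
apply/eqP; rewrite -subr_eq0 -/c -normr_eq0 eq_le normr_ge0 andbT leNgt; apply/negP => c0.
have Q0 : 0 <= Q / `|c|.
  by rewrite divr_ge0 ?ltW// (lt_le_trans c0)//; have := bound 1%N isT; rewrite divr1.
have /archi_boundP bQ := Q0; have := bound (Num.bound (Q / `|c|)).+1 isT.
rewrite leNgt => /negP; apply; rewrite ltr_pdivrMr ?ltr0n// mulrC -ltr_pdivrMr//.
by rewrite (lt_trans bQ)// ltr_nat.
Qed.

End obstruction.

(** * A projective plane in the Stiefel manifold *)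

Section gram_schmidt.
Variables (R : realType) (N : nat) (K : 'M[R]_N).
Notation T := 'M[R]_(N, 1 * 2).
Notation r := (stdJ R 1).
Implicit Types (c : nat -> T) (X Y : T).

(** The two columns stand for one complex vector v and its multiple by i, which have the same
    length; hence the half. *)
Definition sqnorm Y : R := \tr (Y^T *m Y) / 2.

Definition unitize Y : T := (Num.sqrt (sqnorm Y))^-1 *: Y.

(** Course-of-values recursion: the result is a table of the first [j] vectors, extended by one
    entry at each step. *)
Fixpoint gs_upto c (j : nat) : nat -> T :=
  if j is j'.+1 then
    fun i => if (i < j')%N then gs_upto c j' i
             else unitize (c j' - \sum_(l < j') gs_upto c j' l *m ((gs_upto c j' l)^T *m c j'))
  else fun=> 0.

Definition gs c j := gs_upto c j.+1 j.

Definition gs_residual c j := c j - \sum_(l < j) gs c l *m ((gs c l)^T *m c j).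

Lemma gs_upto_lt c j i : (i < j)%N -> gs_upto c j i = gs c i.
Proof.
elim: j => [//|j IH]; rewrite ltnS leq_eqVlt => /predU1P[->//|ij].
by rewrite /= ij IH.
Qed.

Lemma gsE c j : gs c j = unitize (gs_residual c j).
Proof.
rewrite /gs /= ltnn; congr (unitize (_ - _)); apply: eq_bigr => l _.
by rewrite gs_upto_lt.
Qed.

Opaque gs.

Lemma sqnorm_rot Y g : g *m g^T = 1%:M -> sqnorm (Y *m g) = sqnorm Y.
Proof.
move=> gg; by rewrite /sqnorm trmx_mul -mulmxA mxtrace_mulC -!mulmxA gg mulmx1.
Qed.

(** The coefficients of the projections are conjugated by [g] and lengths are preserved. This is the
    source of the circle equivariance of the frames. *)
Lemma gs_rot c g j : g *m g^T = 1%:M -> gs (fun j => c j *m g) j = gs c j *m g.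
Proof.
move=> gg; elim/ltn_ind: j => j IH; rewrite !gsE.
have -> : gs_residual (fun j => c j *m g) j = gs_residual c j *m g.
  rewrite /gs_residual mulmxBl mulmx_suml; congr (_ - _); apply: eq_bigr => l _.
  by rewrite IH// trmx_mul !mulmxA -(mulmxA (gs c l) g) gg mulmx1.
by rewrite /unitize sqnorm_rot// scalemxAl.
Qed.

Lemma sqnormE Y : sqnorm Y = dotm Y Y / 2.
Proof. by []. Qed.

Lemma sqnorm_gt0 Y : Y != 0 -> 0 < sqnorm Y.
Proof.
move=> Y0; rewrite sqnormE divr_gt0// lt_neqAle; apply/andP; split; last first.
  by rewrite dotmE; apply: sumr_ge0 => i _; apply: sumr_ge0 => j _; rewrite -expr2 sqr_ge0.
by rewrite eq_sym; apply: contra_neq Y0; exact: dotm_eq0.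
Qed.

Hypothesis KT : K^T = - K.

Definition clin Y := K *m Y = Y *m r.

Lemma clinT Y : clin Y -> Y^T *m K = r *m Y^T.
Proof.
move=> /(congr1 trmx); rewrite !trmx_mul KT stdJT mulNmx mulmxN => /eqP.
by rewrite eqr_opp => /eqP.
Qed.

Lemma clinB X Y : clin X -> clin Y -> clin (X - Y).
Proof. by rewrite /clin => cX cY; rewrite mulmxBr mulmxBl cX cY. Qed.

Lemma clinZ a Y : clin Y -> clin (a *: Y).
Proof. by rewrite /clin => cY; rewrite -scalemxAr -scalemxAl cY. Qed.

Lemma clin_sum (I : Type) (s : seq I) (F : I -> T) : (forall i, clin (F i)) -> clin (\sum_(i <- s) F i).
Proof.
by move=> cF; rewrite /clin mulmx_suml mulmx_sumr; apply: eq_bigr => i _; exact: cF.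
Qed.

Lemma clin_proj X Y : clin X -> clin Y -> clin (X *m (X^T *m Y)).
Proof.
by move=> cX cY; rewrite /clin mulmxA cX -mulmxA (mulmxA r) -clinT// -!mulmxA cY.
Qed.

Lemma scalar_of_commute (S : 'M[R]_(1 * 2)) : S^T = S -> r *m S = S *m r -> S = (\tr S / 2)%:M.
Proof.
move=> /matrixP ST /matrixP Sr.
pose i0 : 'I_(1 * 2) := ord0; pose i1 : 'I_(1 * 2) := ord_max.
have o2 (i : 'I_(1 * 2)) : i = i0 \/ i = i1.
  by case: i => [[|[|//]] hi]; [left|right]; exact/val_inj.
have rE i j : r i j = ((j < i)%:R - (i < j)%:R :> R).
  rewrite /stdJ !mxE; have [->|->] := o2 i; have [->|->] := o2 j; rewrite ?eqE /= ?mulr1n mul1r//.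
have sumE (F : 'I_(1 * 2) -> R) : \sum_i F i = F i0 + F i1.
  by rewrite !big_ord_recl big_ord0 addr0; congr (_ + F _); exact/val_inj.
have := Sr i0 i0; have := Sr i0 i1; rewrite !mxE !sumE !rE /= => e1 e2.
have := ST i0 i1; rewrite mxE => e3.
have trE : \tr S = S i0 i0 + S i1 i1 by rewrite /mxtrace sumE.
apply/matrixP => i j; rewrite mxE trE.
have [->|->] := o2 i; have [->|->] := o2 j; rewrite ?eqE /= ?mulr1n ?mulr0n; lra.
Qed.

(** The Hermitian square of a complex vector is real: the Gram matrix is symmetric and commutes with
    the rotation. *)
Lemma clin_sqnorm Y : clin Y -> Y^T *m Y = (sqnorm Y)%:M.
Proof.
move=> cY; apply: scalar_of_commute; first by rewrite trmx_mul trmxK.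
by rewrite mulmxA -clinT// -!mulmxA cY.
Qed.

Lemma clin_unitize Y : clin Y -> Y != 0 -> (unitize Y)^T *m unitize Y = 1%:M.
Proof.
move=> cY /sqnorm_gt0 Y0; rewrite /unitize [(_ *: _)^T]linearZ /= -scalemxAl -scalemxAr clin_sqnorm//.
apply/matrixP => i j; rewrite !mxE mulrA -expr2 exprVn sqr_sqrtr ?ltW//.
by rewrite -[sqnorm Y *+ _]mulr_natr mulrA mulVf ?mul1r// gt_eqF.
Qed.

Section echelon.
Variables (c : nat -> T) (h : 'I_N -> nat) (l0 k : nat).
Hypothesis cc : forall j, clin (c j).
Hypothesis c_supp : forall j a b, (j + l0 < h a)%N -> c j a b = 0.
Hypothesis c_lead : forall j, (j < k)%N -> exists a b, h a = (j + l0)%N /\ c j a b != 0.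

Lemma gs_clin j : clin (gs c j).
Proof.
elim/ltn_ind: j => j IH; rewrite gsE; apply: clinZ; apply: clinB => //.
rewrite /clin mulmx_suml mulmx_sumr; apply: eq_bigr => l _.
by apply: clin_proj => //; exact: IH.
Qed.

Lemma gs_supp j a b : (j + l0 < h a)%N -> gs c j a b = 0.
Proof.
elim/ltn_ind: j a b => j IH a b ja; rewrite gsE mxE.
suff -> : gs_residual c j a b = 0 by rewrite mulr0.
rewrite /gs_residual !mxE summxE c_supp// big1 ?subr0// => l _.
rewrite mxE big1// => s _; rewrite IH ?mul0r//.
by apply: leq_ltn_trans ja; rewrite leq_add2r ltnW.
Qed.

(** The earlier vectors live on lower levels of [h], so subtracting their multiples leaves the
    leading entry of [c j] unchanged. *)
Lemma gs_residual_neq0 j : (j < k)%N -> gs_residual c j != 0.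
Proof.
move=> /c_lead[a [b [ha cab]]]; apply: contra_neq cab => /matrixP/(_ a b).
rewrite /gs_residual !mxE summxE big1 ?subr0// => l _; rewrite mxE big1// => s _.
by rewrite gs_supp ?mul0r// ha ltn_add2r.
Qed.

Lemma gs_orthonormal i j : (i < k)%N -> (j < k)%N ->
  (gs c i)^T *m gs c j = if i == j then 1%:M else 0.
Proof.
suff H j' : (j' < k)%N -> forall i, (i <= j')%N -> (gs c i)^T *m gs c j' = if i == j' then 1%:M else 0.
  move=> ik jk; have [ij|ji] := leqP i j; first exact: H.
  have E := H i ik j (ltnW ji).
  by rewrite -[LHS]trmxK trmx_mul trmxK E (gtn_eqF ji) (ltn_eqF ji) trmx0.
elim/ltn_ind: j' => {}j IH jk {}i; rewrite leq_eqVlt => /predU1P[->|ij].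
  rewrite eqxx gsE clin_unitize ?gs_residual_neq0//.
  apply: clinB => //; apply: clin_sum => l; apply: clin_proj => //; exact: gs_clin.
rewrite (ltn_eqF ij) (gsE c j) /unitize -scalemxAr.
suff -> : (gs c i)^T *m gs_residual c j = 0 by rewrite scaler0.
rewrite /gs_residual mulmxBr mulmx_sumr (bigD1 (Ordinal ij))//=.
have Ei := IH i ij (ltn_trans ij jk) i (leqnn i).
rewrite eqxx in Ei.
have -> : (gs c i)^T *m (gs c i *m ((gs c i)^T *m c j)) = (gs c i)^T *m c j.
  by rewrite mulmxA Ei mul1mx.
rewrite big1 ?addr0 ?subrr// => l li.
have {}li : nat_of_ord l != i by apply: contra_neq li => li; exact/val_inj.
rewrite (mulmxA (gs c i)^T); have [il|il] := leqP i l.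
  have El := IH l (ltn_ord l) (ltn_trans (ltn_ord l) jk) i il.
  by rewrite El eq_sym (negPf li) mul0mx.
have El := IH i ij (ltn_trans ij jk) l (ltnW il).
by rewrite -[(gs c i)^T *m gs c l]trmxK trmx_mul trmxK El (negPf li) trmx0 mul0mx.
Qed.

End echelon.
End gram_schmidt.

Section gram_schmidt_smooth.
Variables (R : realType) (N : nat) (E : normedModType R) (c : nat -> E -> 'M[R]_(N, 1 * 2)).
Hypothesis sc : forall j r a b, Cr_on r setT (fun x => c j x a b).

Lemma Cr_on_gs k r : (forall x j, (j < k)%N -> gs_residual (fun j => c j x) j != 0) ->
  forall j, (j < k)%N -> forall a b, Cr_on r setT (fun x => gs (fun j => c j x) j a b).
Proof.
move=> res0; elim/ltn_ind => j IH jk.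
have oT := @openT E.
have sres a b : Cr_on r setT (fun x => gs_residual (fun j => c j x) j a b).
  apply: (@Cr_on_eq _ _ _ _ (fun x => c j x a b - \sum_(l < j) \sum_t gs (fun j => c j x) l a t *
      (\sum_s gs (fun j => c j x) l s t * c j x s b))) => //.
    move=> x _; rewrite !mxE summxE; congr (_ - _); apply: eq_bigr => l _; rewrite mxE.
    by apply: eq_bigr => t _; rewrite mxE; congr (_ * _); apply: eq_bigr => s _; rewrite mxE.
  apply: Cr_onB => //; apply: Cr_on_sum => // l _; apply: Cr_on_sum => // t _.
  have lk : (l < k)%N by exact: ltn_trans (ltn_ord l) jk.
  apply: Cr_onM => //; first exact: IH.
  by apply: Cr_on_sum => // s _; apply: Cr_onM => //; exact: IH.
move=> a b; apply: (@Cr_on_eq _ _ _ _ (fun x => (Num.sqrt (sqnorm (gs_residual (fun j => c j x) j)))^-1 *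
    gs_residual (fun j => c j x) j a b)) => //.
  by move=> x _; rewrite (gsE _ j) [RHS]mxE.
have pos x : 0 < sqnorm (gs_residual (fun j => c j x) j) by apply: sqnorm_gt0; exact: res0.
apply: Cr_onM => //; apply: Cr_onV => //; first by move=> x _; rewrite gt_eqF// sqrtr_gt0.
apply: Cr_on_sqrt => //; apply: Cr_onM => //; last exact: Cr_on_cst.
exact: (Cr_on_dotm oT sres sres).
Qed.

End gram_schmidt_smooth.

(** * Frames from multiplication by a quadratic polynomial *)

Section toeplitz.
Variables (R : realType) (n k : nat).
Hypothesis hn : (k * 2 + 4 <= n)%N.
Notation N := ((k + 2) * 2)%N.
Notation r := (rot90 R).
Implicit Types (Z : 'I_3 -> 'M[R]_2).

(* Column block [j] of the matrix of multiplication by the polynomial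
   [z_0 + z_1 t + z_2 t^2] on polynomials of degree [< k]; multiplication by a
   nonzero polynomial is injective, so these columns are independent. *)
Definition toeplitz_col Z (j : nat) : 'M[R]_(N, 1 * 2) :=
  \sum_(l < 3) (\col_(a < k + 2) (a == j + l :> nat)%:R : 'cV[R]_(k + 2)) *t Z l.

Lemma toeplitz_colE Z j (a : 'I_(k + 2)) (s : 'I_2) b :
  toeplitz_col Z j (mxtens_index (a, s)) (mxtens_index (ord0, b)) =
  \sum_(l < 3) (a == j + l :> nat)%:R * Z l s b.
Proof. by rewrite summxE; apply: eq_bigr => l _; rewrite tensmxE mxE. Qed.

Lemma toeplitz_clin Z j : (forall l, r *m Z l = Z l *m r) -> clin (stdJ R (k + 2)) (toeplitz_col Z j).
Proof.
move=> Zr; rewrite /clin mulmx_suml mulmx_sumr; apply: eq_bigr => l _.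
by rewrite /stdJ !tensmx_mul mul1mx mulmx1 Zr.
Qed.

Lemma toeplitz_rot Z g : toeplitz_col (fun l => Z l *m g) = fun j => toeplitz_col Z j *m ((1%:M : 'M[R]_1) *t g).
Proof.
apply/funext => j; rewrite /toeplitz_col mulmx_suml; apply: eq_bigr => l _.
by rewrite tensmx_mul mulmx1.
Qed.

Section nonzero.
Variable Z : 'I_3 -> 'M[R]_2.
Hypotheses (Zr : forall l, r *m Z l = Z l *m r) (Z0 : exists l, Z l != 0).

Let h (a : 'I_N) : nat := (mxtens_unindex a).1.

Let leading : exists2 l0 : 'I_3, Z l0 != 0 & forall l : 'I_3, (l0 < l)%N -> Z l = 0.
Proof.
have [l Zl] := Z0.
case: (@arg_maxnP _ l (fun l => Z l != 0) (fun l => l : nat) Zl) => l0 Zl0 H.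
exists l0 => // l' ll'; apply/eqP; apply: contraTT ll' => /H.
by rewrite -leqNgt.
Qed.

(** [l0] is the degree of the polynomial, and column [j] is t^j times it, of degree j + l0. *)
Lemma toeplitz_echelon : exists l0 : nat,
  (forall j a b, (j + l0 < h a)%N -> toeplitz_col Z j a b = 0) /\
  (forall j, (j < k)%N -> exists a b, h a = (j + l0)%N /\ toeplitz_col Z j a b != 0).
Proof.
have [l0 Zl0 lead] := leading; exists l0; split.
  move=> j a b; case: (mxtens_indexP a) => a1 a2; case: (mxtens_indexP b) => b1 b2.
  rewrite /h mxtens_indexK /= => ja; rewrite (ord1 b1) toeplitz_colE big1// => l _.
  have [e|] := eqVneq (a1 : nat) (j + l)%N; last by rewrite mul0r.
  have l0l : (l0 < l)%N by rewrite e ltn_add2l in ja.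
  by rewrite lead// mxE mulr0.
move=> j jk.
have [[s b] /= Zsb] : exists sb : 'I_2 * 'I_2, Z l0 sb.1 sb.2 != 0.
  apply/existsP; apply: contraNT Zl0 => /existsPn H; apply/eqP/matrixP => s b.
  by have := H (s, b); rewrite negbK mxE => /eqP.
have jl : (j + l0 < k + 2)%N by rewrite -addSn leq_add// -ltnS ltn_ord.
exists (mxtens_index (Ordinal jl, s)), (mxtens_index (ord0, b)); split; first by rewrite /h mxtens_indexK.
rewrite toeplitz_colE (bigD1 l0)//= eqxx mul1r big1 ?addr0// => l ll0.
rewrite eqn_add2l (_ : (l0 == l :> nat) = false) ?mul0r//; apply/negbTE.
by rewrite eq_sym; apply: contra_neq ll0 => e; exact/val_inj.
Qed.

Lemma toeplitz_residual j : (j < k)%N -> gs_residual (toeplitz_col Z) j != 0.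
Proof.
have [l0 [supp lead]] := toeplitz_echelon.
exact: (gs_residual_neq0 supp lead).
Qed.

Lemma toeplitz_orthonormal i j : (i < k)%N -> (j < k)%N ->
  (gs (toeplitz_col Z) i)^T *m gs (toeplitz_col Z) j = if i == j then 1%:M else 0.
Proof.
have [l0 [supp lead]] := toeplitz_echelon.
apply: (gs_orthonormal (stdJT R (k + 2)) _ supp lead) => j'.
exact: toeplitz_clin.
Qed.

End nonzero.

Definition pad : 'M[R]_(n, N) := pid_mx N.

(** C^(k+2) takes 2 k + 4 real dimensions: the construction of the plane uses the bound on [n]
    here. *)
Lemma padT_pad : pad^T *m pad = 1%:M.
Proof.
have Nn : (N <= n)%N by rewrite mulnDl.
rewrite /pad tr_pid_mx mul_pid_mx minnn (minn_idPr Nn); exact: pid_mx_1.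
Qed.

Definition slot (j : 'I_k) : 'M[R]_(1 * 2, k * 2) := (delta_mx 0 j : 'rV[R]_k) *t 1%:M.

Definition embed Z : 'M[R]_(n, k * 2) := pad *m \sum_(j < k) gs (toeplitz_col Z) j *m slot j.

Lemma slotT_slot : \sum_j (slot j)^T *m slot j = 1%:M.
Proof.
rewrite -(tensmx11 R k) [X in _ = X *t _]matrix_sum_delta.
have -> : \sum_i \sum_j (1%:M : 'M[R]_k) i j *: delta_mx i j = \sum_i delta_mx i i.
  apply: eq_bigr => i _; rewrite (bigD1 i)//= mxE eqxx scale1r big1 ?addr0// => j ij.
  by rewrite mxE eq_sym (negPf ij) scale0r.
apply/matrixP => a b; rewrite [RHS]mxE !summxE mulr_suml; apply: eq_bigr => j _.
by rewrite /slot trmx_tens tensmx_mul trmx_delta mul_delta_mx trmx1 mulmx1 [LHS]mxE.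
Qed.

Lemma embed_stiefel Z : (forall l, r *m Z l = Z l *m r) -> (exists l, Z l != 0) ->
  (embed Z)^T *m embed Z = 1%:M.
Proof.
move=> Zr Z0; rewrite /embed trmx_mul mulmxA -(mulmxA _ pad^T) padT_pad mulmx1.
rewrite [(\sum_(_ < _) _)^T]linear_sum /= mulmx_suml -slotT_slot; apply: eq_bigr => i _ /=.
rewrite mulmx_sumr (bigD1 i)//= big1 ?addr0 => [|j ji].
  by rewrite trmx_mul mulmxA -(mulmxA _ _ (gs _ i)) toeplitz_orthonormal// eqxx mulmx1.
rewrite trmx_mul mulmxA -(mulmxA _ _ (gs _ j)) toeplitz_orthonormal//.
rewrite (_ : (i == j :> nat) = false) ?mulmx0 ?mul0mx//; apply/negbTE.
by rewrite eq_sym; apply: contra_neq ji => e; exact/val_inj.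
Qed.

(** A common unit complex factor of the homogeneous coordinates moves the frame along its circle
    orbit. Hence CP^2 maps to the quotient, with the circle bundle pulling back to the tautological
    one. *)
Lemma embed_rot Z g : g *m g^T = 1%:M ->
  embed (fun l => Z l *m g) = embed Z *m ((1%:M : 'M[R]_k) *t g).
Proof.
move=> gg; rewrite /embed -mulmxA mulmx_suml; congr (_ *m _); apply: eq_bigr => j _.
rewrite toeplitz_rot gs_rot; last first.
  by rewrite trmx_tens tensmx_mul trmx1 mulmx1 gg tensmx11.
by rewrite -!mulmxA /slot !tensmx_mul !mul1mx !mulmx1.
Qed.

Lemma embed_smooth (m : nat) (Z : 'rV[R]_m -> 'I_3 -> 'M[R]_2) :
  (forall l, msmooth (fun x => Z x l)) -> (forall x l, r *m Z x l = Z x l *m r) ->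
  (forall x, exists l, Z x l != 0) -> msmooth (fun x => embed (Z x)).
Proof.
move=> sZ Zr Z0; apply: msmoothM; first exact: msmooth_cst.
have sc j s a b : Cr_on s setT (fun x => toeplitz_col (Z x) j a b).
  case: (mxtens_indexP a) => a1 a2; case: (mxtens_indexP b) => b1 b2; rewrite (ord1 b1).
  apply: (@Cr_on_eq _ _ _ _ (fun x => \sum_(l < 3) (a1 == j + l :> nat)%:R * Z x l a2 b2)).
  - exact: openT.
  - by move=> x _; rewrite toeplitz_colE.
  - apply: smooth_sum => l; apply: smoothM; [exact: smooth_cst|exact: sZ].
move=> a b; rewrite (_ : (fun x => _) = fun x => \sum_(j < k) (gs (toeplitz_col (Z x)) j *m slot j) a b); last first.
  by apply/funext => x; rewrite summxE.
apply: smooth_sum => j; have sg : msmooth (fun x => gs (toeplitz_col (Z x)) j).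
  move=> s t q.
  apply: (@Cr_on_gs _ _ _ (fun j x => toeplitz_col (Z x) j) sc k q) => // x j' jk.
  exact: toeplitz_residual.
by apply: (msmoothM sg (@msmooth_cst R m _ _ (slot j))).
Qed.

End toeplitz.

(** * Polar coordinates on the projective plane *)

Section path.
Variables (R : realType) (n k : nat).
Hypothesis hn : (k * 2 + 4 <= n)%N.
Notation E := 'rV[R]_4.
Implicit Types x : E.

Definition turn (t : R) : 'M[R]_2 := rotJ (rot90 R) (cos t) (sin t).

(* Coordinates [(r, psi, u, phi)] on CP^2: the point with homogeneous coordinates
   [cos r : sin r cos u e^(i psi) : sin r sin u e^(i (psi + phi))]. *)
Definition cp2 x (l : 'I_3) : 'M[R]_2 :=
  if l == 0 then cos (x 0 0) *: 1%:M
  else if l == 1 then (sin (x 0 0) * cos (x 0 2)) *: turn (x 0 1)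
  else (sin (x 0 0) * sin (x 0 2)) *: turn (x 0 1 + x 0 3).

Lemma turnD s t : turn (s + t) = turn s *m turn t.
Proof.
rewrite /turn mul_rotJ /rotJ mulmxDl mul_scalar_mx -scalemxAl rot90_sqr cosD sinD.
by apply/matrixP => i j; rewrite !mxE; ring.
Qed.

Lemma turn_orthogonal t : turn t *m (turn t)^T = 1%:M.
Proof.
apply: mulmx1C; rewrite /turn rotJ_TM ?rot90T ?rot90_sqr//.
by rewrite cos2Dsin2.
Qed.

Lemma turn_comm t : rot90 R *m turn t = turn t *m rot90 R.
Proof.
by rewrite /turn /rotJ mulmxDl mulmxDr mul_mx_scalar mul_scalar_mx -scalemxAr -scalemxAl.
Qed.

Lemma turn_neq0 t : turn t != 0.
Proof.
apply/negP => /eqP t0; have := turn_orthogonal t; rewrite t0 mul0mx => /matrixP/(_ 0 0).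
by rewrite !mxE eqxx => /eqP; rewrite eq_sym oner_eq0.
Qed.

Lemma cp2_comm x l : rot90 R *m cp2 x l = cp2 x l *m rot90 R.
Proof.
rewrite /cp2; case: ifP => _; last case: ifP => _; rewrite -scalemxAr -scalemxAl ?turn_comm//.
by rewrite mulmx1 mul1mx.
Qed.

Lemma cp2_neq0 x : exists l, cp2 x l != 0.
Proof.
have [c0|c0] := eqVneq (cos (x 0 0)) 0; last first.
  exists 0; rewrite /cp2 eqxx scaler_eq0 negb_or c0; exact: matrix_nonzero1.
have s0 : sin (x 0 0) != 0.
  apply/eqP => s0; have := cos2Dsin2 (x 0 0); rewrite c0 s0 !expr0n addr0 => /eqP.
  by rewrite eq_sym oner_eq0.
have [cu|cu] := eqVneq (cos (x 0 2)) 0; last first.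
  by exists 1; rewrite /cp2 /= scaler_eq0 negb_or mulf_neq0// turn_neq0.
exists 2; rewrite /cp2 /= scaler_eq0 negb_or turn_neq0 andbT mulf_neq0//.
apply/eqP => s0u; have := cos2Dsin2 (x 0 2); rewrite cu s0u !expr0n addr0 => /eqP.
by rewrite eq_sym oner_eq0.
Qed.

Lemma smooth_cos_sin (f : E -> R) : smooth_on setT f ->
  smooth_on setT (fun x => cos (f x)) /\ smooth_on setT (fun x => sin (f x)).
Proof. by move=> sf; split=> r; have [] := @Cr_on_cos_sin _ _ r _ _ openT (sf r). Qed.

Lemma smooth_entry i : smooth_on setT (fun x : E => x 0 i).
Proof. by move=> r; exact: Cr_on_coord. Qed.

Lemma msmooth_cp2 l : msmooth (fun x => cp2 x l).
Proof.
have [c0 s0] := smooth_cos_sin (smooth_entry 0).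
have [c2 s2] := smooth_cos_sin (smooth_entry 2).
have turn_smooth (f : E -> R) : smooth_on setT f -> msmooth (fun x => turn (f x)).
  move=> /smooth_cos_sin[cf sf] i j.
  rewrite (_ : (fun x => _) = fun x => cos (f x) * (i == j)%:R + sin (f x) * rot90 R i j).
    by apply: smoothD; apply: smoothM => //; exact: smooth_cst.
  by apply/funext => x; rewrite /turn /rotJ 2!mxE [X in _ + X]mxE mulr_natr.
have scale_smooth (f : E -> R) (F : E -> 'M[R]_2) : smooth_on setT f -> msmooth F ->
    msmooth (fun x => f x *: F x).
  move=> sf sF i j; rewrite (_ : (fun x => _) = fun x => f x * F x i j); first exact: smoothM.
  by apply/funext => x; rewrite mxE.
rewrite /cp2; case: (l == 0); first by apply: scale_smooth => //; exact: msmooth_cst.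
case: (l == 1); apply: scale_smooth; try exact: smoothM; apply: turn_smooth.
  exact: smooth_entry.
by apply: smoothD; exact: smooth_entry.
Qed.

Definition path x : 'M[R]_(n, k * 2) := embed n k (cp2 x).

Lemma path_stiefel x : (path x)^T *m path x = 1%:M.
Proof. by apply: embed_stiefel => //; [exact: cp2_comm|exact: cp2_neq0]. Qed.

Lemma path_smooth : msmooth path.
Proof. by apply: embed_smooth; [exact: msmooth_cp2|exact: cp2_comm|exact: cp2_neq0]. Qed.

Let path_eq x y : (forall l, cp2 x l = cp2 y l) -> path x = path y.
Proof. by move=> H; rewrite /path (_ : cp2 x = cp2 y)//; exact/funext. Qed.

Lemma turn2pi t : turn (t + 2 * pi) = turn t.
Proof. by rewrite /turn mulr_natl cosD2pi sinD2pi. Qed.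

Lemma path_per1 x : path (x + (2 * pi) *: delta_mx 0 1) = path x.
Proof.
apply: path_eq => l; rewrite /cp2 !mxE /= ?mulr0 ?mulr1 !addr0.
by rewrite turn2pi addrAC turn2pi.
Qed.

Lemma path_per3 x : path (x + (2 * pi) *: delta_mx 0 3) = path x.
Proof.
apply: path_eq => l; rewrite /cp2 !mxE /= ?mulr0 ?mulr1 !addr0.
by rewrite addrA turn2pi.
Qed.

Lemma path_r0 x h : x 0 0 = 0 -> path (h *: delta_mx 0 1 + x) = path x.
Proof.
move=> x0; apply: path_eq => l; rewrite /cp2 !mxE /= ?mulr0 ?mulr1 !add0r x0 sin0.
by rewrite !mul0r !scale0r.
Qed.

Lemma path_u0 x h : x 0 2 = 0 -> path (h *: delta_mx 0 3 + x) = path x.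
Proof.
move=> x0; apply: path_eq => l; rewrite /cp2 !mxE /= ?mulr0 ?mulr1 !add0r x0 sin0.
by rewrite !mulr0 !scale0r.
Qed.

(** The middle coordinate vanishes here, and the last one depends on psi + phi only. *)
Lemma path_u1 x h : x 0 2 = pi / 2 -> path (h *: (delta_mx 0 3 - delta_mx 0 1) + x) = path x.
Proof.
move=> x0; apply: path_eq => l; rewrite /cp2 !mxE /= ?subr0 ?sub0r ?mulr0 ?mulr1 ?subrr ?mulr0 !add0r x0 cos_pihalf.
by rewrite !mulr0 !scale0r; case: ifP => // _; case: ifP => // _; congr (_ *: turn _); ring.
Qed.

(** On the line at infinity the first coordinate vanishes, and a shift of psi is a common phase of
    the other two. *)
Lemma path_r1 x h : x 0 0 = pi / 2 ->
  path (h *: delta_mx 0 1 + x) = path x *m rotJ (stdJ R k) (cos h) (sin h).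
Proof.
move=> x0; rewrite /path -tens_rotJ -embed_rot; last exact: turn_orthogonal.
congr embed; apply/funext => l; rewrite /cp2 !mxE /= ?mulr0 ?mulr1 !add0r x0 cos_pihalf.
case: ifP => _; first by rewrite !scale0r mul0mx.
case: ifP => _; rewrite -scalemxAl -turnD.
  by rewrite (addrC h).
by rewrite -addrA addrC.
Qed.

End path.

Section smooth_matrices.
Variables (R : realType) (m : nat).
Notation E := 'rV[R]_m.

Lemma partial_trig i (f : E -> R) x (a b : R) : smooth_on setT f ->
  (forall h, f (h *: delta_mx 0 i + x) = cos h * a + sin h * b) -> partial i f x = b.
Proof.
move=> sf H; rewrite partial.unlock.
have fx : (0 : R) *: delta_mx 0 i + x = x by rewrite scale0r add0r.
have d0 : differentiable f ((0 : R) *: delta_mx 0 i + x) by exact: smooth_diff.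
have [_ D1] := is_derive_line d0.
have D2 : is_derive (0 : R) (1 : R) (fun h : R => f (h *: delta_mx 0 i + x)) b.
  have -> : (fun h : R => f (h *: delta_mx 0 i + x)) = (fun h => cos h * a + sin h * b).
    exact/funext.
  apply: is_derive_eq; rewrite cos0 sin0 /GRing.scale /=; ring.
have [_ E2] := D2.
have E3 := etrans (esym D1) E2.
by rewrite fx in E3.
Qed.

Lemma smooth_prod (I : Type) (s : seq I) (F : I -> E -> R) :
  (forall l, smooth_on setT (F l)) -> smooth_on setT (fun x => \prod_(l <- s) F l x).
Proof. by move=> sF r; apply: Cr_on_prod; [exact: openT|move=> l _; exact: sF]. Qed.

Lemma smooth_det a (F : E -> 'M[R]_a) : msmooth F -> smooth_on setT (fun x => \det (F x)).
Proof.
move=> sF; apply: smooth_sum => s; apply: smoothM; first exact: smooth_cst.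
by apply: smooth_prod => i; exact: sF.
Qed.

Lemma msmooth_adj a (F : E -> 'M[R]_a) : msmooth F -> msmooth (fun x => \adj (F x)).
Proof.
move=> sF i j; rewrite (_ : (fun x => _) = fun x => (-1) ^+ (j + i) * \det (row' j (col' i (F x)))).
  apply: smoothM; first exact: smooth_cst.
  apply: smooth_det => s t; rewrite (_ : (fun x => _) = fun x => F x (lift j s) (lift i t)).
    exact: sF.
  by apply/funext => x; rewrite !mxE.
by apply/funext => x; rewrite mxE.
Qed.

Lemma msmooth_invmx a (F : E -> 'M[R]_a) : msmooth F -> (forall x, F x \in unitmx) ->
  msmooth (fun x => invmx (F x)).
Proof.
move=> sF uF i j; rewrite (_ : (fun x => _) = fun x => (\det (F x))^-1 * \adj (F x) i j).
  apply: smoothM; last exact: msmooth_adj.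
  move=> r; apply: Cr_onV; [exact: openT| |exact: smooth_det].
  by move=> x _; have := uF x; rewrite unitmxE unitfE.
by apply/funext => x; rewrite /invmx uF mxE.
Qed.

Lemma msmooth_trmx a b (F : E -> 'M[R]_(a, b)) : msmooth F -> msmooth (fun x => (F x)^T).
Proof.
move=> sF i j; rewrite (_ : (fun x => _) = fun x => F x j i); first exact: sF.
by apply/funext => x; rewrite mxE.
Qed.

Lemma msmooth_col_mx a1 a2 b (F : E -> 'M[R]_(a1, b)) (G : E -> 'M[R]_(a2, b)) :
  msmooth F -> msmooth G -> msmooth (fun x => col_mx (F x) (G x)).
Proof.
move=> sF sG i j; case: (split_ordP i) => l ->.
  rewrite (_ : (fun x => _) = fun x => F x l j); first exact: sF.
  by apply/funext => x; rewrite col_mxEu.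
rewrite (_ : (fun x => _) = fun x => G x l j); first exact: sG.
by apply/funext => x; rewrite col_mxEd.
Qed.

End smooth_matrices.

(** * The trivialization induced by a frame *)

Section pseudo_inverse.
Variables (R : realType) (a b : nat) (A : 'M[R]_(a, b)) (Pi : 'M[R]_a).
Hypotheses (PiT : Pi^T = Pi) (PiA : Pi *m A = A).
Hypothesis surj : forall u : 'rV[R]_b, exists y, y *m A = u.
Hypothesis inj : forall y : 'rV[R]_a, y *m A = 0 -> y *m Pi = 0.

(** Matrices act on row vectors, so [surj] means that [A] has full column rank. *)
Lemma gram_unit : A^T *m A \in unitmx.
Proof.
rewrite -row_free_unit; apply: inj_row_free => v; rewrite mulmxA => v0.
have vA : v *m A^T = 0.
  have : dotm (v *m A^T)^T (v *m A^T)^T = 0.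
    by rewrite /dotm trmxK trmx_mul trmxK mulmxA v0 mul0mx mxtrace0.
  by move=> /dotm_eq0 /(congr1 trmx); rewrite trmxK trmx0.
have [y yA] := surj v.
have : dotm v^T v^T = 0 by rewrite /dotm trmxK -{2}yA trmx_mul mulmxA vA mul0mx mxtrace0.
by move=> /dotm_eq0 /(congr1 trmx); rewrite trmxK trmx0.
Qed.

Definition pinv : 'M[R]_(b, a) := invmx (A^T *m A) *m A^T.

Lemma pinvK : pinv *m A = 1%:M.
Proof. by rewrite /pinv -mulmxA mulVmx// gram_unit. Qed.

(** Both A [pinv] and [Pi] are symmetric, and each absorbs the other: A [pinv] Pi = Pi by [inj], and
    Pi A [pinv] = A [pinv]. Transposing the second identity makes them equal. *)
Lemma mul_pinv : A *m pinv = Pi.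
Proof.
have symA : (A *m pinv)^T = A *m pinv.
  by rewrite /pinv mulmxA !trmx_mul trmxK trmx_inv trmx_mul trmxK mulmxA.
have key : A *m pinv *m Pi = Pi.
  apply/eqP; rewrite -subr_eq0 -[X in _ - X]mul1mx -mulmxBl; apply/eqP/row_matrixP => i.
  rewrite row_mul row0; apply: inj.
  by rewrite -row_mul mulmxBl -mulmxA pinvK mulmx1 mul1mx subrr row0.
have : Pi *m (A *m pinv) = A *m pinv by rewrite mulmxA PiA.
by move=> E; rewrite -symA -E trmx_mul symA PiT.
Qed.

End pseudo_inverse.

Section linear_operators.
Variables (R : realType) (d : nat).

Lemma trace_lin_mx (f : {linear 'M[R]_d -> 'M[R]_d}) :
  \tr (lin_mx f) = \sum_i \sum_j f (delta_mx i j) i j.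
Proof.
rewrite pair_bigA /mxtrace (reindex _ (curry_mxvec_bij d d)) /=.
apply: eq_bigr => -[i j] _ /=.
by rewrite /lin_mx /lin1_mx mxE /= vec_mx_delta mxvecE.
Qed.

Variable J : 'M[R]_d.
Hypotheses (JT : J^T = - J) (JJ : J *m J = - 1%:M).

Definition ad (S : 'M[R]_d) : 'M[R]_d := S *m J - J *m S.

Fact ad_linear : linear ad.
Proof.
move=> c S T; rewrite /ad mulmxDl mulmxDr -scalemxAl -scalemxAr opprD scalerBr.
by rewrite addrACA.
Qed.
HB.instance Definition _ := GRing.isLinear.Build R _ _ _ ad ad_linear.

Fact symm_linear : linear (@symm R d).
Proof. by move=> c S T; apply/matrixP => i j; rewrite !mxE; ring. Qed.
HB.instance Definition _ := GRing.isLinear.Build R _ _ _ (@symm R d) symm_linear.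

Lemma lin_mx_mul (f g : {linear 'M[R]_d -> 'M[R]_d}) :
  lin_mx f *m lin_mx g = lin_mx (g \o f).
Proof.
apply/row_matrixP => i; rewrite !rowE mulmxA !mul_rV_lin mxvecK.
by rewrite /=.
Qed.

Lemma lin_mx_symmT : (lin_mx (@symm R d))^T = lin_mx (@symm R d).
Proof.
apply/matrixP => i j; rewrite mxE.
case/mxvec_indexP: i => i1 i2; case/mxvec_indexP: j => j1 j2.
rewrite !mxE /= !vec_mx_delta !mxvecE !mxE.
by rewrite (eq_sym j1) (eq_sym j2 i2) (eq_sym j2) (eq_sym j1) [(i1 == j2) && _]andbC.
Qed.

(** Composing with [symm] restricts the trace to symmetric matrices. There ad(J)^2 S = -2 S - 2 J S
    J; the first term contributes -d (d + 1), the second -d, because tr J = 0 and |J|^2 = d. *)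
Lemma trace_ad_sq : \tr (lin_mx ad *m lin_mx ad *m lin_mx (@symm R d)) = - (d%:R ^+ 2 + 2 * d%:R).
Proof.
rewrite !lin_mx_mul trace_lin_mx.
have E S : symm (ad (ad S)) = - (S + S^T) - (J *m S *m J + J *m S^T *m J).
  have -> : ad (ad S) = - 2 *: S - 2 *: (J *m S *m J).
    rewrite /ad mulmxBl mulmxBr (mulJJ JJ) !mulmxA JJ mulNmx mul1mx.
    by move: (J *m S *m J) => T; apply/matrixP => i j; rewrite !mxE; ring.
  rewrite /symm; have -> : (- 2 *: S - 2 *: (J *m S *m J))^T = - 2 *: S^T - 2 *: (J *m S^T *m J).
    have JSJ : (J *m S *m J)^T = J *m S^T *m J.
      by rewrite !trmx_mul JT !mulmxN mulNmx opprK mulmxA.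
    rewrite -JSJ; move: (J *m S *m J) => T; by apply/matrixP => i j; rewrite !mxE.
  move: (J *m S *m J) (J *m S^T *m J) => T1 T2; apply/matrixP => i j; rewrite !mxE; lra.
have JdJ (i j s t : 'I_d) : (J *m delta_mx i j *m J) s t = J s i * J j t.
  rewrite mxE (bigD1 j)//= big1 ?addr0 => [|l lj]; last first.
    by rewrite mxE big1 ?mul0r// => q _; rewrite mxE (negPf lj) andbF mulr0.
  rewrite mxE (bigD1 i)//= mxE !eqxx mulr1 big1 ?addr0// => q qi.
  by rewrite mxE (negPf qi) mulr0.
have Ed (i j : 'I_d) : symm (ad (ad (delta_mx i j))) i j =
    - (1 + (i == j)%:R) - (J i i * J j j + J i j * J i j).
  rewrite E trmx_delta; move: (JdJ i j i j) (JdJ j i i j).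
  move: (J *m delta_mx i j *m J) (J *m delta_mx j i *m J) => T1 T2 e1 e2.
  by rewrite !mxE e1 e2 !eqxx (eq_sym j) (andbb (i == j)).
transitivity (\sum_i \sum_j (- (1 + (i == j)%:R) - (J i i * J j j + J i j * J i j))).
  by apply: eq_bigr => i _; apply: eq_bigr => j _; rewrite -Ed.
have dd : \sum_(i < d) (1 : R) = d%:R by rewrite sumr_const card_ord.
have tr2 : \sum_(i < d) \sum_(j < d) J i i * J j j = 0.
  under eq_bigr do rewrite -mulr_sumr; rewrite -mulr_suml.
  by rewrite -[\sum_(i < d) J i i]/(\tr J) trJ0 ?mul0r.
have JJ2 : \sum_(i < d) \sum_(j < d) J i j * J i j = d%:R.
  by rewrite -dotmE /dotm JT_J// mxtrace1.
have d1 : \sum_(i < d) \sum_(j < d) (i == j)%:R = d%:R :> R.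
  rewrite -[RHS]dd; apply: eq_bigr => i _; rewrite (bigD1 i)//= eqxx big1 ?addr0// => j ji.
  by rewrite eq_sym (negPf ji).
have d2 : \sum_(i < d) \sum_(j < d) (1 : R) = d%:R ^+ 2.
  by under eq_bigr do rewrite dd; rewrite sumr_const card_ord -[LHS]mulr_natr.
transitivity (- (\sum_(i < d) \sum_(j < d) (1 : R) + \sum_(i < d) \sum_(j < d) (i == j)%:R) -
    (\sum_(i < d) \sum_(j < d) J i i * J j j + \sum_(i < d) \sum_(j < d) J i j * J i j)).
  rewrite -!big_split /= -sumrN -sumrB; apply: eq_bigr => i _.
  by rewrite -!big_split /= -sumrN -sumrB; apply: eq_bigr => j _.
by rewrite d2 d1 tr2 JJ2; ring.
Qed.

End linear_operators.

Section tangent_space.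
Variables (R : realType) (n d : nat) (p : 'M[R]_(n, d)).

Lemma tangentD u v : tangent p u -> tangent p v -> tangent p (u + v).
Proof.
rewrite /tangent => hu hv; rewrite mulmxDr [(u + v)^T]linearD /= mulmxDl addrACA hu hv.
exact: addr0.
Qed.

Lemma tangentZ c u : tangent p u -> tangent p (c *: u).
Proof.
rewrite /tangent => hu; rewrite [(c *: u)^T]linearZ /= -scalemxAl -scalemxAr -scalerDr hu.
exact: scaler0.
Qed.

Lemma tangent_sum (I : Type) (s : seq I) (F : I -> 'M[R]_(n, d)) :
  (forall i, tangent p (F i)) -> tangent p (\sum_(i <- s) F i).
Proof.
move=> H; elim/big_rec: _ => [|i u _]; last by apply: tangentD.
by rewrite /tangent trmx0 mulmx0 mul0mx addr0.
Qed.

End tangent_space.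

(** * The trivialization over the projective plane and its charges *)

Section trivialization.
Variables (R : realType) (n k : nat).
Hypotheses (k0 : (0 < k)%N) (hn : (k * 2 + 4 <= n)%N).
Notation d := (k * 2)%N.
Notation J := (stdJ R k).
Notation M := 'M[R]_(n, k * 2).
Notation V := (@stiefel R n (k * 2)).
Notation Y := (circle_quotient R n k).
Notation C := (@smooth_circle_quotient R n k).
Notation E := 'rV[R]_4.
Variables (m : nat) (X : 'I_m -> (Y -> R) -> Y -> R).
Hypothesis HX : smooth_global_frame C X.

(** The parameter [T] covers both the frame itself and its derivative along the circle, where every
    vector is multiplied by J. *)
Definition shifted_frame (T : M -> M) (q : V) : 'M[R]_(m + 1 + d * d, n * d) :=
  col_mx (col_mx (\matrix_(i < m) mxvec (T (frame_vec X i q))) (mxvec (T (val q *m J))))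
         (lin_mx (mulmx (T (val q)) \o @symm R d)).

(* The trivialization of the trivial bundle with fibre M by the frame, the
   vertical vector [p J] and the normal vectors [p S], [S] symmetric. *)
Definition full_frame := shifted_frame id.

(** Symmetric matrices are coordinatized by all d * d entries; this projector accounts for the
    redundancy and is the constant [Pi] of the closed form. *)
Definition sym_proj : 'M[R]_(m + 1 + d * d) := block_mx 1%:M 0 0 (lin_mx (@symm R d)).

Definition weight1 : 'M[R]_(m + 1 + d * d) := block_mx 0 0 0 (lin_mx (ad J)).

Definition weight2 : 'M[R]_(n * d) := lin_mx (@mulmxr R n d d J).

Lemma sym_projT : sym_proj^T = sym_proj.
Proof. by rewrite /sym_proj tr_block_mx !trmx0 trmx1 lin_mx_symmT. Qed.

Lemma comb_full_frame (q : V) (c : 'rV[R]_m) (c0 : 'rV[R]_1) (s : 'rV[R]_(d * d)) :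
  row_mx (row_mx c c0) s *m full_frame q =
  mxvec (\sum_i c 0 i *: frame_vec X i q + c0 0 0 *: (val q *m J) + val q *m symm (vec_mx s)).
Proof.
rewrite /full_frame /shifted_frame !mul_row_col mul_rV_lin /= !linearD /=; congr (_ + _ + _).
  rewrite mulmx_sum_row linear_sum; apply: eq_bigr => i _.
  by rewrite rowK [RHS]linearZ.
by rewrite {1}[c0]mx11_scalar mul_scalar_mx linearZ.
Qed.

Section at_point.
Variable q : V.
Let p0 := val q.
Let pV : p0^T *m p0 = 1%:M.
Proof. by have /set_mem := valP q. Qed.

Lemma full_frame_surj (u : 'rV[R]_(n * d)) : exists y, y *m full_frame q = u.
Proof.
have tg := tangent_decomp (vec_mx u : M) pV.
have [c [c0 E1]] := frame_span k0 HX tg.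
exists (row_mx (row_mx c c0%:M) (mxvec (p0^T *m vec_mx u))).
rewrite comb_full_frame mxvecK [c0%:M 0 0]mxE eqxx mulr1n -E1.
by rewrite subrK vec_mxK.
Qed.

(** Tangent and normal parts separate, and the vertical vector is orthogonal to the lifted frame.
    The only relations among the rows thus come from skew matrices in the last block. *)
Lemma full_frame_inj (y : 'rV[R]_(m + 1 + d * d)) : y *m full_frame q = 0 -> y *m sym_proj = 0.
Proof.
rewrite -[y]hsubmxK -[lsubmx y]hsubmxK; move: (lsubmx (lsubmx y)) (rsubmx (lsubmx y)) (rsubmx y).
move=> c c0 s; rewrite comb_full_frame => /(congr1 vec_mx); rewrite mxvecK linear0 => E0.
have tJ : tangent p0 (p0 *m J) by apply: tangent_J => //; exact: stdJT.
have tt : tangent p0 (\sum_i c 0 i *: frame_vec X i q + c0 0 0 *: (p0 *m J)).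
  apply: tangentD; last exact: tangentZ.
  by apply: tangent_sum => i; apply: tangentZ; exact: frame_vec_tangent.
have [t0 S0] := tangent_normal pV tt E0.
have c00 : c0 0 0 = 0.
  have := congr1 (dotm (p0 *m J)) t0; rewrite dotmDr dotmZr (dotmJJ (stdJT R k) (stdJJ R k)).
  rewrite (dotm_stiefel pV) (_ : dotm _ (\sum_i _) = 0); last first.
    elim/big_rec: _ => [|i u _ IH]; first by rewrite /dotm mulmx0 mxtrace0.
    by rewrite dotmDr IH dotmZr frame_vec_dotJ// mulr0 addr0.
  rewrite /dotm mulmx0 mxtrace0 add0r => /eqP.
  by rewrite mulf_eq0 pnatr_eq0 muln_eq0 -(negbK (k == 0)%N) -lt0n k0 /= orbF => /eqP.
have c_0 : c = 0.
  by apply: (frame_free k0 HX (p := q)); move: t0; rewrite c00 scale0r addr0.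
rewrite /sym_proj mul_row_block !mulmx0 addr0 add0r mulmx1 mul_rV_lin /= S0 linear0 c_0.
by rewrite [c0]mx11_scalar c00 raddf0 !row_mx0.
Qed.

Lemma sym_proj_frame : sym_proj *m full_frame q = full_frame q.
Proof.
rewrite /sym_proj /full_frame /shifted_frame mul_block_col !mul0mx mul1mx addr0 add0r.
congr (col_mx _ _); apply/row_matrixP => i; rewrite row_mul !rowE -mulmxA.
rewrite mulmxA !mul_rV_lin /= mxvecK symm_id//; exact: tr_symm.
Qed.

(* Infinitesimal equivariance under the circle. *)
Lemma shifted_frame_J :
  shifted_frame (mulmx^~ J) q = full_frame q *m weight2 - weight1 *m full_frame q.
Proof.
rewrite /full_frame /shifted_frame /weight1 /weight2 mul_block_col !mul0mx !add0r.
rewrite !mul_col_mx opp_col_mx oppr0 add_col_mx addr0; congr (col_mx (col_mx _ _) _).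
- apply/row_matrixP => i; rewrite row_mul !rowK mul_vec_lin; congr mxvec.
- by rewrite mul_vec_lin.
- apply/row_matrixP => i; rewrite linearB /= !row_mul !rowE -!mulmxA !mulmxA.
  rewrite !mul_rV_lin /= !mxvecK -linearB; congr mxvec.
  move: (vec_mx _) => S.
  have -> : symm (ad J S) = symm S *m J - J *m symm S.
    rewrite /ad /symm -scalemxAl -scalemxAr -scalerBr mulmxDl mulmxDr.
    rewrite [(S *m J - _)^T]linearB /= !trmx_mul (stdJT R k) mulNmx mulmxN opprK.
    by congr (_ *: _); rewrite opprD [RHS]addrACA; congr (_ + _); rewrite addrC.
  by rewrite mulmxBr !mulmxA opprB addrCA subrr addr0.
Qed.

End at_point.

Let pathV_mem (x : E) : path n k x \in V.
Proof. by apply/mem_set; exact: path_stiefel. Qed.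

Definition pathV (x : E) : V := exist (fun z => z \in V) _ (pathV_mem x).

Lemma pathV_eq x y : path n k x = path n k y -> pathV x = pathV y.
Proof. by move=> H; apply/val_inj. Qed.

Let sp := @path_smooth R n k.

Lemma C_path_smooth g : C g -> smooth_on setT (fun x => g (circle_proj (pathV x))).
Proof.
move=> Cg r; apply: Cr_on_local => x _.
have [U [G [oU Ux sG gG]]] := Cg (pathV x).
have cp : continuous (fun x : E => path n k x : M).
  move=> y; rewrite (_ : (fun x => _) = fun x => \sum_(ij : 'I_n * 'I_d) path n k x ij.1 ij.2 *: delta_mx ij.1 ij.2).
    by apply: continuous_sumZ => ij; exact: (sp ij.1 ij.2 0%N).
  by apply/funext => z; rewrite {1}[path n k z]matrix_sum_delta pair_bigA.
have oW : open ((fun x : E => path n k x : M) @^-1` U).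
  by apply: open_comp => // y _; exact: cp.
exists ((fun x : E => path n k x : M) @^-1` U); split => //.
apply: (Cr_on_eq (f := fun x => G (path n k x))) => //.
  by move=> y Uy; rewrite -[LHS](gG (pathV y)).
apply: (Cr_on_comp_mx (W := U)) => //.
  by move=> i j; exact: Cr_on_sub (sp i j r).
Qed.

Lemma full_frame_smooth : msmooth (fun x => full_frame (pathV x)).
Proof.
rewrite /full_frame /shifted_frame; apply: msmooth_col_mx; first apply: msmooth_col_mx.
- move=> i j; case/mxvec_indexP: j => a b.
  (* The lift depends on [x] through the frame and through its base point; linearity separates the
     entries of the path from fixed smooth functions on the quotient. *)
  rewrite (_ : (fun x => _) = fun x => d%:R^-1 * \sum_s \sum_t path n k x s t *
      X i (pfun (delta_mx s t) a b) (circle_proj (pathV x))); last first.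
    apply/funext => x; rewrite mxE mxvecE.
    exact: (lift_entry (frame_tangent HX i (circle_proj (pathV x)))).
  apply: smoothM; first exact: smooth_cst.
  apply: smooth_sum => s; apply: smooth_sum => t; apply: smoothM; first exact: sp.
  apply: C_path_smooth; have [/(_ i)[_ H] _] := HX; apply: H; exact: C_pfun.
- move=> i j; case/mxvec_indexP: j => a b.
  rewrite (_ : (fun x => _) = fun x => (path n k x *m J) a b).
    by apply: (msmoothM sp (@msmooth_cst R 4 _ _ J)).
  by apply/funext => x; rewrite (ord1 i) mxvecE.
- move=> i j; case/mxvec_indexP: i => s t; case/mxvec_indexP: j => a b.
  rewrite (_ : (fun x => _) = fun x => (path n k x *m symm (delta_mx s t)) a b).
    by apply: (msmoothM sp (@msmooth_cst R 4 _ _ (symm (delta_mx s t)))).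
  by apply/funext => x; rewrite /lin_mx /lin1_mx mxE /= mxvecE vec_mx_delta.
Qed.

Lemma lin_mx_symm_comb a b (P Q : M) :
  lin_mx (mulmx (a *: P + b *: Q) \o @symm R d) =
  a *: lin_mx (mulmx P \o @symm R d) + b *: lin_mx (mulmx Q \o @symm R d).
Proof.
apply/row_matrixP => i; rewrite !rowE mulmxDr -!scalemxAr !mul_rV_lin /=.
by move: (symm _) => S; rewrite mulmxDl -!scalemxAl linearD !linearZ.
Qed.

(** Here psi moves the representative without moving the point of the quotient, and every row is
    real linear in the representative. *)
Lemma full_frame_turn (x : E) h : x 0 0 = pi / 2 ->
  full_frame (pathV (h *: delta_mx 0 1 + x)) =
  cos h *: full_frame (pathV x) + sin h *: shifted_frame (mulmx^~ J) (pathV x).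
Proof.
move=> x0; set q := pathV x; set q' := pathV _.
have vq : val q' = val q *m rotJ J (cos h) (sin h) by exact: path_r1.
have pq : circle_proj q' = circle_proj q by apply/esym/(circle_proj_eq (cos2Dsin2 h)).
have mxvec_comb a b (A B : M) : mxvec (a *: A + b *: B) = a *: mxvec A + b *: mxvec B.
  by rewrite linearD !linearZ.
rewrite /full_frame /shifted_frame !scale_col_mx !add_col_mx; congr (col_mx (col_mx _ _) _).
- apply/row_matrixP => i; rewrite [RHS]linearD /= ![row i (_ *: _)]linearZ /= !rowK -mxvec_comb.
  by rewrite /frame_vec pq vq (lift_rotJ (frame_tangent HX i (circle_proj q))) mul_rotJ.
- by rewrite vq mul_rotJ [X in mxvec X]mulmxDl -!scalemxAl mxvec_comb.
- by rewrite vq mul_rotJ lin_mx_symm_comb.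
Qed.

Definition side (i : 'I_4) : R := if odd i then 2 * pi else pi / 2.

Lemma side_gt0 i : 0 < side i.
Proof. by rewrite /side; case: ifP => _; rewrite ?mulr_gt0 ?divr_gt0 ?pi_gt0. Qed.

Theorem frame_dimension : n = (d + 2)%N.
Proof.
pose A (x : E) := full_frame (pathV x).
pose B (x : E) := pinv (A x).
have sA : msmooth A by exact: full_frame_smooth.
have uA x : (A x)^T *m A x \in unitmx by apply: gram_unit; exact: full_frame_surj.
have sB : msmooth B.
  have sAT := msmooth_trmx sA.
  by apply: msmoothM => //; apply: msmooth_invmx => //; exact: msmoothM.
have BA x : B x *m A x = 1%:M by apply: pinvK; exact: full_frame_surj.
have AB x : A x *m B x = sym_proj.
  apply: mul_pinv; [exact: sym_projT|exact: sym_proj_frame|exact: full_frame_surj|].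
  exact: full_frame_inj.
have A_eq x y : path n k x = path n k y -> A x = A y by rewrite /A => /pathV_eq ->.
have entry_eq x y s t : path n k x = path n k y -> A x s t = A y s t by move=> /A_eq ->.
have := charge_balance side_gt0 sA sB BA AB (D1 := weight1) (D2 := weight2).
have -> : \tr (weight2 *m weight2) = - (n * d)%:R.
  have -> : weight2 *m weight2 = - 1%:M.
    apply/row_matrixP => i; rewrite rowE mulmxA /weight2 !mul_rV_lin /= mxvecK.
    by rewrite (mulJJ (stdJJ R k)) linearN /= vec_mxK [RHS]linearN /= rowE mulmx1.
  by rewrite linearN /= mxtrace1.
have -> : \tr (weight1 *m weight1 *m sym_proj) = - (d%:R ^+ 2 + 2 * d%:R).
  rewrite /weight1 /sym_proj !mulmx_block !(mul0mx, mulmx0, addr0, add0r) mxtrace_block.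
  by rewrite mxtrace0 add0r trace_ad_sq ?stdJT ?stdJJ.
move=> balance.
have : - (n * d)%:R = - (d%:R ^+ 2 + 2 * d%:R) :> R.
  apply: balance => x.
  - by apply: A_eq; rewrite /side /= path_per1.
  - by apply: A_eq; rewrite /side /= path_per3.
  - by apply: (congr1 (@pinv _ _ _)); apply: A_eq; rewrite /side /= path_per1.
  - by apply: (congr1 (@pinv _ _ _)); apply: A_eq; rewrite /side /= path_per3.
  - move=> x0; apply/matrixP => s t; rewrite !mxE; apply: partial_const_line; first exact: sA.
    by move=> h; apply: entry_eq; exact: path_r0.
  - move=> x0; apply/matrixP => s t; rewrite !mxE; apply: partial_const_line; first exact: sA.
    by move=> h; apply: entry_eq; exact: path_u0.
  - move=> x0; apply/matrixP => s t; rewrite !mxE; apply: partial_diag; first exact: sA.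
    by move=> h; apply: entry_eq; apply: path_u1; rewrite x0.
  - move=> x0; rewrite -shifted_frame_J; apply/matrixP => s t; rewrite mxE.
    apply: (partial_trig (a := A x s t)); first exact: sA.
    move=> h; rewrite /A full_frame_turn ?x0//.
    by rewrite mxE [X in X + _]mxE [X in _ + X]mxE.
move/oppr_inj; rewrite -natrX -natrM -natrD => /eqP; rewrite eqr_nat => /eqP E0.
(* Divide n d = d^2 + 2 d by d > 0. *)
apply/eqP; rewrite -(eqn_pmul2r (m := d)) ?muln_gt0 ?k0// E0.
by rewrite mulnDl mulnn.
Qed.

End trivialization.

Theorem theorem4p1 (R : realType) (n k : nat) :
  (1 <= k)%N -> (4 <= n - 2 * k)%N ->
  ~ parallelizable (@smooth_circle_quotient R n k).
Proof.
move=> k0 nk [m [X HX]].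
have hn : (k * 2 + 4 <= n)%N.
  (* The subtraction is truncated, but a difference of at least 4 > 0 still gives 2 k + 4 <= n. *)
  by rewrite -leq_psubRL // mulnC.
have := frame_dimension k0 hn HX => E; move: hn.
by rewrite {1}E leq_add2l.
Qed.
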